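(* Let $m\in\mathbb{N}$, $s\in(0,m)$, and let $L_{m,s}:\mathcal{C}^\infty_c(\mathbb{R}^N)\to L^2(\mathbb{R}^N)$ be given by $$L_{m,s}u(x):=\frac{c_{N,m,s}}{2}\int_{\mathbb{R}^N}\frac{\delta_m u(x,y)}{|y|^{N+2s}}\,dy,\qquad x\in\mathbb{R}^N.$$ Then $L_{m,s}u=\mathcal{F}^{-1}(|\cdot|^{2s}\mathcal{F}(u))$ in $\mathbb{R}^N$ for any $u\in\mathcal{C}^\infty_c(\mathbb{R}^N)$.
   Context: $N\in\mathbb{N}=\{1,2,\ldots\}$ is the dimension. $\mathcal{C}^\infty_c(\mathbb{R}^N)$ denotes smooth compactly supported functions. For $m\in\mathbb{N}$, $\delta_m u(x,y):=\sum_{k=-m}^m(-1)^k\binom{2m}{m-k}u(x+ky)$. The constant is $$c_{N,m,s}:=\frac{4^s\Gamma(\frac N2+s)}{\pi^{N/2}\Gamma(-s)}\Big(\sum_{k=1}^m(-1)^k\binom{2m}{m-k}k^{2s}\Big)^{-1}\quad\text{if }s\in(0,m)\setminus\mathbb{N},$$ $$c_{N,m,s}:=\frac{4^s\Gamma(\frac N2+s)\,s!}{2\pi^{N/2}}\Big(\sum_{k=2}^m(-1)^{k-s+1}\binom{2m}{m-k}k^{2s}\ln(k)\Big)^{-1}\quad\text{if }s\in\{1,\ldots,m-1\}.$$ $\mathcal{F}$ denotes the Fourier transform in the angular-frequency convention, i.e. $\mathcal{F}u(\xi)=(2\pi)^{-N/2}\int_{\mathbb{R}^N}u(x)e^{-i\xi\cdot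 x}\,dx$, and $\mathcal{F}^{-1}$ its inverse. *)

(* Defs.v *)
From HB Require Import structures.
From mathcomp Require Import all_boot all_order all_algebra.
From mathcomp Require Import all_classical all_reals all_analysis.
From mathcomp Require Export complex.

Set Implicit Arguments.
Unset Strict Implicit.
Unset Printing Implicit Defensive.

Import Order.TTheory GRing.Theory Num.Theory.
Import numFieldNormedType.Exports.

Local Open Scope classical_set_scope.
Local Open Scope ring_scope.

Definition measure_rV_display : measure_display -> measure_display.
Proof. exact. Qed.

Section measurable_rV.
Context {d} {T : measurableType d}.

Definition rV_coords n : 'I_n -> 'rV[T]_n -> T := fun i x => x ord0 i.

(* The product sigma-algebra, as on [n.-tuple T]; for [T := R] it is the Borel
   sigma-algebra of R^n. *)
HB.instance Definition _ n := @isMeasurable.Build (measure_rV_display d)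
  'rV[T]_n (g_sigma_preimage (@rV_coords n))
  (@sigma_algebra0 _ _ _) (@sigma_algebraC _ _) (@sigma_algebra_bigcup _ _ _).

Lemma measurable_rV_coord n (i : 'I_n) :
  measurable_fun [set: 'rV[T]_n] (@rV_coords n i).
Proof.
move=> _ Y mY; rewrite setTI; apply: sub_sigma_algebra => /=.
rewrite -bigcup_seq/=; exists i => /=; first by rewrite mem_index_enum.
by exists Y => //; rewrite setTI.
Qed.

Lemma measurable_fun_rV d' (S : measurableType d') n (f : S -> 'rV[T]_n) :
  (forall i, measurable_fun [set: S] (fun x => f x ord0 i)) ->
  measurable_fun [set: S] f.
Proof.
move=> mf _ Y mY; rewrite setTI.
suff: preimage_set_system [set: S] f measurable `<=` measurable.
  by apply; exists Y => //; rewrite setTI.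
rewrite -[X in X `<=` _](@g_sigma_preimage_comp _ T n _ (@rV_coords n)).
apply: smallest_sub; first exact: sigma_algebra_measurable.
rewrite -bigcup_seq/=; apply: bigcup_sub => i _.
by move=> A [B mB <-]; exact: (mf i).
Qed.

End measurable_rV.

Section lebesgue_rV.
Context {R : realType}.
Local Open Scope ereal_scope.

Definition rV_cons n (p : measurableTypeR R * 'rV[R]_n) : 'rV[R]_n.+1 :=
  (\row_i oapp (p.2 ord0) p.1 (unlift ord0 i))%R.

Definition rV_uncons n (x : 'rV[R]_n.+1) : measurableTypeR R * 'rV[R]_n :=
  (x ord0 ord0, (\row_j x ord0 (lift ord0 j))%R).

Lemma rV_consK n : cancel (@rV_cons n) (@rV_uncons n).
Proof.
move=> [a v]; congr pair; first by rewrite mxE unlift_none.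
by apply/rowP => j; rewrite !mxE liftK.
Qed.

Lemma measurable_rV_cons n : measurable_fun setT (@rV_cons n).
Proof.
apply: measurable_fun_rV => i.
rewrite (_ : (fun _ => _) = fun p : measurableTypeR R * 'rV[R]_n =>
  oapp (p.2 ord0) p.1 (unlift ord0 i)); last first.
  by apply/funext => p; rewrite mxE.
case: unliftP => [j _|_] /=; last exact: measurable_fst.
exact: measurableT_comp (measurable_rV_coord j) measurable_snd.
Qed.

Lemma measurable_rV_uncons n : measurable_fun setT (@rV_uncons n).
Proof.
apply/measurable_fun_pairP; split.
  exact: (@measurable_rV_coord _ R _ ord0).
apply: measurable_fun_rV => i /=.
rewrite (_ : (fun _ => _) = @rV_coords _ R n.+1 (lift ord0 i)).
  exact: measurable_rV_coord.
by apply/funext => p /=; rewrite mxE.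
Qed.

Section step.
Variables (n : nat) (mu : {sigma_finite_measure set 'rV[R]_n -> \bar R}).

Definition lebesgue_cons : set 'rV[R]_n.+1 -> \bar R :=
  pushforward (lebesgue_measure \x mu) (@rV_cons n).

Let mpre A : measurable A -> measurable (@rV_cons n @^-1` A).
Proof.
by move=> mA; rewrite -[X in measurable X]setTI; exact: measurable_rV_cons.
Qed.

Let cons0 : lebesgue_cons set0 = 0.
Proof. by rewrite /lebesgue_cons /pushforward preimage_set0 measure0. Qed.

Let cons_ge0 A : 0 <= lebesgue_cons A.
Proof. exact: (measure_ge0 (lebesgue_measure \x mu)). Qed.

Let cons_sigma_additive : semi_sigma_additive lebesgue_cons.
Proof.
move=> F mF tF mUF; rewrite /lebesgue_cons /pushforward preimage_bigcup.
apply: measure_semi_sigma_additive.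
- by move=> k; exact: mpre.
- apply/trivIsetP => /= i j _ _ ij; rewrite -preimage_setI.
  by move/trivIsetP : tF => /(_ _ _ _ _ ij) ->//; rewrite preimage_set0.
- by rewrite -preimage_bigcup; exact: mpre.
Qed.

HB.instance Definition _ := isMeasure.Build _ _ _ lebesgue_cons
  cons0 cons_ge0 cons_sigma_additive.

Let cons_sigma_finite : sigma_finite setT lebesgue_cons.
Proof.
have /sigma_finiteP[F [FT ndF Foo]] := sigma_finiteT (@lebesgue_measure R).
have /sigma_finiteP[G [GT ndG Goo]] := sigma_finiteT mu.
exists (fun k => @rV_uncons n @^-1` (F k `*` G k)).
  rewrite -preimage_bigcup -[LHS](preimage_setT (@rV_uncons n)); congr (_ @^-1` _).
  rewrite -setXTT FT GT predeqE => -[x y]; split.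
    move=> [/= [i _ Fix] [k _ Gky]]; exists (maxn i k) => //; split.
    - by move: x Fix; exact/subsetPset/ndF/leq_maxl.
    - by move: y Gky; exact/subsetPset/ndG/leq_maxr.
  by move=> [k _ []/= ? ?]; split; exists k.
move=> k; have [mF Fk] := Foo k; have [mG Gk] := Goo k; split.
  rewrite -[X in measurable X]setTI; apply: measurable_rV_uncons => //.
  exact: measurableX.
rewrite /lebesgue_cons /pushforward -comp_preimage.
rewrite (_ : _ \o _ = id) ?preimage_id; last first.
  by apply/funext => p /=; rewrite rV_consK.
by rewrite product_measure1E// lte_mul_pinfty// ge0_fin_numE.
Qed.

HB.instance Definition _ := Measure_isSigmaFinite.Build _ _ _ lebesgue_cons
  cons_sigma_finite.

End step.

(* Lebesgue measure on R^n: the n-fold product of the one-dimensional one, the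
   case n = 0 being the unit mass of the one-point space. *)
Fixpoint lebesgue_rV n : {sigma_finite_measure set 'rV[R]_n -> \bar R} :=
  if n is n'.+1 then lebesgue_cons (lebesgue_rV n')
  else \d_(0%R : 'rV[R]_0).

Lemma lebesgue_rV_box n (A : 'I_n -> set R) : (forall i, measurable (A i)) ->
  lebesgue_rV n [set x : 'rV[R]_n | forall i, A i (x ord0 i)] =
  \prod_(i < n) lebesgue_measure (A i).
Proof.
elim: n A => [|n IH] A mA.
  by rewrite big_ord0 /= diracE mem_set// => -[].
rewrite big_ord_recl/= -IH//; rewrite -product_measure1E; first last.
- rewrite (_ : [set _ | _] = \bigcap_(i in [set: 'I_n]) (
      @rV_coords _ R n i @^-1` A (lift ord0 i))).
    apply: fin_bigcap_measurable => // i _; rewrite -[X in measurable X]setTI.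
    exact: measurable_rV_coord.
  by apply/seteqP; split => x /= h i; [move=> _|]; exact: h.
- exact: mA.
rewrite /lebesgue_cons /pushforward; congr (_ _); apply/seteqP; split => -[a v] /= h.
  split; first by have := h ord0; rewrite mxE unlift_none.
  by move=> i; have := h (lift ord0 i); rewrite mxE liftK.
move=> i; rewrite mxE; case: unliftP => [j ->|->]/=; [exact: h.2|exact: h.1].
Qed.

End lebesgue_rV.

Section euclidean.
Context {R : realType}.
Implicit Types n N : nat.

(* The norm `|x| of the library on 'rV[R]_n is the sup norm. *)
Definition enorm n (x : 'rV[R]_n) : R := Num.sqrt (\sum_i x ord0 i ^+ 2).

Definition dotr n (x y : 'rV[R]_n) : R := \sum_i x ord0 i * y ord0 i.

Fixpoint is_Ck n (k : nat) (f : 'rV[R]_n -> R) : Prop :=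
  continuous f /\
  if k is k'.+1 then
    forall i : 'I_n, let e_i : 'rV[R]_n := delta_mx ord0 i in
      (forall x, derivable f x e_i) /\ is_Ck k' (fun x => 'D_e_i f x)
  else True.

Definition is_smooth n (f : 'rV[R]_n -> R) : Prop := forall k, is_Ck k f.

End euclidean.

Section complex_valued.
Context {R : realType}.
Local Open Scope complex_scope.

Definition is_test_function n (u : 'rV[R]_n -> R[i]) : Prop :=
  [/\ is_smooth (fun x => complex.Re (u x)),
      is_smooth (fun x => complex.Im (u x)) &
      compact (closure [set x | u x != 0])].

Definition cintegrable n (f : 'rV[R]_n -> R[i]) : Prop :=
  (lebesgue_rV n).-integrable setT (fun x => (complex.Re (f x))%:E) /\
  (lebesgue_rV n).-integrable setT (fun x => (complex.Im (f x))%:E).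

Definition cintegral n (f : 'rV[R]_n -> R[i]) : R[i] :=
  (\int[lebesgue_rV n]_x complex.Re (f x)) +i*
  (\int[lebesgue_rV n]_x complex.Im (f x)).

Definition in_L2 n (f : 'rV[R]_n -> R[i]) : Prop :=
  (fun x => complex.Re (f x)) \in Lfun (lebesgue_rV n) 2%:E /\
  (fun x => complex.Im (f x)) \in Lfun (lebesgue_rV n) 2%:E.

Definition expi (t : R) : R[i] := cos t +i* sin t.

Definition fourier n (f : 'rV[R]_n -> R[i]) (xi : 'rV[R]_n) : R[i] :=
  ((2 * pi) `^ (- (n%:R / 2)))%:C *
  cintegral (fun x => f x * expi (- dotr xi x)).

Definition inv_fourier n (g : 'rV[R]_n -> R[i]) (x : 'rV[R]_n) : R[i] :=
  ((2 * pi) `^ (- (n%:R / 2)))%:C *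
  cintegral (fun xi => g xi * expi (dotr xi x)).

End complex_valued.

Section gamma.
Context {R : realType}.

Definition euler_gamma (z : R) : R :=
  \int[lebesgue_measure]_(t in `]0, +oo[) (t `^ (z - 1) * expR (- t)).

(* For z <= 0 not an integer, the integral is continued by means of
   Gamma (z + k) = z (z + 1) ... (z + k - 1) Gamma z, with k the least natural
   number such that z + k > 0. *)
Definition Gamma (z : R) : R :=
  let k := if 0 < z then 0%N else (Num.truncn (- z)).+1 in
  euler_gamma (z + k%:R) / \prod_(i < k) (z + i%:R).

End gamma.

Section operator.
Context {R : realType}.
Local Open Scope complex_scope.

(* The index j stands for k = j - m, which ranges over -m, ..., m. *)
Definition delta N (m : nat) (u : 'rV[R]_N -> R[i]) (x y : 'rV[R]_N) : R[i] :=
  \sum_(j < (2 * m).+1) let k := j%:Z - m%:Z in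
    (-1) ^ k * ('C(2 * m, `|m%:Z - k|%N))%:R * u (x + k%:~R *: y).

Definition cNms (N m : nat) (s : R) : R :=
  if s \is a Num.nat then
    let n := Num.truncn s in
    4 `^ s * Gamma (N%:R / 2 + s) * (n`!)%:R / (2 * pi `^ (N%:R / 2)) *
    (\sum_(2 <= k < m.+1) (-1) ^ (k%:Z - n%:Z + 1) * ('C(2 * m, m - k))%:R *
       k%:R `^ (2 * s) * ln k%:R)^-1
  else
    4 `^ s * Gamma (N%:R / 2 + s) / (pi `^ (N%:R / 2) * Gamma (- s)) *
    (\sum_(1 <= k < m.+1) (-1) ^+ k * ('C(2 * m, m - k))%:R *
       k%:R `^ (2 * s))^-1.

Definition Lms_integrand N m (s : R) (u : 'rV[R]_N -> R[i])
    (x y : 'rV[R]_N) : R[i] :=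
  delta m u x y / (enorm y `^ (N%:R + 2 * s))%:C.

Definition Lms N m (s : R) (u : 'rV[R]_N -> R[i]) (x : 'rV[R]_N) : R[i] :=
  (cNms N m s / 2)%:C * cintegral (Lms_integrand m s u x).

Definition symbol_fourier N (s : R) (u : 'rV[R]_N -> R[i])
    (xi : 'rV[R]_N) : R[i] :=
  (enorm xi `^ (2 * s))%:C * fourier u xi.

End operator.

(* Main.v *)
From HB Require Import structures.
Require Import Defs.
From mathcomp Require Import all_boot all_order all_algebra.
From mathcomp Require Import all_classical all_reals all_analysis.
From mathcomp Require Import measurable_realfun ring lra.

(** A plane wave of frequency [xi] is an eigenfunction of the symmetric difference of order [2m]:
    in the variable [x] that difference, taken along [y], multiplies it by
    [(2 - 2 cos (xi.y))^m] ([sum_dcoef_cos]).  The theorem therefore reduces to the value of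
<<
      int (2 - 2 cos (xi.y))^m / |y|^(N + 2s) dy = K |xi|^(2s),
>>
    together with [c_{N,m,s} K = 2] ([has_integral_riesz], [cNms_riesz_const]), and to the passage
    from plane waves to test functions by Fourier inversion.

    The value of the integral.  The power [|y|^(-N-2s)] is a superposition of the Gaussians
    [exp (-|y|^2 / (4r))] with weight [r^(-N/2-s-1)], by Euler's integral for Gamma.  The Gaussian
    Fourier transform turns each of them into [(4 pi r)^(N/2) g (r |xi|^2)], where
    [g r = sum_k (-1)^k C(2m, m-k) exp (-k^2 r)], [k] running from [-m] to [m], is [heat_sum m].
    Scaling in [r] produces [|xi|^(2s)] and leaves the moment [int_0^oo r^(-s-1) g r dr]
    ([heat_moment]).  The coefficients of [g] annihilate polynomials in [k^2] of degree less than
    [m], so each exponential may be replaced by a Taylor remainder.  If [s] is not an integer, the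
    remainder of [exp (-k^2 r)] has moment [Gamma (-s) k^(2s)] up to sign, which is Euler's
    integral continued below [0].  If [s] is an integer, the remainder is compared with a multiple
    of that of [exp (-r)], and the moments are Frullani integrals, whence the logarithms
    ([heat_momentP]).  The moment does not vanish because the integrand [(2 - 2 cos)^m], hence
    [g], is nonnegative ([heat_sum_ge0], [heat_moment_gt0]).

    From waves to test functions.  Everything is done with real functions: for real [w] the
    integral [wave w xi a] of [w y * cos (a - xi.y)] holds the real and imaginary parts of the
    Fourier transform, the sine being a cosine shifted by a quarter period.  Repeated integration
    by parts makes it decay faster than any power of [xi] ([wave_decay]); this gives the inversion
    formula ([fourier_inversion], by Gaussian damping) and, by Fubini, the identity for the
    operator ([has_integral_riesz_op]).  For complex [u], the contributions of the real part of
    [u] to the imaginary part of the right-hand side, and conversely, are integrals of odd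
    functions of [xi] ([has_integral_symbol_wave_odd]).

    Square integrability.  The frequency formula bounds the operator uniformly, and away from the
    support of [w] the difference quotient is at most of size [|x|^(-N-2s)] on a set of bounded
    measure; hence the square is bounded by a multiple of the integrable function
    [prod_i (1 + x_i^2)^-1] ([riesz_op_sqr_le]). *)

Set Implicit Arguments.
Unset Strict Implicit.
Unset Printing Implicit Defensive.
Import Order.TTheory GRing.Theory Num.Theory.
Import numFieldNormedType.Exports.
Local Open Scope classical_set_scope.
Local Open Scope ring_scope.

(** * Integration on the line and Euler's integral *)

Section line.
Context {R : realType}.
Notation mu := (@lebesgue_measure R).
Local Open Scope ereal_scope.
Implicit Types (a b c r s t x : R).

Lemma measurable_affine a b :
  measurable_fun [set: measurableTypeR R] ((fun x => a * x + b)%R : _ -> measurableTypeR R).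
Proof. by apply: measurable_funD => //; exact: measurable_funM. Qed.

(** Lebesgue measure is determined by its values on half-open intervals, where the rescaled
    image measure agrees with it. *)
Lemma lebesgue_measure_affine a b (A : set R) : (0 < a)%R -> measurable A ->
  mu A = a%:E * mu ((fun x => a * x + b)%R @^-1` A).
Proof.
move=> a0 mA; pose k := NngNum (ltW a0).
apply: (@lebesgue_measure_unique _ (mscale k
  (measure_function_pushforward__canonical__measure_function_Measure
     mu (measurable_affine a b)))) => // _ [[c d]] _ <-.
rewrite /mscale/=.
change (mu `]c, d] = a%:E * mu ((fun x => a * x + b)%R @^-1` `]c, d])).
rewrite (_ : _ @^-1` _ = `](c - b) / a, (d - b) / a]%classic)%R; last first.
  by apply/seteqP; split => x /=; rewrite !in_itv/= ler_pdivlMr// ltr_pdivrMr//;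
    rewrite ltrBlDr lerBrDr (mulrC x).
rewrite !lebesgue_measure_itv/= !lte_fin ltr_pM2r ?invr_gt0// ltrD2r.
case: ifPn => // _; last by rewrite mule0.
by rewrite -!EFinB -EFinM; congr EFin; field; rewrite gt_eqF.
Qed.

Lemma ge0_integral_affine a b (f : R -> \bar R) : (0 < a)%R ->
  measurable_fun [set: R] f -> (forall x, 0 <= f x) ->
  \int[mu]_x f (a * x + b)%R = a^-1%:E * \int[mu]_x f x.
Proof.
move=> a0 mf f0; pose k := NngNum (ltW a0).
have -> : \int[mu]_x f x = a%:E * \int[mu]_x f (a * x + b)%R.
  rewrite (eq_measure_integral (mscale k
    (measure_function_pushforward__canonical__measure_function_Measure
     mu (measurable_affine a b)))); last first.
    by move=> A mA _; exact: lebesgue_measure_affine.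
  rewrite ge0_integral_mscale//=.
  rewrite ge0_integral_pushforward//=.
  exact: measurable_affine.
by rewrite muleA -EFinM mulVf ?gt_eqF// mul1e.
Qed.

Lemma ge0_integral_oppr (f : R -> \bar R) :
  measurable_fun [set: R] f -> (forall x, 0 <= f x) ->
  \int[mu]_x f (- x)%R = \int[mu]_x f x.
Proof.
move=> mf f0.
rewrite [RHS](eq_measure_integral (pushforward mu (-%R : _ -> measurableTypeR R))).
  by rewrite ge0_integral_pushforward.
by move=> A mA _; apply/esym/lebesgue_measureN.
Qed.

Lemma ge0_integral_scale0y c (f : R -> \bar R) : (0 < c)%R ->
  measurable_fun (`]0%R, +oo[ : set R) f -> (forall x, (0 < x)%R -> 0 <= f x) ->
  \int[mu]_(x in `]0%R, +oo[) f (c * x)%R = c^-1%:E * \int[mu]_(x in `]0%R, +oo[) f x.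
Proof.
move=> c0 mf f0; rewrite [in RHS]integral_mkcond.
rewrite -(@ge0_integral_affine c 0%R)//; last 2 first.
- by apply/(measurable_restrictT f).
- by move=> x; apply: erestrict_ge0 => y; rewrite /= in_itv/= andbT; exact: f0.
rewrite integral_mkcond; apply: eq_integral => x _.
by rewrite /patch addr0 !mem_setE/= !in_itv/= !andbT pmulr_rgt0.
Qed.

Lemma itv0y_bigcup : `]0%R, +oo[%classic =
  \bigcup_n [set x : R | (n.+1%:R^-1 <= x <= n.+1%:R)%R].
Proof.
apply/seteqP; split => [x /=|x [n _] /=]; rewrite in_itv/= ?andbT; last first.
  by move=> /andP[+ _]; apply: lt_le_trans; rewrite invr_gt0.
move=> x0; pose y : R := x; have y0 : (0 < y)%R by [].
have [n yn] : exists n : nat, (Num.max y y^-1 <= n.+1%:R)%R.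
  by exists (Num.truncn (Num.max y y^-1)%R); exact/ltW/truncnS_gt.
move: yn; rewrite ge_max => /andP[yn yVn].
exists n => //=; rewrite -/y yn andbT.
by rewrite -(invrK y) lef_pV2// posrE// invr_gt0.
Qed.

(** The intervals [1/n, n] exhaust the half-line, and inversion maps each of them to itself. *)
Lemma cvg_integral0y (f : R -> \bar R) :
  measurable_fun (`]0%R, +oo[ : set R) f -> (forall x, (0 < x)%R -> 0 <= f x) ->
  \int[mu]_(x in [set x : R | (n.+1%:R^-1 <= x <= n.+1%:R)%R]) f x @[n --> \oo] -->
  \int[mu]_(x in `]0%R, +oo[) f x.
Proof.
move=> mf f0.
have sub n (x : R) : (n.+1%:R^-1 <= x <= n.+1%:R)%R -> (0 < x)%R.
  by move=> /andP[+ _]; apply: lt_le_trans; rewrite invr_gt0.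
have mI n : measurable [set x : R | (n.+1%:R^-1 <= x <= n.+1%:R)%R].
  by rewrite (_ : [set _ | _] = `[n.+1%:R^-1, n.+1%:R]%classic)%R.
rewrite itv0y_bigcup; apply: ge0_nondecreasing_set_cvg_integral => //.
- apply/nondecreasing_seqP => n; rewrite subsetEset => x /=.
  move=> /andP[nx xn]; apply/andP; split.
    by rewrite (le_trans _ nx)// lef_pV2// ?posrE// ler_nat.
  by rewrite (le_trans xn)// ler_nat.
- move=> n; apply: measurable_funS mf => //.
  by move=> x /= /sub; rewrite in_itv/= andbT.
- by move=> n x /= /sub; exact: f0.
Qed.

Lemma is_derive_invr x : x != 0%R -> is_derive x 1%R (fun y : R => y^-1)%R (- x ^- 2)%R.
Proof.
move=> x0; apply: DeriveDef; first exact: derivableV.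
by rewrite deriveV// derive_id /GRing.scale/= mulr1.
Qed.

Lemma derive1_invr x : (0 < x)%R -> ((fun y : R => y^-1)%R^`())%classic x = (- x ^- 2)%R.
Proof.
move=> x0; rewrite derive1E.
by apply: (@derive_val _ _ _ _ _ _ _ (is_derive_invr _)); rewrite gt_eqF.
Qed.

Lemma continuous_derive1_invr x : (0 < x)%R ->
  {for x, continuous (((fun y : R => y^-1)%R^`())%classic)}.
Proof.
move=> x0; rewrite /prop_for /continuous_at derive1_invr//.
have : (- y ^- 2)%R @[y --> x] --> (- x ^- 2)%R.
  apply: cvgN; apply: cvgV; first by rewrite expf_neq0// gt_eqF.
  exact: exprn_continuous.
apply: cvg_trans; apply: near_eq_cvg; near=> y.
by rewrite derive1_invr//; near: y; exact: lt_nbhsr.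
Unshelve. all: by end_near. Qed.

(** The substitution is carried out on the compact intervals [1/n, n], where the fundamental
    theorem of calculus applies, and passes to the limit on both sides. *)
Lemma ge0_integral_inv0y (f : R -> R) :
  {in `]0%R, +oo[, continuous f} -> (forall x, (0 < x)%R -> (0 <= f x)%R) ->
  \int[mu]_(x in `]0%R, +oo[) (f x^-1 * x ^- 2)%:E = \int[mu]_(x in `]0%R, +oo[) (f x)%:E.
Proof.
move=> cf f0.
have cV x : (0 < x)%R -> {for x, continuous (fun x : R => x^-1)%R}.
  by move=> x0; apply: inv_continuous; rewrite gt_eqF.
have cg : {in `]0%R, +oo[, continuous (fun x : R => f x^-1 * x ^- 2)%R}.
  move=> x x0; have := x0; rewrite in_itv/= andbT => x0'.
  apply: cvgM.
    apply: continuous_comp; first exact: cV.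
    by apply: cf; rewrite in_itv/= andbT invr_gt0.
  apply: cvgV; first by rewrite expf_neq0// gt_eqF.
  exact: exprn_continuous.
have mo (h : R -> R) : {in `]0%R, +oo[, continuous h} ->
    measurable_fun (`]0%R, +oo[ : set R) (fun x => (h x)%:E).
  move=> ch; apply/measurable_EFinP; apply: open_continuous_measurable_fun => //.
  by move=> x; rewrite inE; exact: ch.
have f0' x : (0 < x)%R -> 0 <= (f x)%:E by move=> x0; rewrite lee_fin f0.
have /cvg_lim <- // := cvg_integral0y (mo _ cf) f0'.
have g0 x : (0 < x)%R -> 0 <= (f x^-1 * x ^- 2)%:E.
  by move=> x0; rewrite lee_fin mulr_ge0 ?invr_ge0 ?exprn_ge0 ?f0 ?invr_gt0// ltW.
have /cvg_lim <- // := cvg_integral0y (mo _ cg) g0.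
apply: congr_lim; apply/funext => n /=.
set a : R := (n.+1%:R^-1)%R; set b : R := (n.+1%:R)%R.
have a0 : (0 < a)%R by rewrite invr_gt0.
have ab : (a <= b)%R.
  by rewrite (@le_trans _ _ 1%R)// ?invf_le1// ler1n.
have aV : (a^-1)%R = b by rewrite invrK.
have sub x : (a <= x)%R -> (0 < x)%R by exact: lt_le_trans.
have b0 := sub _ ab.
have dV x : (0 < x)%R -> derivable (fun y : R => y^-1)%R x 1%R.
  by move=> x0; apply: (@ex_derive _ _ _ _ _ _ _ (is_derive_invr _)); rewrite gt_eqF.
have Iab : [set x : R | (a <= x <= b)%R] = `[a, b]%classic by [].
have := @integration_by_substitution_decreasing R (fun x => x^-1)%R f a b ab.
rewrite aV -/a Iab => ->.
- apply: eq_integral => x; rewrite inE/= in_itv/= => /andP[/sub x0 _].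
  by rewrite !fctE derive1_invr// opprK.
- move=> x y; rewrite !in_itv/= => /andP[/sub x0 _] /andP[/sub y0 _] xy.
  by rewrite ltf_pV2.
- move=> x; rewrite in_itv/= => /andP[ax _].
  by apply: continuous_derive1_invr; exact: lt_trans ax.
- apply/cvg_ex; exists (((fun y : R => y^-1)%R^`())%classic a).
  by apply: cvg_at_right_filter; exact: continuous_derive1_invr.
- apply/cvg_ex; exists (((fun y : R => y^-1)%R^`())%classic b).
  by apply: cvg_at_left_filter; exact: continuous_derive1_invr.
- split.
  + by move=> x; rewrite in_itv/= => /andP[ax _]; apply: dV; exact: lt_trans ax.
  + by apply: cvg_at_right_filter; exact: cV.
  + by apply: cvg_at_left_filter; exact: cV.
- apply: continuous_in_subspaceT => x; rewrite inE/= in_itv/= => /andP[/sub x0 _].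
  by apply: cf; rewrite in_itv/= andbT.
Qed.

Lemma is_derive_powRN s x : s != 0%R -> (0 < x)%R ->
  is_derive x 1%R (fun y => - (y `^ (- s) / s))%R (x `^ (- s - 1))%R.
Proof.
move=> s0 x0.
have h : is_derive x 1%R (fun y : R => y `^ (- s))%R (- s * x `^ (- s - 1))%R.
  exact: is_derive1_powR.
rewrite (_ : (fun y => _) = (- s^-1)%R \*: (fun y : R => y `^ (- s))%R); last first.
  by apply/funext => y /=; rewrite /GRing.scale/= mulNr mulrC.
apply: is_derive_eq; rewrite /GRing.scale/=.
by field.
Qed.

Lemma cvg_powRNy s : (0 < s)%R -> ((x : R) `^ (- s) @[x --> +oo] --> (0 : R))%R.
Proof.
move=> s0; apply/cvgrPdist_le => e e0; near=> x.
have x0 : (0 < x)%R by near: x; exact: nbhs_pinfty_gt.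
rewrite sub0r normrN ger0_norm ?powR_ge0// powRN.
rewrite -[leRHS]invrK lef_pV2 ?posrE ?powR_gt0 ?invr_gt0//.
rewrite -[leLHS](@powRr1 _ e^-1) ?invr_ge0 ?(ltW e0)//.
rewrite -(mulVf (lt0r_neq0 s0)) powRrM.
have xe : (e^-1 `^ s^-1 <= x)%R by near: x; exact: nbhs_pinfty_ge.
by apply: ge0_ler_powR; rewrite ?nnegrE ?powR_ge0// ltW.
Unshelve. all: by end_near. Qed.

Lemma integral_powR_tail s t : (0 < s)%R -> (0 < t)%R ->
  \int[mu]_(x in `]t, +oo[) (x `^ (- s - 1))%:E = (t `^ (- s) / s)%:E.
Proof.
move=> s0 t0.
rewrite integral_itv_obnd_cbnd; last first.
  by apply/measurable_EFinP/measurable_funTS; exact: measurable_powR.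
have sN0 : s != 0%R by rewrite gt_eqF.
have dF x : (t <= x)%R -> is_derive x 1%R (fun y => - (y `^ (- s) / s))%R (x `^ (- s - 1))%R.
  by move=> tx; apply: is_derive_powRN => //; exact: lt_le_trans tx.
have cont (h : R -> R) x : derivable h x 1%R -> {for x, continuous h}.
  by move=> dh; apply: differentiable_continuous; exact/derivable1_diffP.
have dp x : (t <= x)%R -> derivable (fun y : R => y `^ (- s - 1))%R x 1%R.
  by move=> tx; apply: derivable_powR; rewrite in_itv/= andbT (lt_le_trans t0 tx).
rewrite (@ge0_continuous_FTC2y _ _ (fun x => - (x `^ (- s) / s))%R _ 0%R).
- by rewrite sub0e -EFinN opprK.
- by move=> x tx; exact: powR_ge0.
- apply: continuous_in_subspaceT => x; rewrite inE/= in_itv/= andbT => tx.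
  by apply: cont; exact: dp.
- have : (- ((x : R) `^ (- s) / s) @[x --> +oo] --> - (0 / s))%R.
    by apply: cvgN; apply: cvgM; [exact: cvg_powRNy|exact: cvg_cst].
  by rewrite mul0r oppr0.
- by move=> x tx; have [] := dF x (ltW tx).
- by apply: cvg_at_right_filter; apply: (cont (fun x => - (x `^ (- s) / s))%R); have [] := dF t (lexx _).
- move=> x; rewrite in_itv/= andbT => tx.
  by rewrite derive1E; have [_ ->] := dF x (ltW tx).
Qed.

End line.

Section half_line.
Context {R : realType}.
Notation mu := (@lebesgue_measure R).
Implicit Types (r s t x z : R).

Lemma derivable1_continuous (f : R -> R) x : derivable f x 1 -> {for x, continuous f}.
Proof. by move=> df; apply/differentiable_continuous/derivable1_diffP. Qed.

Lemma integral_0_FTC (F Phi : R -> R) r :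
  continuous F -> (forall x, is_derive x 1 Phi (F x)) -> Phi 0 = 0 -> 0 < r ->
  (\int[mu]_(t in `]0%R, r[) (F t)%:E = (Phi r)%:E)%E.
Proof.
move=> cF dPhi Phi0 r0.
have mF : measurable_fun [set: R] (fun t => (F t)%:E).
  by apply/measurable_EFinP; exact: continuous_measurable_fun.
have cPhi x : {for x, continuous Phi}.
  by apply: derivable1_continuous; have [] := dPhi x.
rewrite -(@integral_itv_bndoo _ _ _ _ true false) //=; last exact: measurable_funTS.
rewrite (@continuous_FTC2 _ F Phi) ?Phi0 ?sube0//.
- exact: continuous_subspaceT.
- split.
  + by move=> x _; have [] := dPhi x.
  + by apply: cvg_at_right_filter; exact: cPhi.
  + by apply: cvg_at_left_filter; exact: cPhi.
- by move=> x _; rewrite derive1E; have [_ ->] := dPhi x.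
Qed.

(** Integration by parts without boundary terms: Tonelli on the region [0 < t < r], where
    [Phi r] is the integral of [F] over [0 < t < r] and [t^(-s) / s] that of [r^(-s-1)] over [r > t]. *)
Lemma ge0_integral_powR_primitive (F Phi : R -> R) s :
  0 < s -> continuous F -> (forall x, is_derive x 1 Phi (F x)) -> Phi 0 = 0 ->
  (forall x, 0 < x -> 0 <= F x) ->
  (\int[mu]_(r in `]0%R, +oo[) (r `^ (- s - 1) * Phi r)%:E =
   \int[mu]_(t in `]0%R, +oo[) (t `^ (- s) / s * F t)%:E)%E.
Proof.
move=> s0 cF dPhi Phi0 F0.
have mF : measurable_fun [set: R] F by exact: continuous_measurable_fun.
pose I := `]0 : R, +oo[%classic.
pose h (z : measurableTypeR R * measurableTypeR R) : \bar R :=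
  ((z.1 : R) `^ (- s - 1) * F z.2 * \1_I (z.2 : R) * \1_I ((z.1 : R) - z.2))%:E.
have I1 x : \1_I x = (0 < x)%R%:R :> R.
  by rewrite indicE /I mem_setE in_itv/= andbT.
have h0 (z : measurableTypeR R * measurableTypeR R) : (0 <= h z)%E.
  rewrite /h !I1 lee_fin; case: ltP => [z0|]; last by rewrite mulr0 mul0r.
  by rewrite !mulr_ge0 ?powR_ge0 ?F0.
have mI : measurable_fun [set: R] (\1_I : R -> R) by apply: measurable_indic; exact: measurable_itv.
have mh : measurable_fun setT h.
  apply/measurable_EFinP; apply: measurable_funM; last first.
    apply: (measurableT_comp mI); apply: measurable_funB; [exact: measurable_fst|exact: measurable_snd].
  apply: measurable_funM; last exact: (measurableT_comp mI measurable_snd).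
  apply: measurable_funM; last exact: (measurableT_comp mF measurable_snd).
  exact: (measurableT_comp (measurable_powR _) measurable_fst).
have := fubini_tonelli (m1 := mu) (m2 := mu) h mh h0.
rewrite [X in X = _ -> _](_ : _ = \int[mu]_(r in `]0%R, +oo[) (r `^ (- s - 1) * Phi r)%:E)%E; last first.
  rewrite [RHS]integral_mkcond; apply: eq_integral => r _; rewrite patchE mem_setE.
  rewrite in_itv/= andbT; case: ltP => r0.
    rewrite EFinM -(integral_0_FTC cF dPhi Phi0 r0) -ge0_integralZl_EFin ?powR_ge0//; last 2 first.
    - by move=> x /=; rewrite in_itv/= => /andP[x0 _]; rewrite lee_fin F0.
    - by apply/measurable_EFinP/measurable_funTS.
    rewrite [RHS]integral_mkcond; apply: eq_integral => t _; rewrite patchE mem_setE /h/= !I1.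
    rewrite in_itv/= subr_gt0; case: ltP => t0; rewrite ?mulr0 ?mul0r//.
    by case: ltP => tr; rewrite ?mulr1 ?mulr0.
  apply: integral0_eq => t _; rewrite /h/= !I1 subr_gt0; case: ltP => t0; rewrite ?mulr0 ?mul0r//.
  by rewrite ltNge (le_trans r0 (ltW t0)) mulr0.
move=> ->; rewrite [RHS]integral_mkcond; apply: eq_integral => t _; rewrite patchE mem_setE.
rewrite in_itv/= andbT; case: ltP => t0; last first.
  by apply: integral0_eq => r _; rewrite /h/= !I1 ltNge t0/= mulr0 mul0r.
rewrite mulrC EFinM -(integral_powR_tail s0 t0) -ge0_integralZl_EFin ?F0//; last 2 first.
- by move=> x _; rewrite lee_fin powR_ge0.
- by apply/measurable_EFinP/measurable_funTS; exact: measurable_powR.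
rewrite [RHS]integral_mkcond; apply: eq_integral => r _; rewrite patchE mem_setE /h/= !I1.
rewrite in_itv/= andbT subr_gt0 t0 mulr1; case: ltP => _; rewrite ?mulr0// mulr1 mulrC EFinM//.
Qed.

(** From [x / n <= 1 + x / n <= exp (x / n)]. *)
Lemma expr_le_expR (n : nat) x : 0 <= x -> x ^+ n <= n%:R ^+ n * expR x.
Proof.
move=> x0; case: n => [|n]; first by rewrite !expr0 mul1r -expR0 ler_expR.
have -> : expR x = expR (x / n.+1%:R) ^+ n.+1.
  by rewrite -expRM_natl -mulr_natl; congr expR; rewrite mulrC divfK// pnatr_eq0.
rewrite -exprMn lerXn2r ?nnegrE ?mulr_ge0 ?expR_ge0//.
rewrite mulrC -ler_pdivrMr ?ltr0n//.
by apply: le_trans (expR_ge1Dx _); rewrite lerDr.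
Qed.

Lemma powR_expRN_bounded z : 0 <= z ->
  exists2 C, 0 < C & forall x, 0 < x -> x `^ z * expR (- x) <= C.
Proof.
move=> z0; pose n := (Num.truncn z).+1; have zn : z <= n%:R by exact/ltW/truncnS_gt.
have n1 : 1 <= n%:R ^+ n :> R by rewrite exprn_ege1// ler1n.
exists (n%:R ^+ n); first by rewrite (lt_le_trans _ n1).
move=> x x0; rewrite expRN ler_pdivrMr ?expR_gt0//.
have [x1|x1] := leP x 1.
  rewrite (@le_trans _ _ 1)//; last by rewrite mulr_ege1// -expR0 ler_expR ltW.
  have -> : 1 = 1 `^ z :> R by rewrite powR1.
  by rewrite ge0_ler_powR// ?nnegrE ltW.
apply: le_trans (expr_le_expR _ (ltW x0)).
by rewrite -powR_mulrn ?ler_powR// ltW.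
Qed.

(** The exponential is bounded by a multiple of [(1 + t^(z+1))^-1]; the inversion [t -> 1/t] then
    removes the factor [t^(z-1)], singular at [0] for small [z]. *)
Lemma integral_gamma_lty z : 0 < z ->
  (\int[mu]_(t in `]0%R, +oo[) (t `^ (z - 1) * expR (- t))%:E < +oo)%E.
Proof.
move=> z0.
have [C C0 hC] := @powR_expRN_bounded (z + 1) (addr_ge0 (ltW z0) ler01).
pose f x : R := (1 + x `^ (z + 1))^-1.
have den x : 0 < 1 + x `^ (z + 1) by rewrite ltr_pwDl ?powR_ge0.
have f0 x : 0 <= f x by rewrite invr_ge0 ltW.
have cf : {in `]0, +oo[, continuous f}.
  move=> x; rewrite in_itv/= andbT => x0; apply: cvgV; first by rewrite gt_eqF.
  apply: cvgD; first exact: cvg_cst.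
  apply: (@derivable1_continuous (fun x => x `^ (z + 1))).
  by apply: derivable_powR; rewrite in_itv/= andbT.
have fV x : 0 < x -> f x^-1 * x ^- 2 = x `^ (z - 1) * f x.
  move=> x0; rewrite /f.
  have -> : x `^ (z - 1) = x `^ (z + 1) * x ^- 2.
    rewrite -powR_invn ?ltW// -powRD; first by congr powR; lra.
    by rewrite (gt_eqF x0) implybT.
  rewrite -[x^-1]powR_inv1 ?(ltW x0)// -powRrM mulN1r powRN.
  have := powR_gt0 (z + 1) x0; have := den x; set p := x `^ (z + 1) => p1 p0.
  by field; rewrite !gt_eqF//= ltr_pwDr.
have mc (h : R -> R) : {in `]0, +oo[, continuous h} ->
    measurable_fun (`]0, +oo[%classic : set R) (fun x => (h x)%:E).
  move=> ch; apply/measurable_EFinP; apply: open_continuous_measurable_fun => //.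
  by move=> x; rewrite inE; exact: ch.
have mf := mc _ cf.
have -> : (+oo = (1 + C)%:E * +oo :> \bar R)%E by rewrite gt0_muley// lte_fin addr_gt0.
have C1 : 0 <= 1 + C by rewrite addr_ge0// ltW.
have mp (q : R) : measurable_fun (`]0, +oo[%classic : set R) (fun x => x `^ q).
  by apply: measurable_funTS; exact: measurable_powR.
apply: (@le_lt_trans _ _ (\int[mu]_(t in `]0%R, +oo[) ((1 + C)%:E * (t `^ (z - 1) * f t)%:E))%E).
  apply: ge0_le_integral => //.
  - by move=> x _; rewrite lee_fin mulr_ge0 ?powR_ge0 ?expR_ge0.
  - apply/measurable_EFinP; apply: measurable_funM; first exact: mp.
    by apply: measurable_funTS; exact: measurableT_comp.
  - apply: measurable_funeM; apply/measurable_EFinP; apply: measurable_funM; first exact: mp.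
    exact/measurable_EFinP.
  - move=> x /=; rewrite in_itv/= andbT => x0; rewrite -EFinM lee_fin mulrCA.
    rewrite ler_wpM2l ?powR_ge0// /f ler_pdivlMr// mulrDr mulr1.
    rewrite lerD// 1?[leLHS]mulrC ?hC//.
    by rewrite -expR0 ler_expR; lra.
rewrite ge0_integralZl_EFin//; last 2 first.
- by move=> x _; rewrite lee_fin mulr_ge0 ?powR_ge0.
- apply/measurable_EFinP; apply: measurable_funM; first exact: mp.
  exact/measurable_EFinP.
rewrite lte_pmul2l ?lte_fin ?ltr_pwDl//; last by rewrite ltW.
under eq_integral.
  move=> x; rewrite inE/= in_itv/= andbT => x0; rewrite -(fV _ x0).
  over.
rewrite ge0_integral_inv0y//.
pose g : R -> R := fun x => x `^ (- z - 1).
have -> : `]0, +oo[%classic = `]0, 1]%classic `|` `]1, +oo[%classic :> set R.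
  apply/seteqP; split => x /=; rewrite !in_itv/= !andbT.
    by move=> ->; case: leP; [left|right].
  by case=> [/andP[]//|]; apply: lt_trans.
rewrite ge0_integral_setU//=; last 3 first.
- by apply: measurable_funS mf => // x /=; rewrite !in_itv/= !andbT; case=> [/andP[]//|]; apply: lt_trans.
- by move=> x _; rewrite lee_fin.
- by apply/disj_set2P/seteqP; split => x //= []; rewrite !in_itv/= andbT => /andP[_ x1]; rewrite ltNge x1.
apply: lte_add_pinfty.
  apply: (@le_lt_trans _ _ (\int[mu]_(x in `]0%R, 1%R]) 1)%E).
    apply: ge0_le_integral => //.
    + by move=> x _; rewrite lee_fin.
    + by apply: measurable_funS mf => // x /=; rewrite !in_itv/= andbT => /andP[].
    + by move=> x _; rewrite lee_fin invf_le1// lerDl powR_ge0.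
  by rewrite integral_cst//= lebesgue_measure_itv/= lte_fin ltr01 mul1e -EFinB ltry.
apply: (@le_lt_trans _ _ (\int[mu]_(x in `]1%R, +oo[) (x `^ (- z - 1))%:E)%E).
  apply: ge0_le_integral => //.
  - by move=> x _; rewrite lee_fin.
  - by apply: measurable_funS mf => // x /=; rewrite !in_itv/= !andbT; apply: lt_trans.
  - by apply/measurable_EFinP/measurable_funTS; exact: measurable_powR.
  - move=> x /=; rewrite in_itv/= andbT => x1; rewrite lee_fin.
    have x0 := lt_trans ltr01 x1.
    by rewrite -opprD powRN lef_pV2 ?posrE ?powR_gt0// lerDr.
by rewrite integral_powR_tail// ltry.
Qed.

Lemma integral0y_gt0 (f : R -> R) a b c : 0 < a -> a < b -> 0 < c ->
  measurable_fun (`]0, +oo[%classic : set R) (fun x => (f x)%:E) ->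
  (forall x, 0 < x -> 0 <= f x) -> (forall x, a <= x -> x <= b -> c <= f x) ->
  (0 < \int[mu]_(t in `]0%R, +oo[) (f t)%:E)%E.
Proof.
move=> a0 ab c0 mf f0 fc.
have sub : `[a, b]%classic `<=` `]0, +oo[%classic.
  by move=> x /=; rewrite !in_itv/= andbT => /andP[+ _]; apply: lt_le_trans.
apply: (@lt_le_trans _ _ (\int[mu]_(t in `[a, b]) c%:E)%E).
  by rewrite integral_cst//= lebesgue_measure_itv/= lte_fin ab -EFinB -EFinM lte_fin mulr_gt0 ?subr_gt0.
apply: (@le_trans _ _ (\int[mu]_(t in `[a, b]) (f t)%:E)%E).
  apply: ge0_le_integral => //.
  - by move=> x _; rewrite lee_fin ltW.
  - by apply: measurable_funS mf.
  - by move=> x /=; rewrite in_itv/= => /andP[ax xb]; rewrite lee_fin fc.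
apply: ge0_subset_integral => //.
by move=> x /=; rewrite in_itv/= andbT => x0; rewrite lee_fin f0.
Qed.

Lemma integral_gamma_gt0 z : 0 < z ->
  (0 < \int[mu]_(t in `]0%R, +oo[) (t `^ (z - 1) * expR (- t))%:E)%E.
Proof.
move=> z0; apply: (@integral0y_gt0 _ 1 2 (2^-1 * expR (- 2))) => //.
- by rewrite ltr1n.
- apply/measurable_EFinP/measurable_funTS; apply: measurable_funM.
    exact: measurable_powR.
  exact: measurableT_comp.
- by move=> x _; rewrite mulr_ge0 ?powR_ge0 ?expR_ge0.
- move=> x x1 x2; have x0 : 0 < x by exact: lt_le_trans x1.
  rewrite ler_pM ?invr_ge0 ?expR_ge0//; last by rewrite ler_expR lerN2.
  rewrite powRB ?(gt_eqF x0) ?implybT// powRr1 ?(ltW x0)//.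
  rewrite ler_pdivlMr// (@le_trans _ _ 1)//; first by rewrite ler_pdivrMl// mulr1.
  by rewrite -(powRr0 x) ler_powR// ltW.
Qed.

Lemma euler_gammaE z : 0 < z ->
  (\int[mu]_(t in `]0%R, +oo[) (t `^ (z - 1) * expR (- t))%:E = (euler_gamma z)%:E)%E.
Proof.
move=> z0; rewrite /euler_gamma /Rintegral fineK// ge0_fin_numE ?integral_gamma_lty//.
by apply: integral_ge0 => x _; rewrite lee_fin mulr_ge0 ?powR_ge0 ?expR_ge0.
Qed.

Lemma euler_gamma_gt0 z : 0 < z -> 0 < euler_gamma z.
Proof. by move=> z0; rewrite -lte_fin -euler_gammaE// integral_gamma_gt0. Qed.

End half_line.

(** * Real integrals together with their values *)

Section has_integral.
Context d (T : measurableType d) (R : realType) (mu : {measure set T -> \bar R}).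
Variables (D : set T) (mD : measurable D).
Implicit Types (f g : T -> R) (v w : R).

(** Integrability and the value are carried together, with a real value, so that linear
    combinations need no side conditions on extended reals. *)
Definition has_integral f v := mu.-integrable D (EFin \o f) /\
  (\int[mu]_(x in D) (f x)%:E = v%:E)%E.

Lemma has_integral_ge0 f v : measurable_fun D f -> (forall x, D x -> 0 <= f x) ->
  (\int[mu]_(x in D) (f x)%:E = v%:E)%E -> has_integral f v.
Proof.
move=> mf f0 fv; split => //; apply/integrableP; split; first exact/measurable_EFinP.
under eq_integral.
  move=> x; rewrite inE => Dx; rewrite /= ger0_norm ?f0//.
  over.
by rewrite fv ltry.
Qed.

Lemma has_integralZl f v a : has_integral f v -> has_integral (fun x => a * f x) (a * v).
Proof.
move=> [fi fv]; split.
  by rewrite (_ : EFin \o _ = (fun x => a%:E * (EFin \o f) x)%E)//; exact: integrableZl.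
by under eq_integral do rewrite EFinM; rewrite integralZl// fv.
Qed.

Lemma has_integral_sum (I : Type) (r : seq I) (f : I -> T -> R) (v : I -> R) :
  (forall i, has_integral (f i) (v i)) ->
  has_integral (fun x => \sum_(i <- r) f i x) (\sum_(i <- r) v i).
Proof.
move=> fi; split.
  rewrite (_ : EFin \o _ = (fun x => \sum_(i <- r) (EFin \o f i) x)%E); last first.
    by apply/funext => x /=; rewrite sumEFin.
  by apply: integrable_sum => // i _; have [] := fi i.
under eq_integral do rewrite -sumEFin.
rewrite (integral_sum mD (f := fun i x => (f i x)%:E)); last by move=> i; have [] := fi i.
by rewrite -sumEFin; apply: eq_bigr => i _; have [] := fi i.
Qed.

Lemma eq_has_integral f g v : (forall x, D x -> f x = g x) -> has_integral f v -> has_integral g v.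
Proof.
move=> fg [fi fv]; split.
  by apply: eq_integrable fi => // x; rewrite inE => Dx /=; rewrite fg.
by rewrite -fv; apply: eq_integral => x; rewrite inE => Dx; rewrite fg.
Qed.

Lemma has_integral_Rintegral f v : has_integral f v -> \int[mu]_(x in D) f x = v.
Proof. by move=> [_ fv]; rewrite /Rintegral fv. Qed.

Lemma integrable_has_integral f : mu.-integrable D (EFin \o f) ->
  has_integral f (\int[mu]_(x in D) f x).
Proof. by move=> fi; split => //; rewrite /Rintegral fineK//; exact: integrable_fin_num. Qed.

End has_integral.

(** * Moments of the heat sum *)

Section finite_difference.
Context {R : idomainType}.

Lemma finite_difference_rec n (f : nat -> R) :
  \sum_(i < n.+2) (-1) ^+ i * 'C(n.+1, i)%:R * f i =
  \sum_(i < n.+1) (-1) ^+ i * 'C(n, i)%:R * f i - \sum_(i < n.+1) (-1) ^+ i * 'C(n, i)%:R * f i.+1.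
Proof.
rewrite big_ord_recl.
under eq_bigr => i _ do rewrite binS natrD mulrDr mulrDl.
rewrite big_split/= addrA; congr (_ + _).
  rewrite [RHS]big_ord_recl big_ord_recr/= !bin0; congr (_ + _).
  by rewrite bin_small// mulr0n mulr0 mul0r addr0.
by rewrite -sumrN; apply: eq_bigr => i _; rewrite /bump/= add1n exprS; ring.
Qed.

(** Passing from [p] to [p - p (X + 1)] lowers the degree and the order of the difference by one. *)
Lemma sum_binomial_sign_poly (n : nat) (p : {poly R}) : (size p <= n)%N ->
  \sum_(i < n.+1) (-1) ^+ i * 'C(n, i)%:R * p.[i%:R] = 0.
Proof.
elim: n p => [|n IH] p.
  by rewrite leqn0 size_poly_eq0 => /eqP ->; rewrite big_ord1 horner0 mulr0.
move=> pn; pose q := p - (p \Po ('X + 1%:P)).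
have sX : size ('X + 1%:P : {poly R}) = 2 by exact: size_XaddC.
have qn : (size q <= n)%N.
  apply/leq_sizeP => j nj; rewrite coefB.
  have [pj|jp] := leqP (size p) j; first by rewrite !nth_default ?subr0// size_comp_poly2.
  have pE : size p = j.+1 by apply/eqP; rewrite eqn_leq jp (leq_trans pn).
  have -> : p`_j = lead_coef p by rewrite lead_coefE pE.
  have -> : (p \Po ('X + 1%:P))`_j = lead_coef (p \Po ('X + 1%:P)).
    by rewrite lead_coefE size_comp_poly2// pE.
  by rewrite lead_coef_comp ?sX// lead_coefXaddC expr1n mulr1 subrr.
rewrite -[RHS](IH q qn).
rewrite (finite_difference_rec n (fun i => p.[i%:R])) -sumrB; apply: eq_bigr => i _.
by rewrite -mulrBr /q hornerD hornerN horner_comp !hornerE -natr1.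
Qed.

End finite_difference.

Section pointwise_derivative.
Context {R : realType}.
Implicit Types (f g : R -> R) (x a b c : R).

Lemma is_derive1_ext f g x a : is_derive x 1 f a -> f =1 g -> is_derive x 1 g a.
Proof. by move=> fa /funext <-. Qed.

Lemma is_derive1D f g x a b : is_derive x 1 f a -> is_derive x 1 g b ->
  is_derive x 1 (fun y => f y + g y) (a + b).
Proof. by move=> fa gb; exact: is_deriveD. Qed.

Lemma is_derive1N f x a : is_derive x 1 f a -> is_derive x 1 (fun y => - f y) (- a).
Proof. by move=> fa; exact: is_deriveN. Qed.

Lemma is_derive1M f g x a b : is_derive x 1 f a -> is_derive x 1 g b ->
  is_derive x 1 (fun y => f y * g y) (f x * b + g x * a).
Proof. by move=> fa gb; exact: is_deriveM. Qed.

Lemma is_derive1Z f x a c : is_derive x 1 f a -> is_derive x 1 (fun y => c * f y) (c * a).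
Proof. by move=> fa; exact: is_deriveZ. Qed.

Lemma is_derive1_linear c x : is_derive x 1 (fun y => c * y) c.
Proof. by have := is_derive1Z c (is_derive_id x 1); rewrite mulr1. Qed.

Lemma is_derive1_expR f x a : is_derive x 1 f a ->
  is_derive x 1 (fun y => expR (f y)) (expR (f x) * a).
Proof. by move=> fa; apply: (is_derive1_comp (f := expR)). Qed.

Lemma is_derive1X f n x a : is_derive x 1 f a ->
  is_derive x 1 (fun y => f y ^+ n.+1) (n.+1%:R * f x ^+ n * a).
Proof.
move=> fa; have h : is_derive x 1 (f ^+ n.+1) (n.+1%:R * f x ^+ n * a) := is_deriveX n.+1 fa.
apply: (is_derive1_ext h) => y; clear h.
by move: n.+1 => k; elim: k => [//|k IH]; rewrite exprS/= [in RHS]exprS -IH.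
Qed.

End pointwise_derivative.

Section exp_remainder.
Context {R : realType}.
Notation mu := (@lebesgue_measure R).
Implicit Types (r s t x z b : R) (n : nat).

(** With this sign the Taylor remainder of [exp (- r)] is nonnegative for [r >= 0]. *)
Definition exp_remainder n r : R :=
  (-1) ^+ n * (expR (- r) - \sum_(j < n) (- r) ^+ j / j`!%:R).

Lemma is_derive_exp_remainder n x :
  is_derive x 1 (exp_remainder n.+1) (exp_remainder n x).
Proof.
have dN : is_derive x 1 (fun r : R => - r) (- 1) by exact: is_derive1N.
have dsum : is_derive x 1 (fun r : R => \sum_(j < n.+1) (- r) ^+ j / j`!%:R)
    (- \sum_(j < n) (- x) ^+ j / j`!%:R).
  elim: n => [|n IH].
    rewrite big_ord0 oppr0.
    have h : is_derive x 1 (cst (1 : R)) (0 : R) by exact: is_derive_cst.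
    apply: (is_derive1_ext h) => r.
    by rewrite big_ord1 expr0 fact0 divr1.
  have := is_derive1D IH (is_derive1Z (n.+1`!%:R^-1) (is_derive1X n dN)).
  move/(is_derive1_ext (g := fun r => \sum_(j < n.+2) (- r) ^+ j / j`!%:R)) => h.
  apply: is_derive_eq; first by apply: h => r; rewrite [RHS]big_ord_recr/= mulrC.
  rewrite [in RHS]big_ord_recr/= opprD; congr (_ + _).
  rewrite factS natrM; have := fact_gt0 n; have n1 : n.+1%:R != 0 :> R by rewrite pnatr_eq0.
  rewrite -(ltr_nat R) lt0r => /andP[n0 _].
  by move: (n.+1%:R : R) n1 => c c0; field; rewrite n0 c0.
have de : is_derive x 1 (fun r : R => expR (- r)) (expR (- x) * - 1) by exact: is_derive1_expR.
apply: is_derive_eq (is_derive1Z ((-1) ^+ n.+1) (is_derive1D de (is_derive1N dsum))) _.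
by rewrite /exp_remainder exprS; ring.
Qed.

Lemma exp_remainder_at0 n : exp_remainder n.+1 0 = 0.
Proof.
rewrite /exp_remainder oppr0 expR0 big_ord_recl/= expr0 fact0 divr1.
by rewrite big1 ?addr0 ?subrr ?mulr0// => i _; rewrite expr0n mul0r.
Qed.

Lemma continuous_exp_remainder n : continuous (exp_remainder n).
Proof.
move=> x; have : derivable (exp_remainder n) x 1.
  case: n => [|n]; last by have [] := is_derive_exp_remainder n x.
  have := is_derive1_expR (is_derive1N (is_derive_id x 1)); case => + _.
  rewrite (_ : exp_remainder 0 = (fun r => expR (- r)))//.
  by apply/funext => r; rewrite /exp_remainder big_ord0 expr0 mul1r subr0.
exact: derivable1_continuous.
Qed.

(** The derivative of each remainder is the previous one, and those of positive order vanish at [0]. *)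
Lemma exp_remainder_ge0 n x : 0 <= x -> 0 <= exp_remainder n x.
Proof.
elim: n x => [|n IH] x; first by rewrite /exp_remainder big_ord0 expr0 mul1r subr0 expR_ge0.
rewrite le_eqVlt => /predU1P[<-|x0]; first by rewrite exp_remainder_at0.
rewrite -lee_fin -(integral_0_FTC (@continuous_exp_remainder n) (is_derive_exp_remainder n)
  (exp_remainder_at0 n) x0).
by apply: integral_ge0 => t /=; rewrite in_itv/= => /andP[t0 _]; rewrite lee_fin IH// ltW.
Qed.

(** Each further Taylor term is an integration by parts, which lowers the exponent by one and
    contributes one factor of the functional equation of Gamma. *)
Lemma integral_exp_remainder n z : 0 < z -> z < 1 ->
  (\int[mu]_(r in `]0%R, +oo[) (r `^ (z - n%:R - 1) * exp_remainder n r)%:E =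
   (euler_gamma z / \prod_(j < n) (j.+1%:R - z))%:E)%E.
Proof.
move=> z0 z1; elim: n => [|n IH].
  rewrite big_ord0 divr1 -euler_gammaE//; apply: eq_integral => r _.
  by rewrite subr0 /exp_remainder big_ord0 expr0 mul1r !subr0.
have s0 : 0 < n.+1%:R - z by rewrite subr_gt0 (lt_le_trans z1)// ler1n.
rewrite (_ : z - n.+1%:R - 1 = - (n.+1%:R - z) - 1); last by ring.
rewrite (ge0_integral_powR_primitive s0 (@continuous_exp_remainder n) (is_derive_exp_remainder n)
  (exp_remainder_at0 n)); last first.
  by move=> x x0; rewrite exp_remainder_ge0// ltW.
rewrite big_ord_recr/= invfM mulrA EFinM muleC -IH -ge0_integralZl_EFin//; last 3 first.
- move=> x /=; rewrite in_itv/= andbT => x0.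
  by rewrite lee_fin mulr_ge0 ?powR_ge0 ?exp_remainder_ge0// ltW.
- apply/measurable_EFinP; apply: measurable_funTS; apply: measurable_funM.
    exact: measurable_powR.
  by apply: continuous_measurable_fun; exact: continuous_exp_remainder.
- by rewrite invr_ge0 ltW.
apply: eq_integral => r _; rewrite -EFinM; congr EFin.
by rewrite (_ : z - n%:R - 1 = - (n.+1%:R - z)); [ring|rewrite -natr1; ring].
Qed.

Lemma integral_scale_powR (f : R -> R) s b v : 0 < b -> measurable_fun [set: R] f ->
  (forall x, 0 < x -> 0 <= f x) ->
  (\int[mu]_(r in `]0%R, +oo[) (r `^ (- s - 1) * f r)%:E = v%:E)%E ->
  (\int[mu]_(r in `]0%R, +oo[) (r `^ (- s - 1) * f (b * r))%:E = (b `^ s * v)%:E)%E.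
Proof.
move=> b0 mf f0 fv.
pose g x := (x `^ (- s - 1) * f x)%:E.
have mg : measurable_fun (`]0, +oo[%classic : set R) g.
  apply/measurable_EFinP; apply: measurable_funTS; apply: measurable_funM; last exact: mf.
  exact: measurable_powR.
have g0 x : 0 < x -> (0 <= g x)%E.
  by move=> x0; rewrite lee_fin mulr_ge0 ?powR_ge0 ?f0.
have := ge0_integral_scale0y b0 mg g0.
rewrite [in X in _ = X -> _]/g fv -EFinM => h.
have -> : b `^ s * v = b `^ (s + 1) * (b^-1 * v).
  rewrite powRD ?(gt_eqF b0) ?implybT// powRr1 ?(ltW b0)//.
  by field; rewrite gt_eqF.
rewrite EFinM -h -ge0_integralZl_EFin ?powR_ge0//; last 2 first.
- by move=> x /=; rewrite in_itv/= andbT => x0; apply: g0; rewrite mulr_gt0.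
- apply/measurable_EFinP; apply: measurable_funTS; apply: measurable_funM.
    apply: (measurableT_comp (measurable_powR _)); exact: measurable_funM.
  apply: (measurableT_comp mf); exact: measurable_funM.
apply: eq_integral => r; rewrite inE/= in_itv/= andbT => r0.
rewrite /g -EFinM; congr EFin; rewrite powRM ?ltW// mulrA mulrA -powRD ?(gt_eqF b0) ?implybT//.
by rewrite (_ : s + 1 + _ = 0) ?powRr0 ?mul1r//; ring.
Qed.

(** Frullani's integral, by swapping the integrals of [exp (- t r)] over [r > 0] and
    [1 < t < b]. *)
Lemma integral_frullani b : 1 <= b ->
  (\int[mu]_(r in `]0%R, +oo[) (r^-1 * (expR (- r) - expR (- (b * r))))%:E = (ln b)%:E)%E.
Proof.
rewrite le_eqVlt => /predU1P[<-|b1].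
  by rewrite ln1; apply: integral0_eq => r _; rewrite mul1r subrr mulr0.
pose I : set R := `]0, +oo[%classic; pose K : set R := `[1, b]%classic.
pose h (z : measurableTypeR R * measurableTypeR R) : \bar R :=
  (expR (- ((z.2 : R) * z.1)) * \1_I (z.1 : R) * \1_K (z.2 : R))%:E.
have I1 x : \1_I x = (0 < x)%R%:R :> R by rewrite indicE /I mem_setE in_itv/= andbT.
have K1 x : \1_K x = (1 <= x <= b)%R%:R :> R by rewrite indicE /K mem_setE in_itv.
have h0 (z : measurableTypeR R * measurableTypeR R) : (0 <= h z)%E.
  by rewrite /h I1 K1 lee_fin !mulr_ge0 ?expR_ge0.
have mI : measurable_fun [set: R] (\1_I : R -> R) by apply: measurable_indic; exact: measurable_itv.
have mK : measurable_fun [set: R] (\1_K : R -> R) by apply: measurable_indic; exact: measurable_itv.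
have me (t : R) : measurable_fun [set: R] (fun r => expR (- (t * r))).
  by apply: measurableT_comp => //; apply: measurableT_comp => //; exact: measurable_funM.
have mh : measurable_fun setT h.
  apply/measurable_EFinP; apply: measurable_funM; last exact: (measurableT_comp mK measurable_snd).
  apply: measurable_funM; last exact: (measurableT_comp mI measurable_fst).
  apply: measurableT_comp => //; apply: measurableT_comp => //.
  by apply: measurable_funM; [exact: measurable_snd|exact: measurable_fst].
have := fubini_tonelli (m1 := mu) (m2 := mu) h mh h0.
have cont (f : R -> R) x : derivable f x 1 -> {for x, continuous f} by exact: derivable1_continuous.
have dE c x : c != 0 -> is_derive x 1 (fun x => - (c^-1 * expR (- (c * x)))) (expR (- (c * x))).
  move=> c0; apply: is_derive_eq (is_derive1N (is_derive1Z c^-1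
    (is_derive1_expR (is_derive1N (is_derive1_linear c x))))) _.
  by field.
have cE c : continuous (fun x : R => expR (- (c * x))).
  move=> x; apply: cont.
  by have [] := is_derive1_expR (is_derive1N (is_derive1_linear c x)).
have cP c : c != 0 -> continuous (fun x : R => - (c^-1 * expR (- (c * x)))).
  by move=> c0 x; apply: cont; have [] := dE c x c0.
rewrite [X in X = _ -> _](_ : _ =
  \int[mu]_(r in `]0%R, +oo[) (r^-1 * (expR (- r) - expR (- (b * r))))%:E)%E; last first.
  rewrite [RHS]integral_mkcond; apply: eq_integral => r _; rewrite patchE mem_setE.
  rewrite in_itv/= andbT; case: ltP => r0; last first.
    by apply: integral0_eq => t _; rewrite /h/= I1 ltNge r0/= mulr0 mul0r.
  transitivity (\int[mu]_(t in `[1%R, b]) (expR (- (r * t)))%:E)%E.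
    rewrite [RHS]integral_mkcond; apply: eq_integral => t _; rewrite patchE mem_setE /h/= I1 K1.
    by rewrite in_itv/= r0 mulr1 (mulrC r); case: ifP; rewrite ?mulr1 ?mulr0.
  rewrite (@continuous_FTC2 _ _ (fun x => - (r^-1 * expR (- (r * x)))))//.
  - by rewrite -EFinB mulr1 (mulrC r b); congr EFin; ring.
  - by apply: continuous_subspaceT; exact: cE.
  - split.
    + by move=> x _; have [] := dE r x (lt0r_neq0 r0).
    + by apply: cvg_at_right_filter; apply: cP; rewrite gt_eqF.
    + by apply: cvg_at_left_filter; apply: cP; rewrite gt_eqF.
  - by move=> x _; rewrite derive1E; have [_ ->] := dE r x (lt0r_neq0 r0).
move=> ->; transitivity (\int[mu]_(t in `[1%R, b]) (t^-1)%:E)%E.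
  rewrite [RHS]integral_mkcond; apply: eq_integral => t _; rewrite patchE mem_setE in_itv/=.
  case: ifP => t1; last first.
    by apply: integral0_eq => r _; rewrite /h/= K1 t1/= mulr0.
  have t0 : 0 < t by move: t1 => /andP[t1 _]; exact: lt_le_trans t1.
  transitivity (\int[mu]_(r in `]0%R, +oo[) (expR (- (t * r)))%:E)%E.
    rewrite [RHS]integral_mkcond; apply: eq_integral => r _; rewrite patchE mem_setE /h/= I1 K1.
    by rewrite in_itv/= t1 andbT mulr1; case: ifP; rewrite ?mulr1 ?mulr0.
  rewrite integral_itv_obnd_cbnd; last by apply/measurable_EFinP/measurable_funTS.
  rewrite (@ge0_continuous_FTC2y _ _ (fun x => - (t^-1 * expR (- (t * x)))) _ 0)//.
  - by rewrite mulr0 oppr0 expR0 mulr1 EFinN oppeK add0e.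
  - by apply: continuous_subspaceT; exact: cE.
  - have : - (t^-1 * expR (- (t * x))) @[x --> +oo] --> - (t^-1 * 0).
      apply: cvgN; apply: cvgM; first exact: cvg_cst.
      apply: (cvg_comp (fun x => t * x) (fun x => expR (- x))); last exact: cvgr_expR.
      by apply: gt0_cvgMry => //; exact: cvg_id.
    by rewrite mulr0 oppr0.
  - by apply: cvg_at_right_filter; apply: cP; rewrite gt_eqF.
  - by move=> x _; rewrite derive1E; have [_ ->] := dE t x (lt0r_neq0 t0).
have dl (x : R) : 1 <= x -> is_derive x 1 (@ln R) x^-1.
  by move=> x1; apply: is_derive1_ln; exact: lt_le_trans x1.
rewrite (@continuous_FTC2 _ _ (@ln R))//.
- by rewrite ln1 sube0.
- apply: continuous_in_subspaceT => x; rewrite inE/= in_itv/= => /andP[x1 _].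
  by apply: inv_continuous; rewrite gt_eqF// (lt_le_trans ltr01).
- split.
  + by move=> x; rewrite in_itv/= => /andP[/ltW x1 _]; have [] := dl x x1.
  + by apply: cvg_at_right_filter; apply: cont; have [] := dl 1 (lexx _).
  + by apply: cvg_at_left_filter; apply: cont; have [] := dl b (ltW b1).
- by move=> x; rewrite in_itv/= => /andP[/ltW x1 _]; rewrite derive1E; have [_ ->] := dl x x1.
Qed.

(** Against [r^(-n-1)] the remainder of order [n] diverges logarithmically at [0], where it behaves
    like [r^n]; in this combination the terms in [r^n] cancel. *)
Definition log_remainder n b r : R := b ^+ n * exp_remainder n r - exp_remainder n (b * r).

Lemma is_derive_log_remainder n b x :
  is_derive x 1 (log_remainder n.+1 b) (b * log_remainder n b x).
Proof.
have h : is_derive x 1 (fun r => exp_remainder n.+1 (b * r)) (exp_remainder n (b * x) * b).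
  exact: (is_derive1_comp (is_derive_exp_remainder n (b * x)) (is_derive1_linear b x)).
apply: is_derive_eq (is_derive1D (is_derive1Z (b ^+ n.+1) (is_derive_exp_remainder n x)) (is_derive1N h)) _.
by rewrite /log_remainder exprS; ring.
Qed.

Lemma log_remainder_at0 n b : log_remainder n.+1 b 0 = 0.
Proof. by rewrite /log_remainder mulr0 !exp_remainder_at0 mulr0 subr0. Qed.

Lemma continuous_log_remainder n b : continuous (log_remainder n b).
Proof.
move=> x; apply: cvgB.
  apply: cvgM; first exact: cvg_cst.
  exact: continuous_exp_remainder.
apply: (@continuous_comp _ _ _ (fun r => b * r) (exp_remainder n)).
  by apply: cvgM; [exact: cvg_cst|exact: cvg_id].
exact: continuous_exp_remainder.
Qed.

Lemma log_remainder_ge0 n b x : 1 <= b -> 0 <= x -> 0 <= log_remainder n b x.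
Proof.
move=> b1; elim: n x => [|n IH] x x0.
  rewrite /log_remainder /exp_remainder !big_ord0 expr0 !mul1r !subr0 subr_ge0 ler_expR lerN2.
  by rewrite ler_peMl.
move: x0; rewrite le_eqVlt => /predU1P[<-|x0]; first by rewrite log_remainder_at0.
have cF : continuous (fun x => b * log_remainder n b x).
  by move=> y; apply: cvgM; [exact: cvg_cst|exact: continuous_log_remainder].
rewrite -lee_fin -(integral_0_FTC cF (is_derive_log_remainder n b) (log_remainder_at0 n b) x0).
apply: integral_ge0 => t /=; rewrite in_itv/= => /andP[t0 _].
by rewrite lee_fin mulr_ge0 ?IH ?(ltW t0)// (le_trans ler01).
Qed.

(** Induction on [n] from the Frullani integral: the derivative of each combination is [b] times
    the previous one. *)
Lemma integral_log_remainder n b : 1 <= b ->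
  (\int[mu]_(r in `]0%R, +oo[) (r `^ (- n%:R - 1) * log_remainder n b r)%:E =
   (b ^+ n / n`!%:R * ln b)%:E)%E.
Proof.
move=> b1; have b0 : 0 <= b by rewrite (le_trans ler01).
elim: n => [|n IH].
  rewrite expr0 fact0 divr1 mul1r -integral_frullani//; apply: eq_integral => r.
  rewrite inE/= in_itv/= andbT => r0.
  rewrite /log_remainder /exp_remainder !big_ord0 expr0 !mul1r !subr0 oppr0 sub0r.
  by rewrite powR_inv1 ?ltW.
have s0 : 0 < n.+1%:R :> R by rewrite ltr0n.
have cF : continuous (fun x => b * log_remainder n b x).
  by move=> y; apply: cvgM; [exact: cvg_cst|exact: continuous_log_remainder].
rewrite (ge0_integral_powR_primitive s0 cF (is_derive_log_remainder n b) (log_remainder_at0 n b)); last first.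
  by move=> x x0; rewrite mulr_ge0 ?log_remainder_ge0// ltW.
have -> : b ^+ n.+1 / n.+1`!%:R * ln b = b / n.+1%:R * (b ^+ n / n`!%:R * ln b).
  rewrite factS natrM exprS invfM; ring.
rewrite EFinM -IH -ge0_integralZl_EFin//; last 3 first.
- move=> x /=; rewrite in_itv/= andbT => x0.
  by rewrite lee_fin mulr_ge0 ?powR_ge0 ?log_remainder_ge0// ltW.
- apply/measurable_EFinP; apply: measurable_funTS; apply: measurable_funM.
    exact: measurable_powR.
  by apply: continuous_measurable_fun; exact: continuous_log_remainder.
- by rewrite divr_ge0.
apply: eq_integral => r _; rewrite -EFinM; congr EFin.
by rewrite (_ : - n%:R - 1 = - n.+1%:R); [ring|rewrite -natr1; ring].
Qed.

End exp_remainder.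

Section heat_sum.
Context {R : realType}.
Notation mu := (@lebesgue_measure R).
Implicit Types (m j n : nat) (r s : R).

(** The coefficients and nodes of the symmetric difference of order [2m]; the index [j] stands
    for [k = j - m], and [dcoef m j] is [(-1)^k C(2m, m-k)]. *)
Definition dcoef m j : R := (-1) ^+ (j + m) * 'C(2 * m, j)%:R.
Definition dnode m j : R := j%:R - m%:R.

(** The difference of order [2m] annihilates polynomials of degree less than [2m]. *)
Lemma dcoef_moment m q : (q < m)%N ->
  \sum_(j < (2 * m).+1) dcoef m j * (dnode m j ^+ 2) ^+ q = 0.
Proof.
move=> qm; pose p : {poly R} := ('X - m%:R%:P) ^+ (2 * q).
have sp : (size p <= 2 * m)%N by rewrite size_exp_XsubC ltn_mul2l.
transitivity ((-1) ^+ m * (0 : R)); last by rewrite mulr0.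
rewrite -[in RHS](sum_binomial_sign_poly sp).
rewrite big_distrr/=; apply: eq_bigr => j _.
rewrite /p horner_exp !hornerE /dcoef /dnode exprD (exprM _ 2 q).
by rewrite (mulrC ((-1) ^+ j)).
Qed.

(** The symmetric difference of order [2m] at [0], with unit step, of [x -> exp (- x^2 r)]. *)
Definition heat_sum m r := \sum_(j < (2 * m).+1) dcoef m j * expR (- (dnode m j ^+ 2 * r)).

(** Since the low moments of the coefficients vanish, the Taylor polynomial of every exponential
    may be subtracted. *)
Lemma heat_sumE m n r : (n <= m)%N ->
  heat_sum m r = (-1) ^+ n * \sum_(j < (2 * m).+1) dcoef m j * exp_remainder n (dnode m j ^+ 2 * r).
Proof.
move=> nm; rewrite big_distrr/=.
transitivity (heat_sum m r - \sum_(q < n) ((- r) ^+ q / q`!%:R *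
   \sum_(j < (2 * m).+1) dcoef m j * (dnode m j ^+ 2) ^+ q)).
  rewrite [X in _ - X]big1 ?subr0// => q _.
  by rewrite dcoef_moment ?mulr0// (leq_trans _ nm).
under [X in _ - X]eq_bigr => q _ do rewrite big_distrr/=.
rewrite exchange_big/= -sumrB; apply: eq_bigr => j _.
rewrite /exp_remainder mulrCA (mulrA ((-1) ^+ n)) -expr2 sqrr_sign mul1r mulrBr; congr (_ - _).
rewrite big_distrr/=; apply: eq_bigr => q _.
rewrite -(mulrN (dnode m j ^+ 2) r) [(_ * - r) ^+ q]exprMn.
by move: ((- r) ^+ q) ((dnode m j ^+ 2) ^+ q) => a c; ring.
Qed.

Lemma measurable_heat_sum m : measurable_fun [set: R] (heat_sum m).
Proof.
apply: measurable_sum => j; apply: measurable_funM => //.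
by apply: measurableT_comp => //; apply: measurableT_comp => //; exact: measurable_funM.
Qed.

Let I : set (measurableTypeR R) := `]0 : R, +oo[%classic.

Lemma dnode_ge1 m j : dnode m j ^+ 2 != 0 -> 1 <= dnode m j ^+ 2.
Proof.
rewrite sqrf_eq0 /dnode subr_eq0 eqr_nat => jm.
have [mj|jm'] := leqP m j; first by rewrite -natrB// -natrX ler1n expn_gt0 subn_gt0 ltn_neqAle eq_sym jm mj.
by rewrite -sqrrN opprB -natrB 1?ltnW// -natrX ler1n expn_gt0 subn_gt0 jm'.
Qed.

(** Euler's integral continued below [0] by subtracting Taylor polynomials (Cauchy, Saalschuetz),
    applied to each exponential after rescaling. *)
Lemma heat_sum_moment_frac m n z : (n <= m)%N -> (0 < n)%N -> 0 < z -> z < 1 ->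
  has_integral mu I (fun r => r `^ (- (n%:R - z) - 1) * heat_sum m r)
   ((-1) ^+ n * (euler_gamma z / \prod_(j < n) (j.+1%:R - z)) *
    \sum_(j < (2 * m).+1) dcoef m j * (dnode m j ^+ 2) `^ (n%:R - z)).
Proof.
move=> nm n0 z0 z1; set A := euler_gamma z / _; set s := n%:R - z.
have s0 : 0 < s by rewrite subr_gt0 (lt_le_trans z1)// ler1n.
have mI : measurable I by exact: measurable_itv.
have h (j : nat) : has_integral mu I
    (fun r => r `^ (- s - 1) * exp_remainder n (dnode m j ^+ 2 * r))
    ((dnode m j ^+ 2) `^ s * A).
  apply: has_integral_ge0 => //.
  - apply: measurable_funTS; apply: measurable_funM; first exact: measurable_powR.
    apply: measurableT_comp; last exact: measurable_funM.
    by apply: continuous_measurable_fun; exact: continuous_exp_remainder.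
  - move=> x; rewrite /I/= in_itv/= andbT => x0.
    by rewrite mulr_ge0 ?powR_ge0 ?exp_remainder_ge0// mulr_ge0 ?sqr_ge0// ltW.
  - have [->|b0] := eqVneq (dnode m j ^+ 2) 0.
      rewrite powR0 ?gt_eqF// mul0r; apply: integral0_eq => x _.
      by rewrite mul0r -(prednK n0) exp_remainder_at0 mulr0.
    apply: integral_scale_powR.
    + by rewrite lt_neqAle eq_sym b0 sqr_ge0.
    + by apply: continuous_measurable_fun; exact: continuous_exp_remainder.
    + by move=> x x0; rewrite exp_remainder_ge0// ltW.
    + rewrite -(integral_exp_remainder n z0 z1); apply: eq_integral => r _.
      by congr (_ `^ _ * _)%:E; rewrite /s; ring.
have := has_integral_sum mI (index_enum (ordinal (2 * m).+1))
  (fun j : 'I_(2 * m).+1 => has_integralZl mI ((-1) ^+ n * dcoef m j) (h j)).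
rewrite [X in has_integral _ _ _ X](_ : _ = (-1) ^+ n * A *
    \sum_(j < (2 * m).+1) dcoef m j * (dnode m j ^+ 2) `^ s).
  apply: eq_has_integral => // r Ir; rewrite (heat_sumE _ nm) mulrCA 2!big_distrr/=.
  by apply: eq_bigr => j _; ring.
by rewrite [RHS]big_distrr/=; apply: eq_bigr => j _; ring.
Qed.

(** Adding [b^n * exp_remainder n r] to the term of the node with square [b] does not change the sum,
    again by the vanishing moments, and turns the remainders into logarithmic ones. *)
Lemma heat_sum_moment_int m n : (n < m)%N -> (0 < n)%N ->
  has_integral mu I (fun r => r `^ (- n%:R - 1) * heat_sum m r)
   ((-1) ^+ n.+1 / n`!%:R *
    \sum_(j < (2 * m).+1) dcoef m j * ((dnode m j ^+ 2) ^+ n * ln (dnode m j ^+ 2))).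
Proof.
move=> nm n0.
have mI : measurable I by exact: measurable_itv.
have h (j : nat) : has_integral mu I
    (fun r => r `^ (- n%:R - 1) * log_remainder n (dnode m j ^+ 2) r)
    ((dnode m j ^+ 2) ^+ n / n`!%:R * ln (dnode m j ^+ 2)).
  have [->|b0] := eqVneq (dnode m j ^+ 2) 0.
    have l0 r : log_remainder n 0 r = 0 :> R.
      by rewrite /log_remainder expr0n gtn_eqF// mul0r mul0r -(prednK n0) exp_remainder_at0 subr0.
    rewrite expr0n gtn_eqF//= !mul0r; apply: has_integral_ge0 => //.
    - apply: measurable_funTS; apply: measurable_funM; first exact: measurable_powR.
      by apply: continuous_measurable_fun; exact: continuous_log_remainder.
    - by move=> x _; rewrite l0 mulr0.
    - by apply: integral0_eq => x _; rewrite l0 mulr0.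
  have b1 := dnode_ge1 b0.
  apply: has_integral_ge0 => //.
  - apply: measurable_funTS; apply: measurable_funM; first exact: measurable_powR.
    by apply: continuous_measurable_fun; exact: continuous_log_remainder.
  - move=> x; rewrite /I/= in_itv/= andbT => x0.
    by rewrite mulr_ge0 ?powR_ge0 ?log_remainder_ge0// ltW.
  - exact: integral_log_remainder.
have := has_integral_sum mI (index_enum (ordinal (2 * m).+1))
  (fun j : 'I_(2 * m).+1 => has_integralZl mI ((-1) ^+ n.+1 * dcoef m j) (h j)).
rewrite [X in has_integral _ _ _ X](_ : _ = (-1) ^+ n.+1 / n`!%:R *
    \sum_(j < (2 * m).+1) dcoef m j * ((dnode m j ^+ 2) ^+ n * ln (dnode m j ^+ 2))).
  apply: eq_has_integral => // r Ir.
  have -> : heat_sum m r = (-1) ^+ n.+1 *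
      \sum_(j < (2 * m).+1) dcoef m j * log_remainder n (dnode m j ^+ 2) r.
    rewrite (heat_sumE _ (ltnW nm)) exprS -mulrA mulrCA mulN1r; congr (_ * _).
    under [in RHS]eq_bigr => j _ do rewrite mulrBr mulrA.
    by rewrite sumrB -mulr_suml dcoef_moment// mul0r sub0r opprK.
  by rewrite mulrCA 2!big_distrr/=; apply: eq_bigr => j _; ring.
by rewrite [RHS]big_distrr/=; apply: eq_bigr => j _; ring.
Qed.

(** The nodes [k] and [-k] contribute equally. *)
Lemma sum_dcoef_sym m (h : R -> R) :
  \sum_(j < (2 * m).+1) dcoef m j * h (dnode m j ^+ 2) =
  dcoef m m * h 0 + 2 * \sum_(1 <= k < m.+1) (-1) ^+ k * 'C(2 * m, m - k)%:R * h (k%:R ^+ 2).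
Proof.
pose F (j : nat) := dcoef m j * h (dnode m j ^+ 2).
rewrite -(big_mkord xpredT F) (@big_cat_nat _ _ _ m)//=; last by rewrite leqW// leq_pmull.
rewrite [X in _ + X]big_ltn ?ltnS ?leq_pmull// addrCA.
congr (_ + _); first by rewrite /F /dnode subrr expr0n.
rewrite mulr_natl mulr2n; congr (_ + _).
  rewrite big_nat_rev/= add0n big_add1/= big_nat_cond [RHS]big_nat_cond.
  apply: eq_bigr => k; rewrite andbT => /andP[_ km]; rewrite /F /dcoef /dnode.
  have -> : ((m - k.+1)%:R - m%:R) ^+ 2 = k.+1%:R ^+ 2 :> R by rewrite natrB//; ring.
  congr (_ * _ * _).
  by rewrite -signr_odd oddD oddB// -[RHS]signr_odd addbAC addbb.
rewrite (_ : (2 * m).+1 = m + m.+1)%N; last by rewrite mul2n -addnn addnS.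
rewrite -{1}[m.+1]addn0 addSn -addnS.
rewrite -[X in \sum_(X <= _ < _) _](addnC 1%N m) big_addn.
rewrite addKn.
rewrite big_nat_cond [RHS]big_nat_cond.
apply: eq_bigr => k; rewrite andbT => /andP[k0 km]; rewrite /F /dcoef /dnode.
have -> : ((k + m)%:R - m%:R) ^+ 2 = k%:R ^+ 2 :> R by rewrite natrD; ring.
congr (_ * _ * _).
  by rewrite -signr_odd !oddD -addbA addbb addbF signr_odd.
rewrite -[in RHS]bin_sub; last by rewrite (leq_trans (leq_subr _ _))// leq_pmull.
by congr (_%:R); congr ('C(_, _)); rewrite mul2n -addnn subnBA// -addnA addKn addnC.
Qed.

Definition heat_moment m s : R := \int[mu]_(r in I) (r `^ (- s - 1) * heat_sum m r).

(** In either branch of the constant, the sum over [k] that it inverts is the heat moment up to an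
    elementary factor; if the moment is nonzero the two cancel. *)
Lemma heat_momentP N m s : 0 < s -> s < m%:R ->
  has_integral mu I (fun r => r `^ (- s - 1) * heat_sum m r) (heat_moment m s) /\
  (heat_moment m s != 0 ->
   cNms N m s * (pi `^ (N%:R / 2) * heat_moment m s) = 2 * (4 `^ s * Gamma (N%:R / 2 + s))).
Proof.
move=> s0 sm; rewrite /cNms.
have P0 : pi `^ (N%:R / 2) != 0 :> R by rewrite gt_eqF// powR_gt0// pi_gt0.
case: ifPn => [/natrP[n sn]|snat].
  have n0 : (0 < n)%N by rewrite -(ltr_nat R) -sn.
  have nm : (n < m)%N by rewrite -(ltr_nat R) -sn.
  have h := heat_sum_moment_int nm n0.
  rewrite -sn in h.
  have HE := has_integral_Rintegral h.
  split; first by rewrite /heat_moment HE.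
  have -> : Num.truncn s = n by rewrite sn natrK.
  set S := \sum_(2 <= k < m.+1) _.
  have SE : heat_moment m s = 4 / n`!%:R * S.
    rewrite /heat_moment HE (sum_dcoef_sym m (fun x => x ^+ n * ln x)).
    rewrite expr0n gtn_eqF// mul0r mulr0 add0r /S.
    have [m0|] := posnP m; first by rewrite m0 !big_geq// !mulr0.
    move=> m0; rewrite (@big_ltn _ _ _ 1)// expr1n ln1 mulr0 mulr0 add0r.
    rewrite [in LHS]mulrA !big_distrr/= big_nat_cond [RHS]big_nat_cond.
    apply: eq_bigr => k; rewrite andbT => /andP[k2 km].
    have k0 : 0 < k%:R :> R by rewrite ltr0n (leq_trans _ k2).
    rewrite lnXn// sn -natrM powR_mulrn ?ltW// -exprM.
    have -> : (-1) ^ (k%:Z - n%:Z + 1) = (-1) ^+ n.+1 * (-1) ^+ k :> R.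
      rewrite !expfzDr ?oppr_eq0 ?oner_neq0// expr1z -exprnN invr_sign -!exprnP exprS; ring.
    rewrite -mulr_natr; ring.
  rewrite SE => J0.
  have S0 : S != 0 by apply: contra_neq J0 => ->; rewrite mulr0.
  have f0 : n`!%:R != 0 :> R by rewrite pnatr_eq0 -lt0n fact_gt0.
  move: (4 `^ s) (Gamma _) => A G; field.
  by rewrite f0 S0 P0.
pose n := (Num.truncn s).+1; pose z := n%:R - s.
have tr := truncn_itv (ltW s0).
have z0 : 0 < z by rewrite subr_gt0; case/andP: tr.
have z1 : z < 1.
  rewrite /z /n -natr1 ltrBlDr addrC ltrD2l lt_neqAle; case/andP: tr => -> _; rewrite andbT.
  by apply: contraNneq snat => <-; exact: rpred_nat.
have nm : (n <= m)%N.
  by rewrite /n -(ltr_nat R); case/andP: tr => + _ => /le_lt_trans; apply.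
have h := heat_sum_moment_frac nm (ltn0Sn _) z0 z1.
have zE : n%:R - z = s by rewrite /z; ring.
rewrite zE in h.
have HE := has_integral_Rintegral h.
split; first by rewrite /heat_moment HE.
set S := \sum_(1 <= k < m.+1) _.
have GE : Gamma (- s) = (-1) ^+ n * (euler_gamma z / \prod_(j < n) (j.+1%:R - z)).
  rewrite /Gamma oppr_gt0 ltNge (ltW s0)/= opprK -/n.
  have -> : - s + n%:R = z by rewrite /z addrC.
  rewrite mulrCA; congr (_ * _).
  rewrite (reindex_inj rev_ord_inj)/=.
  rewrite (eq_bigr (fun j : 'I_n => - (j.+1%:R - z))); last first.
    by move=> j _; rewrite natrB// /z; ring.
  rewrite prodrN card_ord invfM -signr_odd; congr (_ * _).
  by case: (odd n); rewrite ?expr0 ?expr1 ?invrN ?invr1.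
have SE : heat_moment m s = Gamma (- s) * (2 * S).
  rewrite /heat_moment HE -GE (sum_dcoef_sym m (fun x => x `^ s)).
  rewrite powR0 ?gt_eqF// mulr0 add0r; congr (_ * (_ * _)).
  by apply: eq_bigr => k _; rewrite -powR_mulrn// -powRrM.
rewrite SE => J0.
have S0 : S != 0 by apply: contra_neq J0 => ->; rewrite mulr0 mulr0.
have G0 : Gamma (- s) != 0 by apply: contra_neq J0 => ->; rewrite mul0r.
move: (4 `^ s) (Gamma (_ + _)) => A G; field.
by rewrite P0 S0 G0.
Qed.

(** As [r -> oo] the heat sum tends to the coefficient of the node [0], which is positive; so the
    nonnegative integrand is bounded below on some interval. *)
Lemma heat_moment_gt0 m s : 0 < s -> s < m%:R -> (forall r, 0 < r -> 0 <= heat_sum m r) ->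
  0 < heat_moment m s.
Proof.
move=> s0 sm g0.
have [[_ hJ] _] := heat_momentP 0 s0 sm.
rewrite -lte_fin -hJ.
(* On [2 M, 4 M] the nodes other than 0 contribute at most M exp (- r) <= 1 / 2. *)
pose M : R := 2 * \sum_(1 <= k < m.+1) 'C(2 * m, m - k)%:R + 1.
have M0 : 0 < M by rewrite ltr_pwDr// mulr_ge0// sumr_ge0.
have M1 : 1 <= 2 * M by rewrite mulr_ege1 ?ler1n// lerDr mulr_ge0// sumr_ge0.
have M2 : 0 < 2 * M by rewrite mulr_gt0.
apply: (@integral0y_gt0 _ _ (2 * M) (4 * M) ((4 * M) `^ (- s - 1) * 2^-1)) => //.
- by rewrite ltr_pM2r// ltr_nat.
- by rewrite mulr_gt0 ?invr_gt0// powR_gt0// mulr_gt0.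
- apply/measurable_EFinP/measurable_funTS; apply: measurable_funM; last exact: measurable_heat_sum.
  exact: measurable_powR.
- by move=> x x0; rewrite mulr_ge0 ?powR_ge0 ?g0.
move=> x Mx xM; have x0 := lt_le_trans M2 Mx.
rewrite ler_pM ?powR_ge0 ?invr_ge0//.
  rewrite -opprD !powRN lef_pV2 ?posrE ?powR_gt0 ?mulr_gt0//.
  by rewrite ge0_ler_powR ?nnegrE ?addr_ge0 ?(ltW s0) ?(ltW x0)// mulr_ge0// ltW.
rewrite /heat_sum (sum_dcoef_sym m (fun y => expR (- (y * x)))) mul0r oppr0 expR0 mulr1.
have -> : dcoef m m = 'C(2 * m, m)%:R.
  by rewrite /dcoef -signr_odd oddD addbb expr0 mul1r.
have C1 : 1 <= 'C(2 * m, m)%:R :> R by rewrite ler1n bin_gt0 leq_pmull.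
have eM : expR (- x) <= (2 * M)^-1.
  rewrite expRN lef_pV2 ?posrE ?expR_gt0// (le_trans Mx)//.
  by apply: le_trans (expR_ge1Dx _); rewrite lerDr.
suff : `|2 * \sum_(1 <= k < m.+1) (-1) ^+ k * 'C(2 * m, m - k)%:R * expR (- (k%:R ^+ 2 * x))| <= 2^-1.
  by rewrite ler_norml => /andP[+ _]; lra.
rewrite normrM ger0_norm//.
apply: (@le_trans _ _ (M * expR (- x))); last first.
  apply: (@le_trans _ _ (M * (2 * M)^-1)); first by rewrite ler_pM2l.
  by rewrite invfM mulrCA divff ?mulr1// gt_eqF.
set E := expR (- x); pose S : R := \sum_(1 <= k < m.+1) 'C(2 * m, m - k)%:R.
have -> : M * E = 2 * (S * E) + E by rewrite /M -/S; ring.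
apply: (@le_trans _ _ (2 * (S * E))); last by rewrite lerDl expR_ge0.
rewrite ler_pM2l// /S /E.
rewrite (le_trans (ler_norm_sum _ _ _))// mulr_suml big_nat_cond [leRHS]big_nat_cond.
apply: ler_sum => k; rewrite andbT => /andP[k1 _].
rewrite !normrM normrX normrN1 expr1n mul1r ger0_norm// ler_wpM2l//.
rewrite ger0_norm ?expR_ge0// ler_expR lerN2 ler_peMl ?(ltW x0)//.
by rewrite -natrX ler1n expn_gt0 k1.
Qed.

End heat_sum.

(** * Lebesgue integration on row vectors *)

Lemma has_integral_measurable d (T : measurableType d) (R : realType)
    (mu : {measure set T -> \bar R}) (D : set T) (f : T -> R) v :
  has_integral mu D f v -> measurable_fun D f.
Proof. by move=> [fi _]; apply/measurable_EFinP; exact: measurable_int fi. Qed.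

Section rV_measure.
Context {R : realType}.
Notation mu := (@lebesgue_measure R).
Notation L := (@lebesgue_rV R).
Implicit Types (n : nat).

Lemma ge0_integral_rV0 (f : 'rV[R]_0 -> \bar R) : measurable_fun setT f ->
  (\int[L 0]_x f x = f 0%R)%E.
Proof. by move=> mf; rewrite /= integral_dirac// diracT mul1e. Qed.

Lemma ge0_integral_rVS n (f : 'rV[R]_n.+1 -> \bar R) :
  measurable_fun setT f -> (forall x, (0 <= f x)%E) ->
  (\int[L n.+1]_x f x = \int[mu]_a \int[L n]_v f (rV_cons (a, v)))%E.
Proof.
move=> mf f0.
transitivity (\int[(mu \x L n)%E]_p (f \o @rV_cons R n) p)%E.
  exact: (ge0_integral_pushforward (@measurable_rV_cons R n) (mu \x L n)%E measurableT mf (fun x _ => f0 x)).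
rewrite fubini_tonelli1//; last by move=> x; exact: f0.
by apply: measurableT_comp => //; exact: measurable_rV_cons.
Qed.

Lemma measurable_coord n (i : 'I_n) : measurable_fun setT (fun x : 'rV[R]_n => x ord0 i).
Proof. exact: measurable_rV_coord. Qed.

Lemma rV_cons0 n (a : R) (v : 'rV[R]_n) : rV_cons (a, v) ord0 ord0 = a.
Proof. by rewrite mxE unlift_none. Qed.

Definition rV_tail n (x : 'rV[R]_n.+1) : 'rV[R]_n := \row_j x ord0 (lift ord0 j).

Lemma rV_tail_cons n (a : R) (v : 'rV[R]_n) : rV_tail (rV_cons (a, v)) = v.
Proof. by apply/rowP => j; rewrite !mxE liftK. Qed.

Lemma measurable_rV_tail n : measurable_fun setT (@rV_tail n).
Proof. by apply: measurable_fun_rV => i; under eq_fun do rewrite mxE; exact: measurable_coord. Qed.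

Lemma has_integral_rVS n (f : R -> R) (g : 'rV[R]_n -> R) a b :
  has_integral mu setT f a -> has_integral (L n) setT g b ->
  has_integral (L n.+1) setT (fun x => f (x ord0 ord0) * g (rV_tail x)) (a * b).
Proof.
move=> [fi fa] [gi gb].
have mf : measurable_fun [set: measurableTypeR R] f by exact: has_integral_measurable (conj fi fa).
have mg : measurable_fun setT g by exact: has_integral_measurable (conj gi gb).
pose k (p : measurableTypeR R * 'rV[R]_n) : \bar R := (f p.1 * g p.2)%:E.
have mk : measurable_fun setT k.
  apply/measurable_EFinP; apply: measurable_funM.
    exact: (measurableT_comp mf measurable_fst).
  exact: (measurableT_comp mg measurable_snd).
have ki : (mu \x L n)%E.-integrable setT k.
  apply/integrable12ltyP => //.
  under eq_integral => x _.
    under eq_integral => v _ do rewrite /k/= normrM EFinM.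
    rewrite ge0_integralZl_EFin//; last by apply/measurable_EFinP; exact: measurableT_comp.
    over.
  move/integrableP : gi => [_]; rewrite /comp/=.
  set G := (\int[L n]_x _)%E => Gy.
  have G0 : (0 <= G)%E by apply: integral_ge0 => x _; rewrite lee_fin.
  rewrite ge0_integralZr//=; last by apply/measurable_EFinP; exact: measurableT_comp.
  rewrite lte_mul_pinfty//; first by apply: integral_ge0 => x _; rewrite lee_fin.
    move/integrableP : fi => [_ fy]; rewrite ge0_fin_numE//.
    by apply: integral_ge0 => x _; rewrite lee_fin.
pose h := (fun x : 'rV[R]_n.+1 => f (x ord0 ord0) * g (rV_tail x)).
have hk : EFin \o h \o @rV_cons R n = k.
  by apply/funext => -[x v]; rewrite /h/= rV_cons0 rV_tail_cons.
have mh : measurable_fun setT (EFin \o h).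
  apply/measurable_EFinP; apply: measurable_funM.
    exact: (measurableT_comp mf (measurable_coord _)).
  exact: (measurableT_comp mg (@measurable_rV_tail n)).
have hi : (mu \x L n)%E.-integrable (@rV_cons R n @^-1` setT) ((EFin \o h) \o @rV_cons R n).
  by rewrite preimage_setT hk.
split.
  exact: (integrable_pushforward (@measurable_rV_cons R n) mh hi measurableT).
transitivity (\int[(mu \x L n)%E]_p k p)%E.
  have := integral_pushforward (@measurable_rV_cons R n) mh hi measurableT.
  by rewrite preimage_setT hk.
rewrite -integral12_prod_meas1//.
transitivity (\int[mu]_x ((f x)%:E * b%:E))%E.
  apply: eq_integral => x _; rewrite /fubini_F /k/=.
  under eq_integral do rewrite EFinM.
  by rewrite integralZl// gb.
by rewrite integralZr// fa.
Qed.

Lemma has_integral_rV0 (f : 'rV[R]_0 -> R) : measurable_fun setT f ->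
  has_integral (L 0) setT f (f 0).
Proof.
move=> mf; have mf' : measurable_fun setT (EFin \o f) by exact/measurable_EFinP.
split.
  apply/integrableP; split => //=.
  rewrite integral_dirac//=; last by apply/measurable_EFinP; exact: measurableT_comp.
  by rewrite diracT mul1e ltry.
by rewrite /= integral_dirac// diracT mul1e.
Qed.

Lemma has_integral_rV_prod n (f : 'I_n -> R -> R) (a : 'I_n -> R) :
  (forall i, has_integral mu setT (f i) (a i)) ->
  has_integral (L n) setT (fun x => \prod_(i < n) f i (x ord0 i)) (\prod_(i < n) a i).
Proof.
elim: n f a => [|n IH] f a fa.
  rewrite big_ord0; have h := has_integral_rV0 (measurable_cst (1 : R)).
  by apply: (eq_has_integral measurableT _ h) => x _; rewrite big_ord0.
have := has_integral_rVS (fa ord0) (IH _ _ (fun i => fa (lift ord0 i))).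
rewrite big_ord_recl; apply: eq_has_integral => // x _.
by rewrite big_ord_recl; congr (_ * _); apply: eq_bigr => i _; rewrite mxE.
Qed.

(** Induction on the dimension; each coordinate contributes one factor [c]. *)
Lemma ge0_integral_rV_coordwise n (phi : 'I_n -> R -> R) (c : R) (f : 'rV[R]_n -> \bar R) :
  0 <= c -> (forall i, measurable_fun [set: measurableTypeR R] (phi i : _ -> measurableTypeR R)) ->
  (forall i (g : R -> \bar R), measurable_fun [set: R] g -> (forall x, (0 <= g x)%E) ->
    (\int[mu]_x g (phi i x) = c%:E * \int[mu]_x g x)%E) ->
  measurable_fun setT f -> (forall x, (0 <= f x)%E) ->
  (\int[L n]_x f (\row_i phi i (x ord0 i)) = (c ^+ n)%:E * \int[L n]_x f x)%E.
Proof.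
move=> c0; elim: n phi f => [|n IH] phi f mphi hphi mf f0.
  rewrite !ge0_integral_rV0//; last first.
    by rewrite (_ : (fun _ => _) = f)//; apply/funext => x; congr f; apply/rowP => -[].
  by rewrite expr0 mul1e; congr f; apply/rowP => -[].
have mphi' m (psi : 'I_m -> R -> R) :
    (forall i, measurable_fun [set: measurableTypeR R] (psi i : _ -> measurableTypeR R)) ->
    measurable_fun setT (fun x : 'rV[R]_m => (\row_i psi i (x ord0 i) : 'rV[R]_m)).
  move=> mpsi; apply: measurable_fun_rV => i; under eq_fun do rewrite mxE.
  exact: (measurableT_comp (mpsi i) (measurable_coord i)).
rewrite ge0_integral_rVS//; last exact: measurableT_comp (mphi' _ _ mphi).
pose F (a : R) := (\int[L n]_v f (rV_cons (a, v)))%E.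
have mF : measurable_fun [set: R] F.
  apply: (@measurable_fun_fubini_tonelli_F _ _ _ _ _ (L n) (fun p => f (rV_cons p))) => //.
  exact: measurableT_comp (@measurable_rV_cons R n).
have F0 a : (0 <= F a)%E by exact: integral_ge0.
rewrite [in RHS]ge0_integral_rVS// -/F exprSr EFinM -muleA -(hphi ord0)//.
rewrite -ge0_integralZl_EFin ?exprn_ge0//; last 2 first.
- by move=> x _; exact: F0.
- exact: (measurableT_comp mF (mphi ord0)).
apply: eq_integral => a _.
have := IH (fun i => phi (lift ord0 i)) (fun v => f (rV_cons (phi ord0 a, v)))
  (fun i => mphi _) (fun i => hphi _).
rewrite -/(F _) => <- //; last first.
  apply: measurableT_comp => //; apply: (measurableT_comp (@measurable_rV_cons R n)).
  exact: measurable_pair1.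
apply: eq_integral => v _; congr f; apply/rowP => i.
by rewrite !mxE; case: unliftP => [j ->|->]/=; rewrite ?mxE ?liftK ?unlift_none//=.
Qed.

(** A change of variables for nonnegative functions extends to integrable ones through positive
    and negative parts. *)
Lemma has_integral_comp d (T : measurableType d) (nu : {measure set T -> \bar R})
    (Phi : T -> T) (c : R) (f : T -> R) v :
  measurable_fun setT Phi ->
  (forall g : T -> \bar R, measurable_fun setT g -> (forall x, (0 <= g x)%E) ->
    (\int[nu]_x g (Phi x) = c%:E * \int[nu]_x g x)%E) ->
  has_integral nu setT f v -> has_integral nu setT (f \o Phi) (c * v).
Proof.
move=> mPhi hPhi [fi fv].
have mf : measurable_fun setT (EFin \o f).
  by apply/measurable_EFinP; exact: has_integral_measurable (conj fi fv).
split.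
  apply/integrableP; split; first exact: (measurableT_comp mf mPhi).
  have /integrableP[_ fy] := fi.
  rewrite [X in (X < _)%E](_ : _ = c%:E * \int[nu]_x `|(EFin \o f) x|)%E; last first.
    by rewrite -hPhi//; exact: measurableT_comp.
  have : (\int[nu]_x `|(EFin \o f) x|)%E \is a fin_num.
    by rewrite ge0_fin_numE//; exact: integral_ge0.
  by move/fineK => <-; rewrite -EFinM ltry.
have E1 := hPhi _ (measurable_funepos mf) (funepos_ge0 _).
have E2 := hPhi _ (measurable_funeneg mf) (funeneg_ge0 _).
have p := integrable_pos_fin_num measurableT fi.
have q := integrable_neg_fin_num measurableT fi.
transitivity (\int[nu]_x ((EFin \o f)^\+ (Phi x)) - \int[nu]_x ((EFin \o f)^\- (Phi x)))%E.
  by rewrite integralE; congr (_ - _)%E; apply: eq_integral => x _; rewrite ?funeposE ?funenegE.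
rewrite E1 E2.
move: fv; rewrite integralE.
rewrite -[in X in X -> _](fineK p) -[in X in X -> _](fineK q).
rewrite -[in X in _ -> X](fineK p) -[in X in _ -> X](fineK q).
by rewrite -!EFinM -!EFinB => -[<-]; rewrite mulrBr.
Qed.

Lemma has_integral_rV_affine n (x0 : 'rV[R]_n) c (f : 'rV[R]_n -> R) v : 0 < c ->
  has_integral (L n) setT f v ->
  has_integral (L n) setT (fun z => f (c *: z + x0)) (c ^- n * v).
Proof.
move=> c0 fv.
have E : (fun z : 'rV[R]_n => c *: z + x0) = fun z => \row_i (c * z ord0 i + x0 ord0 i).
  by apply/funext => z; apply/rowP => i; rewrite !mxE.
apply: (@has_integral_comp _ _ (L n) (fun z => c *: z + x0) (c ^- n) f v _ _ fv).
  rewrite E; apply: measurable_fun_rV => i; under eq_fun do rewrite mxE.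
  by apply: measurable_funD => //; apply: measurable_funM => //; exact: measurable_coord.
move=> g mg g0; rewrite -exprVn.
rewrite -(@ge0_integral_rV_coordwise n (fun i a => c * a + x0 ord0 i))//.
- by apply: eq_integral => z _; congr g; apply/rowP => i; rewrite !mxE.
- by rewrite invr_ge0 ltW.
- by move=> i; exact: measurable_affine.
- by move=> i h mh h0; exact: ge0_integral_affine.
Qed.

Lemma has_integral_rVN n (f : 'rV[R]_n -> R) v :
  has_integral (L n) setT f v -> has_integral (L n) setT (fun z => f (- z)) v.
Proof.
move=> fv; rewrite -[v]mul1r.
apply: (@has_integral_comp _ _ (L n) -%R 1 f v _ _ fv).
  apply: measurable_fun_rV => i; under eq_fun do rewrite mxE.
  by apply: measurableT_comp => //; exact: measurable_coord.
move=> g mg g0; rewrite -(expr1n _ n).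
rewrite -(@ge0_integral_rV_coordwise n (fun i a => - a))//.
- by apply: eq_integral => z _; congr g; apply/rowP => i; rewrite !mxE.
- by move=> i; exact: oppr_measurable.
- by move=> i h mh h0; rewrite mul1e; exact: ge0_integral_oppr.
Qed.

End rV_measure.

Section rV_measurable.
Context {R : realType}.
Implicit Types n : nat.

Lemma mx_norm_leP n (x : 'rV[R]_n) (e : R) : 0 <= e ->
  (`|x| <= e) <-> (forall i, `|x ord0 i| <= e).
Proof.
move=> e0; have -> : `|x| = mx_norm x by [].
rewrite mx_normrE; split.
  move=> /bigmax_leP[_ h] i; exact: (h (ord0, i)).
by move=> h; apply/bigmax_leP; split => // -[i j] _ /=; rewrite ord1.
Qed.

Lemma coord_le_mx_norm n (x : 'rV[R]_n) i : `|x ord0 i| <= `|x|.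
Proof. by move: i; apply/(mx_norm_leP x (normr_ge0 x)). Qed.

(* The grid has mesh 1 / (k + 1). *)
Let grid k (a : R) : int := Num.floor (a * k.+1%:R).

(** The sigma-algebra is generated by the coordinates rather than by the open sets, so [f] is
    obtained as the limit of its values at the grid points below [x]: these take countably many
    values, on products of intervals. *)
Lemma continuous_rV_measurable n (f : 'rV[R]_n -> R) : continuous f -> measurable_fun setT f.
Proof.
move=> cf.
pose node k (z : 'rV[int]_n) : 'rV[R]_n := \row_i ((z ord0 i)%:~R / k.+1%:R).
pose r k (x : 'rV[R]_n) : 'rV[int]_n := \row_i grid k (x ord0 i).
have mr k z : measurable [set x | r k x = z].
  rewrite (_ : [set _ | _] = \bigcap_(i in [set: 'I_n])
      ((fun x : 'rV[R]_n => x ord0 i) @^-1` [set a | grid k a = z ord0 i])).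
    apply: fin_bigcap_measurable => // i _; rewrite -[X in measurable X]setTI.
    apply: measurable_coord => //.
    rewrite (_ : [set _ | _] = `[(z ord0 i)%:~R / k.+1%:R, ((z ord0 i) + 1)%:~R / k.+1%:R[%classic)//.
    apply/seteqP; split => a /=; rewrite in_itv/= ler_pdivrMr// ltr_pdivlMr// /grid.
      by move=> <-; exact: floor_itv.
    by move=> h; exact/floor_def.
  apply/seteqP; split => [x <- i _|x h] /=; first by rewrite mxE.
  by apply/rowP => i; rewrite mxE; exact: h.
apply: (@measurable_fun_cvg _ _ _ _ (fun k x => f (node k (r k x)))).
  move=> k _ Y mY; rewrite setTI.
  rewrite (_ : _ @^-1` _ = \bigcup_(j in [set: nat])
    (if @unpickle 'rV[int]_n j is Some z then
       if `[< Y (f (node k z)) >] then [set x | r k x = z] else set0 else set0)).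
    apply: bigcupT_measurable => j; case: unpickle => [z|//].
    by case: ifP => _ //; exact: mr.
  apply/seteqP; split => [x Yx|x [j _]] /=.
    by exists (pickle (r k x)) => //; rewrite pickleK; case: asboolP.
  by case: unpickle => [z|//]; case: asboolP => // Yz /= ->.
move=> x _; apply: continuous_cvg; first exact: cf.
apply/cvgrPdist_le => e e0; near=> k.
apply/mx_norm_leP; first exact: ltW.
move=> i; rewrite !mxE.
have k0 : 0 < k.+1%:R :> R by rewrite ltr0n.
have /andP[h1 h2] := floor_itv (x ord0 i * k.+1%:R).
rewrite -(ler_pM2r k0) -[X in _ * X <= _](gtr0_norm k0) -normrM mulrBl divfK ?gt_eqF//.
rewrite ger0_norm ?subr_ge0// (@le_trans _ _ 1)//.
  by rewrite lerBlDr addrC -intrD1 ltW.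
rewrite mulrC -ler_pdivrMr// div1r (le_trans (ltW (truncnS_gt _)))// ler_nat ltnS.
near: k; exact: nbhs_infty_ge.
Unshelve. all: by end_near. Qed.

Lemma measurable_enorm n : measurable_fun setT (@enorm R n).
Proof.
apply: (measurableT_comp (continuous_measurable_fun (@sqrt_continuous R))).
apply: measurable_sum => i; apply: measurable_funX; exact: measurable_coord.
Qed.

Lemma enorm_ge0 n (x : 'rV[R]_n) : 0 <= enorm x.
Proof. exact: sqrtr_ge0. Qed.

Lemma sqr_enorm n (x : 'rV[R]_n) : enorm x ^+ 2 = \sum_i x ord0 i ^+ 2.
Proof. by rewrite sqr_sqrtr// sumr_ge0// => i _; rewrite sqr_ge0. Qed.

Lemma dotrC n (x y : 'rV[R]_n) : dotr x y = dotr y x.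
Proof. by apply: eq_bigr => i _; rewrite mulrC. Qed.

Lemma dotrDr n (x y z : 'rV[R]_n) : dotr x (y + z) = dotr x y + dotr x z.
Proof. by rewrite -big_split/=; apply: eq_bigr => i _; rewrite mxE mulrDr. Qed.

Lemma dotrNr n (x y : 'rV[R]_n) : dotr x (- y) = - dotr x y.
Proof. by rewrite -sumrN; apply: eq_bigr => i _; rewrite mxE mulrN. Qed.

Lemma dotrZr n a (x y : 'rV[R]_n) : dotr x (a *: y) = a * dotr x y.
Proof. by rewrite big_distrr/=; apply: eq_bigr => i _; rewrite mxE; ring. Qed.

Lemma dotrBr n (x y z : 'rV[R]_n) : dotr x (y - z) = dotr x y - dotr x z.
Proof. by rewrite dotrDr dotrNr. Qed.

Lemma dotrNl n (x y : 'rV[R]_n) : dotr (- x) y = - dotr x y.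
Proof. by rewrite dotrC dotrNr dotrC. Qed.

Lemma measurable_fun_dotr d (T : measurableType d) n (f g : T -> 'rV[R]_n) :
  measurable_fun setT f -> measurable_fun setT g -> measurable_fun setT (fun t => dotr (f t) (g t)).
Proof.
move=> mf mg; apply: measurable_sum => i; apply: measurable_funM.
  exact: (measurableT_comp (measurable_coord i) mf).
exact: (measurableT_comp (measurable_coord i) mg).
Qed.

End rV_measurable.

(** * Comparison and dominated convergence *)

Section has_integral_more.
Context d (T : measurableType d) (R : realType) (mu : {measure set T -> \bar R}).
Implicit Types (f g : T -> R) (v w : R).

Lemma has_integralD f g v w : has_integral mu setT f v -> has_integral mu setT g w ->
  has_integral mu setT (fun x => f x + g x) (v + w).
Proof.
move=> [fi fv] [gi gw]; split.
  rewrite (_ : EFin \o _ = (EFin \o f) \+ (EFin \o g))%E; last by apply/funext.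
  exact: integrableD.
under eq_integral do rewrite EFinD.
by rewrite (integralD measurableT fi gi) fv gw.
Qed.

Lemma has_integralN f v : has_integral mu setT f v -> has_integral mu setT (fun x => - f x) (- v).
Proof.
move=> /(has_integralZl measurableT (-1)); rewrite mulN1r.
by apply: (eq_has_integral measurableT) => x _; rewrite mulN1r.
Qed.

Lemma has_integralB f g v w : has_integral mu setT f v -> has_integral mu setT g w ->
  has_integral mu setT (fun x => f x - g x) (v - w).
Proof. by move=> fv gw; apply: has_integralD => //; exact: has_integralN. Qed.

Lemma integrable_dominated f g v : measurable_fun setT f -> has_integral mu setT g v ->
  (forall x, `|f x| <= g x) -> mu.-integrable setT (EFin \o f).
Proof.
move=> mf [gi _] fg; apply: le_integrable gi => //; first exact/measurable_EFinP.
by move=> x _ /=; rewrite lee_fin (le_trans (fg x))// ler_norm.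
Qed.

Lemma has_integral_uniq f v w : has_integral mu setT f v -> has_integral mu setT f w -> v = w.
Proof. by move=> [_ fv] [_]; rewrite fv => -[]. Qed.

Lemma has_integral_ge0_val f v : has_integral mu setT f v -> (forall x, 0 <= f x) -> 0 <= v.
Proof.
by move=> [_ fv] f0; rewrite -lee_fin -fv; apply: integral_ge0 => x _; rewrite lee_fin.
Qed.

Lemma has_integral_norm_le f g v w : has_integral mu setT f v -> has_integral mu setT g w ->
  (forall x, `|f x| <= g x) -> `|v| <= w.
Proof.
move=> fv gw fg; rewrite ler_norml; apply/andP; split.
  rewrite -subr_ge0 opprK; apply: (has_integral_ge0_val (has_integralD fv gw)) => x.
  by have := fg x; rewrite ler_norml => /andP[+ _]; rewrite -subr_ge0 opprK.
rewrite -subr_ge0; apply: (has_integral_ge0_val (has_integralB gw fv)) => x.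
by rewrite subr_ge0 (le_trans (ler_norm _)).
Qed.

(** The limit is part of the conclusion: when the limit of the integrals is known from elsewhere, it
    identifies the integral of [f]. *)
Lemma has_integral_dominated (f_ : nat -> T -> R) (v_ : nat -> R) f g w :
  (forall k, has_integral mu setT (f_ k) (v_ k)) ->
  (forall x, f_ k x @[k --> \oo] --> f x) ->
  has_integral mu setT g w -> (forall k x, `|f_ k x| <= g x) ->
  exists2 v, has_integral mu setT f v & v_ k @[k --> \oo] --> v.
Proof.
move=> fk cf [gi gw] fg.
have mfk k : measurable_fun setT (fun x => (f_ k x)%:E).
  by apply/measurable_EFinP; exact: has_integral_measurable (fk k).
have cf' x : (f_ k x)%:E @[k --> \oo] --> (f x)%:E.
  by apply/fine_cvgP; split; [exact: nearW|exact: cf].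
have mf : measurable_fun setT (fun x => (f x)%:E).
  exact: (emeasurable_fun_cvg _ _ mfk (fun x _ => cf' x)).
have fg' : {ae mu, forall x n, setT x -> (`|(f_ n x)%:E| <= (EFin \o g) x)%E}.
  by apply: aeW => x n _; rewrite /= lee_fin.
have [fi _ cv] := dominated_convergence measurableT mfk mf (aeW _ (fun x _ => cf' x)) gi fg'.
have fh := integrable_has_integral measurableT fi.
exists (\int[mu]_x f x) => //.
move: cv; rewrite fh.2 (_ : [sequence _]_n = (fun n => (v_ n)%:E)).
  by move/fine_cvgP => [_].
by apply/funext => n /=; have [_ ->] := fk n.
Qed.

End has_integral_more.

(** * The Fourier transform of Gaussians *)

Section line_integrals.
Context {R : realType}.
Notation mu := (@lebesgue_measure R).
Implicit Types (a c r x y : R).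

Lemma has_integral_cauchy_density : has_integral mu setT (fun x => (1 + x ^+ 2)^-1) pi.
Proof.
have den x : 0 < 1 + x ^+ 2 by rewrite ltr_pwDl// sqr_ge0.
have cf : continuous (fun x : R => (1 + x ^+ 2)^-1).
  move=> x; apply: cvgV; first by rewrite gt_eqF.
  by apply: cvgD; [exact: cvg_cst|exact: exprn_continuous].
apply: has_integral_ge0 => //.
- exact: continuous_measurable_fun.
- by move=> x _; rewrite invr_ge0 ltW.
rewrite ge0_symfun_integralT//; last 2 first.
- by move=> x; rewrite invr_ge0 ltW.
- by move=> x /=; rewrite sqrrN.
rewrite (_ : [set x | _] = `[0, +oo[%classic); last first.
  by apply/seteqP; split => x/=; rewrite in_itv/= andbT.
rewrite (@ge0_continuous_FTC2y _ _ (@atan R) _ (pi / 2))//.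
- by rewrite atan0 sube0 -EFinM; congr EFin; field.
- by move=> x _; rewrite invr_ge0 ltW.
- exact: continuous_subspaceT.
- exact: cvgy_atan.
- by apply: cvg_at_right_filter; exact: continuous_atan.
- by move=> x _; rewrite derive1E; have [_ ->] := is_derive1_atan x.
Qed.

(** The fundamental theorem of calculus on [-(n+1), n+1], then dominated convergence. *)
Lemma has_integral_derive (F f : R -> R) :
  (forall x, is_derive x 1 F (f x)) -> continuous f -> mu.-integrable setT (EFin \o f) ->
  F n%:R @[n --> \oo] --> 0 -> F (- n%:R) @[n --> \oo] --> 0 ->
  has_integral mu setT f 0.
Proof.
move=> dF cf fi F1 F2.
have fv := integrable_has_integral measurableT fi.
have {}F1 : F n.+1%:R @[n --> \oo] --> 0 by rewrite (cvg_shiftS (fun n => F n%:R)).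
have {}F2 : F (- n.+1%:R) @[n --> \oo] --> 0 by rewrite (cvg_shiftS (fun n => F (- n%:R))).
pose I n := `[- n.+1%:R : R, n.+1%:R]%classic.
pose f_ n x := f x * \1_(I n) x.
have cF x : {for x, continuous F} by apply: derivable1_continuous; have [] := dF x.
have fk n : has_integral mu setT (f_ n) (F n.+1%:R - F (- n.+1%:R)).
  split.
    apply: (integrable_dominated _ (integrable_has_integral measurableT (integrable_norm fi))).
    - apply: measurable_funM; first exact: has_integral_measurable fv.
      by apply: measurable_indic; exact: measurable_itv.
    - move=> x; rewrite /f_ normrM ler_piMr// indicE.
      by case: (_ \in _); rewrite ?normr1 ?normr0.
  transitivity (\int[mu]_(x in I n) (f x)%:E)%E.
    rewrite [RHS]integral_mkcond; apply: eq_integral => x _.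
    by rewrite patchE /f_ indicE; case: ifP; rewrite ?mulr1 ?mulr0.
  rewrite (@continuous_FTC2 _ f F)//.
  - by rewrite (@lt_trans _ _ 0)// oppr_lt0.
  - exact: continuous_subspaceT.
  - split.
    + by move=> x _; have [] := dF x.
    + by apply: cvg_at_right_filter; exact: cF.
    + by apply: cvg_at_left_filter; exact: cF.
  - by move=> x _; rewrite derive1E; have [_ ->] := dF x.
have cvg x : f_ n x @[n --> \oo] --> f x.
  apply: cvg_near_cst; near=> n.
  rewrite /f_ indicE /I mem_setE in_itv/= -ler_norml.
  rewrite (_ : `|x| <= n.+1%:R) ?mulr1//.
  rewrite (le_trans (ltW (truncnS_gt _)))// ler_nat ltnS.
  by near: n; exact: nbhs_infty_ge.
have := has_integral_dominated fk cvg (integrable_has_integral measurableT (integrable_norm fi)).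
case.
  move=> n x; rewrite /f_ normrM ler_piMr// indicE.
  by case: (_ \in _); rewrite ?normr1 ?normr0.
move=> v hv; have : F n.+1%:R - F (- n.+1%:R) @[n --> \oo] --> (0 - 0) by exact: cvgB.
rewrite subr0 => h1 h2.
by have <- : v = 0 by exact: cvg_unique h2 h1.
Unshelve. all: by end_near. Qed.

Lemma sqr_expRN_le x : (1 + x ^+ 2) ^+ 2 * expR (- x ^+ 2) <= 4 * expR 1.
Proof.
rewrite expRN ler_pdivrMr ?expR_gt0// -mulrA -expRD.
have := @expr_le_expR R 2 (1 + x ^+ 2); rewrite addr_ge0 ?sqr_ge0// => /(_ isT).
by rewrite -natrX.
Qed.

(** [1 + |x|] is at most [2 (1 + x^2)], and the Gaussian absorbs the square of [1 + x^2]. *)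
Lemma gauss_moment_le x : (1 + `|x|) * expR (- x ^+ 2) <= 8 * expR 1 * (1 + x ^+ 2)^-1.
Proof.
have den : 0 < 1 + x ^+ 2 by rewrite ltr_pwDl// sqr_ge0.
have := sqr_expRN_le x; set E := expR (- _); have E0 : 0 < E by exact: expR_gt0.
rewrite ler_pdivlMr// => h.
have x1 : 1 + `|x| <= 2 * (1 + x ^+ 2).
  rewrite -(real_normK (num_real x)); have := normr_ge0 x; set t := `|x|; nra.
apply: le_trans (_ : 2 * (1 + x ^+ 2) * E * (1 + x ^+ 2) <= _); last by nra.
by rewrite ler_pM2r// ler_pM2r.
Qed.

(** The Fourier transform of [exp (- x^2)], determined below by the differential equation
    [g' = - (a / 2) g]. *)
Definition gcos a := \int[mu]_x (expR (- x ^+ 2) * cos (a * x)).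

Lemma measurable_gauss (h : R -> R) : measurable_fun [set: R] h ->
  measurable_fun [set: R] (fun x => expR (- x ^+ 2) * h x).
Proof.
move=> mh; apply: measurable_funM => //; apply: measurableT_comp => //.
by apply: measurableT_comp => //; exact: measurable_funX.
Qed.

Lemma integrable_gauss (h : R -> R) : measurable_fun [set: R] h ->
  (forall x, `|h x| <= 1 + `|x|) -> mu.-integrable setT (EFin \o (fun x => expR (- x ^+ 2) * h x)).
Proof.
move=> mh hx.
apply: (integrable_dominated _ (has_integralZl measurableT (8 * expR 1) has_integral_cauchy_density)).
  exact: measurable_gauss.
move=> x; apply: le_trans (gauss_moment_le x).
by rewrite normrM mulrC [`|expR _|]ger0_norm ?expR_ge0// ler_pM2r ?expR_gt0.
Qed.

Lemma measurable_cosZ a : measurable_fun [set: R] (fun x => cos (a * x)).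
Proof.
apply: (measurableT_comp (continuous_measurable_fun (@continuous_cos R))).
exact: measurable_funM.
Qed.

Lemma measurable_sinZ a : measurable_fun [set: R] (fun x => sin (a * x)).
Proof.
apply: (measurableT_comp (continuous_measurable_fun (@continuous_sin R))).
exact: measurable_funM.
Qed.

Lemma is_derive_cosZ a x : is_derive x 1 (fun x => cos (a * x)) (- sin (a * x) * a).
Proof. exact: (is_derive1_comp (is_derive_cos (a * x)) (is_derive1_linear a x)). Qed.

Lemma is_derive_sinZ a x : is_derive x 1 (fun x => sin (a * x)) (cos (a * x) * a).
Proof. exact: (is_derive1_comp (is_derive_sin (a * x)) (is_derive1_linear a x)). Qed.

(** The derivative of [exp (- x^2) sin (a x)] has integral zero. *)
Lemma gcos_by_parts a :
  has_integral mu setT (fun x => expR (- x ^+ 2) * (x * sin (a * x))) (a / 2 * gcos a).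
Proof.
have h1 : has_integral mu setT (fun x => expR (- x ^+ 2) * cos (a * x)) (gcos a).
  apply: integrable_has_integral => //; apply: integrable_gauss; first exact: measurable_cosZ.
  by move=> x; rewrite (le_trans (_ : _ <= 1))// ?lerDl// ler_norml cos_geN1 cos_le1.
have ms : measurable_fun [set: R] (fun x => x * sin (a * x)).
  by apply: measurable_funM => //; exact: measurable_sinZ.
have is2 : mu.-integrable setT (EFin \o (fun x => expR (- x ^+ 2) * (x * sin (a * x)))).
  apply: integrable_gauss => // x.
  rewrite normrM (le_trans (_ : _ <= `|x|))// ?lerDr// ler_piMr//.
  by rewrite ler_norml sin_geN1 sin_le1.
have h2 := integrable_has_integral measurableT is2.
set v := \int[mu]_(x in _) _ in h2.
pose f x := a * (expR (- x ^+ 2) * cos (a * x)) - 2 * (expR (- x ^+ 2) * (x * sin (a * x))).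
have hf := has_integralB (has_integralZl measurableT a h1) (has_integralZl measurableT 2 h2).
have dE x : is_derive x 1 (fun x => expR (- x ^+ 2)) (expR (- x ^+ 2) * (- (2 * x))).
  have := is_derive1_expR (is_derive1N (is_derive1X 1 (is_derive_id x (1 : R)))).
  by rewrite expr1 mulr1.
have dF x : is_derive x 1 (fun x => expR (- x ^+ 2) * sin (a * x)) (f x).
  apply: is_derive_eq (is_derive1M (dE x) (is_derive_sinZ a x)) _.
  by rewrite /f; ring.
have cdf : continuous f.
  move=> x; apply: derivable1_continuous.
  have [+ _] := is_derive1D (is_derive1Z a (is_derive1M (dE x) (is_derive_cosZ a x)))
    (is_derive1N (is_derive1Z 2 (is_derive1M (dE x)
      (is_derive1M (is_derive_id x (1 : R)) (is_derive_sinZ a x))))).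
  by [].
have hlim (u : nat -> R) : (forall n, `|u n| = n%:R) ->
    expR (- (u n) ^+ 2) * sin (a * u n) @[n --> \oo] --> 0.
  move=> un; have cg : gauss_fun (n%:R : R) @[n --> \oo] --> 0.
    exact: (cvg_comp _ _ (@cvgr_idn R) (@cvg_gauss_fun R)).
  apply/cvgr0Pnorm_le => e e0; near=> n.
  rewrite normrM (@le_trans _ _ `|gauss_fun (n%:R : R)|)//.
    rewrite /gauss_fun -(un n) real_normK ?num_real// ler_piMr//.
    by rewrite ler_norml sin_geN1 sin_le1.
  by near: n; exact: cvgr0_norm_le.
have h0 : has_integral mu setT f 0.
  apply: (has_integral_derive dF cdf hf.1).
    by apply: (hlim (fun n => n%:R)) => n; rewrite ger0_norm.
  by apply: (hlim (fun n => - n%:R)) => n; rewrite normrN ger0_norm.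
have E := has_integral_uniq hf h0.
by have -> : a / 2 * gcos a = v by lra.
Unshelve. all: by end_near. Qed.

(** Differentiation under the integral sign, then integration by parts. *)
Lemma is_derive_gcos a : is_derive a 1 gcos (- (a / 2 * gcos a)).
Proof.
pose f a x : R := expR (- x ^+ 2) * cos (a * x).
have dfE (b x : R) : is_derive b 1 (fun b => f b x) (- (expR (- x ^+ 2) * (x * sin (b * x)))).
  have h : is_derive b 1 (fun b => b * x) x.
    have := is_derive1Z x (is_derive_id b (1:R)); rewrite mulr1.
    by move/is_derive1_ext; apply => y; rewrite mulrC.
  have D : is_derive b 1 (fun b => f b x) (expR (- x ^+ 2) * (- sin (b * x) * x)).
    have h2 : is_derive b 1 (fun c => cos (c * x)) (- sin (b * x) * x).
      exact: (@is_derive1_comp _ cos (fun c => c * x) b _ _ (is_derive_cos (b * x)) h).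
    exact: (is_derive1Z (expR (- x ^+ 2)) h2).
  by apply: is_derive_eq D _; ring.
have p1 b x : partial1of2 f b x = - (expR (- x ^+ 2) * (x * sin (b * x))).
  by rewrite partial1of2E; have [_ ->] := dfE b x.
have Ia : `]a - 1, a + 1[%classic a by rewrite /= in_itv/=; apply/andP; split; lra.
have fi b : `]a - 1, a + 1[%classic b -> mu.-integrable setT (EFin \o f b).
  move=> _; apply: integrable_gauss; first exact: measurable_cosZ.
  by move=> x; rewrite (le_trans (_ : _ <= 1))// ?lerDl// ler_norml cos_geN1 cos_le1.
have df b x : `]a - 1, a + 1[%classic b -> setT x -> derivable (f ^~ x) b 1.
  by move=> _ _; have [] := dfE b x.
pose G x : R := 8 * expR 1 * (1 + x ^+ 2)^-1.
have G0 x : 0 <= G x.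
  by rewrite mulr_ge0 ?mulr_ge0 ?expR_ge0// invr_ge0 addr_ge0 ?sqr_ge0.
have Gi : mu.-integrable setT (EFin \o G).
  by have [] := has_integralZl measurableT (8 * expR 1) has_integral_cauchy_density.
have fG b x : `]a - 1, a + 1[%classic b -> setT x -> `|partial1of2 f b x| <= G x.
  move=> _ _; rewrite p1; apply: le_trans (gauss_moment_le x).
  rewrite normrN normrM mulrC [`|expR _|]ger0_norm ?expR_ge0// ler_pM2r ?expR_gt0//.
  rewrite normrM (le_trans (_ : _ <= `|x|))// ?lerDr// ler_piMr//.
  by rewrite ler_norml sin_geN1 sin_le1.
have D := derivable_under_integral measurableT Ia fi df G0 Gi fG.
have E := differentiation_under_integral measurableT Ia fi df G0 Gi fG.
apply: DeriveDef; first exact: D.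
rewrite -derive1E [LHS]E.
under eq_Rintegral do rewrite p1.
have := has_integralN (gcos_by_parts a).
exact: has_integral_Rintegral.
Qed.

Lemma gcosE a : gcos a = Num.sqrt pi * expR (- (a ^+ 2 / 4)).
Proof.
pose h a := gcos a * expR (a ^+ 2 / 4).
have dh x : is_derive x 1 h 0.
  have e : is_derive x 1 (fun x : R => expR (x ^+ 2 / 4)) (expR (x ^+ 2 / 4) * (x / 2)).
    have := is_derive1_expR (is_derive1Z 4^-1 (is_derive1X 1 (is_derive_id x (1 : R)))).
    rewrite expr1 mulr1 => e.
    have -> : expR (x ^+ 2 / 4) * (x / 2) = expR (4^-1 * x ^+ 2) * (4^-1 * (2 * x)).
      by rewrite (mulrC _ 4^-1); congr (_ * _); field.
    by apply: (is_derive1_ext e) => y; rewrite (mulrC _ 4^-1).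
  apply: is_derive_eq (is_derive1M (is_derive_gcos x) e) _.
  by ring.
have h0 : h 0 = Num.sqrt pi.
  rewrite /h /gcos expr0n/= mul0r expR0 mulr1 /Rintegral.
  under eq_integral do rewrite mul0r cos0 mulr1.
  by have := @integralT_gauss R; rewrite /gauss_fun => ->.
have hc : h a = h 0 by exact: is_derive_0_is_cst.
by rewrite -h0 -hc /h -mulrA -expRD subrr expR0 mulr1.
Qed.

End line_integrals.

Section gaussian.
Context {R : realType}.
Notation mu := (@lebesgue_measure R).
Notation L := (@lebesgue_rV R).
Implicit Types (a c r : R) (n m : nat).

Lemma has_integral_gauss_cos1 r a : 0 < r ->
  has_integral mu setT (fun y => expR (- y ^+ 2 / (4 * r)) * cos (a * y))
    (Num.sqrt (4 * pi * r) * expR (- (r * a ^+ 2))).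
Proof.
move=> r0; pose c := (2 * Num.sqrt r)^-1.
have sr : 0 < Num.sqrt r by rewrite sqrtr_gt0.
have c0 : 0 < c by rewrite invr_gt0 mulr_gt0.
pose b := a * (2 * Num.sqrt r).
have h : has_integral mu setT (fun x => expR (- x ^+ 2) * cos (b * x)) (gcos b).
  apply: integrable_has_integral => //; apply: integrable_gauss; first exact: measurable_cosZ.
  by move=> x; rewrite (le_trans (_ : _ <= 1))// ?lerDl// ler_norml cos_geN1 cos_le1.
have := @has_integral_comp _ _ _ mu (fun x => c * x + 0) c^-1 _ _ (measurable_affine c 0)
  (fun g mg g0 => ge0_integral_affine 0 c0 mg g0) h.
rewrite gcosE (_ : c^-1 * _ = Num.sqrt (4 * pi * r) * expR (- (r * a ^+ 2))); last first.
  rewrite mulrA; congr (_ * expR (- _)); last first.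
    by rewrite /b exprMn exprMn sqr_sqrtr ?ltW//; field.
  rewrite /c invrK (_ : 4 = 2 ^+ 2); last by rewrite expr2 -natrM.
  rewrite -mulrA sqrtrM ?sqr_ge0// sqrtr_sqr ger0_norm// sqrtrM ?pi_ge0//; ring.
apply: (eq_has_integral measurableT) => y _ /=; rewrite addr0; congr (expR _ * cos _).
  by rewrite /c exprMn exprVn exprMn sqr_sqrtr ?ltW//; field; rewrite gt_eqF.
by rewrite /b /c; field; rewrite gt_eqF.
Qed.

Lemma has_integral_gauss_sin1 r a : 0 < r ->
  has_integral mu setT (fun y => expR (- y ^+ 2 / (4 * r)) * sin (a * y)) 0.
Proof.
move=> r0.
have [c0 _] := has_integral_gauss_cos1 0 r0.
have hi : mu.-integrable setT (EFin \o (fun y => expR (- y ^+ 2 / (4 * r)) * sin (a * y))).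
  apply: (integrable_dominated _ (integrable_has_integral measurableT c0)).
    apply: measurable_funM; last exact: measurable_sinZ.
    apply: measurableT_comp => //; apply: measurable_funM => //.
    by apply: measurableT_comp => //; exact: measurable_funX.
  move=> x; rewrite mul0r cos0 mulr1 normrM ger0_norm ?expR_ge0// ler_piMr ?expR_ge0//.
  by rewrite ler_norml sin_geN1 sin_le1.
have hv := integrable_has_integral measurableT hi.
set v := \int[mu]_(x in _) _ in hv.
have := @has_integral_comp _ _ _ mu (fun x => - x) 1 _ _ (@oppr_measurable R setT)
  (fun g mg g0 => etrans (ge0_integral_oppr mg g0) (esym (mul1e _))) hv.
rewrite mul1r => h1; have h2 := has_integralN hv.
have : v = - v.
  apply: has_integral_uniq h1 _; apply: (eq_has_integral measurableT) h2 => x _ /=.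
  by rewrite sqrrN mulrN sinN mulrN.
by move=> vN; have <- : v = 0 by lra.
Qed.

Lemma sqr_enormS n (x : 'rV[R]_n.+1) :
  enorm x ^+ 2 = x ord0 ord0 ^+ 2 + enorm (rV_tail x) ^+ 2.
Proof.
rewrite !sqr_enorm big_ord_recl; congr (_ + _).
by apply: eq_bigr => i _; rewrite mxE.
Qed.

Lemma dotrS n (x y : 'rV[R]_n.+1) :
  dotr x y = x ord0 ord0 * y ord0 ord0 + dotr (rV_tail x) (rV_tail y).
Proof.
rewrite /dotr big_ord_recl; congr (_ + _).
by apply: eq_bigr => i _; rewrite !mxE.
Qed.

Lemma sqr_enorm0 (x : 'rV[R]_0) : enorm x ^+ 2 = 0.
Proof. by rewrite sqr_enorm big_ord0. Qed.

Lemma dotr0 (x y : 'rV[R]_0) : dotr x y = 0.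
Proof. by rewrite /dotr big_ord0. Qed.

Definition gaussian n r (y : 'rV[R]_n) : R := expR (- enorm y ^+ 2 / (4 * r)).

Lemma measurable_gaussian n r : measurable_fun setT (@gaussian n r).
Proof.
apply: measurableT_comp => //; apply: measurable_funM => //.
by apply: measurableT_comp => //; apply: measurable_funX; exact: measurable_enorm.
Qed.

Lemma gaussianS n r (y : 'rV[R]_n.+1) :
  gaussian r y = expR (- y ord0 ord0 ^+ 2 / (4 * r)) * gaussian r (rV_tail y).
Proof. by rewrite /gaussian sqr_enormS opprD mulrDl expRD. Qed.

Lemma gaussian_ge0 n r (y : 'rV[R]_n) : 0 <= gaussian r y.
Proof. exact: expR_ge0. Qed.

(** The Fourier transform of a Gaussian, one coordinate at a time. *)
Lemma has_integral_gaussian n r (xi : 'rV[R]_n) : 0 < r ->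
  has_integral (L n) setT (fun y => gaussian r y * cos (dotr xi y))
    (Num.sqrt (4 * pi * r) ^+ n * expR (- (r * enorm xi ^+ 2))) /\
  has_integral (L n) setT (fun y => gaussian r y * sin (dotr xi y)) 0.
Proof.
move=> r0; elim: n xi => [|n IH] xi.
  have g0 (y : 'rV[R]_0) : gaussian r y = 1.
    by rewrite /gaussian sqr_enorm0 oppr0 mul0r expR0.
  rewrite expr0 mul1r sqr_enorm0 mulr0 oppr0 expR0; split.
    have h := has_integral_rV0 (measurable_cst (1 : R)).
    by apply: (eq_has_integral measurableT _ h) => y _; rewrite g0 dotr0 cos0 mulr1.
  have h := has_integral_rV0 (measurable_cst (0 : R)).
  by apply: (eq_has_integral measurableT _ h) => y _; rewrite g0 dotr0 sin0 mulr0.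
have [c s] := IH (rV_tail xi).
have c1 := has_integral_gauss_cos1 (xi ord0 ord0) r0.
have s1 := has_integral_gauss_sin1 (xi ord0 ord0) r0.
split.
  have h := has_integralB (has_integral_rVS c1 c) (has_integral_rVS s1 s).
  rewrite sqr_enormS (mulrDr r) opprD expRD exprS.
  rewrite (_ : _ * _ = Num.sqrt (4 * pi * r) * expR (- (r * xi ord0 ord0 ^+ 2)) *
    (Num.sqrt (4 * pi * r) ^+ n * expR (- (r * enorm (rV_tail xi) ^+ 2))) - 0 * 0); last by ring.
  by apply: (eq_has_integral measurableT _ h) => y _; rewrite gaussianS dotrS cosD; ring.
have h := has_integralD (has_integral_rVS s1 c) (has_integral_rVS c1 s).
rewrite mul0r mulr0 addr0 in h.
by apply: (eq_has_integral measurableT _ h) => y _; rewrite gaussianS dotrS sinD; ring.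
Qed.

(** Raising [m] by one applies the difference of order two once more, and
    [2 cos a - cos (a - t) - cos (a + t) = (2 - 2 cos t) cos a]. *)
Lemma sum_dcoef_cos m a t :
  \sum_(j < (2 * m).+1) dcoef m j * cos (a + dnode m j * t) = cos a * (2 - 2 * cos t) ^+ m.
Proof.
elim: m a => [|m IH] a.
  rewrite expr0 mulr1 muln0 big_ord1 /dcoef /dnode subrr mul0r addr0.
  by rewrite expr0 bin0 !mul1r.
pose f b (j : nat) : R := cos (b + j%:R * t).
pose S n b := \sum_(i < n.+1) (-1) ^+ i * 'C(n, i)%:R * f b i.
have Srec n b : S n.+1 b = S n b - S n (b + t).
  rewrite /S finite_difference_rec; congr (_ - _); apply: eq_bigr => i _.
  by congr (_ * cos _); rewrite -natr1; ring.
have T k b : \sum_(j < (2 * k).+1) dcoef k j * cos (b + dnode k j * t) =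
    (-1) ^+ k * S (2 * k)%N (b - k%:R * t).
  rewrite /S big_distrr/=; apply: eq_bigr => i _; rewrite /dcoef /dnode /f exprD.
  rewrite (_ : b + (i%:R - k%:R) * t = b - k%:R * t + i%:R * t); last by ring.
  by ring.
rewrite T mulnS !addSn add0n !Srec.
have E b : (-1) ^+ m * S (2 * m)%N (b - m%:R * t) = cos b * (2 - 2 * cos t) ^+ m by rewrite -T IH.
have -> : a - m.+1%:R * t = (a - t) - m%:R * t by rewrite -natr1; ring.
have -> : a - t - m%:R * t + t = a - m%:R * t by ring.
have -> : a - m%:R * t + t = (a + t) - m%:R * t by ring.
rewrite exprS mulN1r mulNr !mulrBr !E exprS cosB cosD; ring.
Qed.

(** The power of [2 - 2 cos] is a combination of waves, each transformed by the Gaussian. *)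
Lemma heat_sum_gaussian n m r (xi : 'rV[R]_n) : 0 < r ->
  has_integral (L n) setT (fun y => gaussian r y * (2 - 2 * cos (dotr xi y)) ^+ m)
    (Num.sqrt (4 * pi * r) ^+ n * heat_sum m (r * enorm xi ^+ 2)).
Proof.
move=> r0.
have h (j : nat) := has_integralZl measurableT (dcoef m j) (has_integral_gaussian (dnode m j *: xi) r0).1.
have := has_integral_sum measurableT (index_enum (ordinal (2 * m).+1)) h.
rewrite (_ : \sum_(i <- _) _ = Num.sqrt (4 * pi * r) ^+ n * heat_sum m (r * enorm xi ^+ 2)).
  apply: (eq_has_integral measurableT) => y _.
  have := sum_dcoef_cos m 0 (dotr xi y); rewrite cos0 mul1r => <-.
  rewrite big_distrr/=; apply: eq_bigr => j _.
  by rewrite add0r dotrC dotrZr dotrC; ring.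
rewrite /heat_sum big_distrr/=; apply: eq_bigr => j _.
have -> : enorm (dnode m j *: xi) ^+ 2 = dnode m j ^+ 2 * enorm xi ^+ 2.
  by rewrite !sqr_enorm big_distrr/=; apply: eq_bigr => i _; rewrite mxE exprMn.
rewrite (mulrCA r); ring.
Qed.

Lemma symbol_ge0 (t : R) m : 0 <= (2 - 2 * cos t) ^+ m.
Proof. by rewrite exprn_ge0//; have := cos_le1 t; lra. Qed.

(** In dimension one it is, up to a positive factor, the integral of a nonnegative function. *)
Lemma heat_sum_ge0 m r : 0 < r -> 0 <= heat_sum m r.
Proof.
move=> r0; have := @heat_sum_gaussian 1 m r (const_mx 1) r0.
have -> : enorm (const_mx 1 : 'rV[R]_1) ^+ 2 = 1.
  by rewrite sqr_enorm big_ord1 mxE expr1n.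
move/has_integral_ge0_val; rewrite mulr1 pmulr_rge0 ?exprn_gt0 ?sqrtr_gt0 ?mulr_gt0 ?pi_gt0//.
by apply => y; rewrite mulr_ge0 ?gaussian_ge0 ?symbol_ge0.
Qed.

End gaussian.

(** * The symbol as a singular integral *)

Lemma measurable_invr (R : realType) : measurable_fun [set: R] (fun x : R => x^-1).
Proof.
rewrite -(setUv [set (0 : R)]) measurable_funU//; last exact: measurableC.
split; first exact: measurable_fun_set1.
apply: open_continuous_measurable_fun; first by apply: closed_openC; exact: closed_eq.
by move=> x; rewrite inE/= => x0; apply: inv_continuous; apply/eqP.
Qed.

Section subordination.
Context {R : realType}.
Notation mu := (@lebesgue_measure R).
Notation L := (@lebesgue_rV R).
Implicit Types (a c p r s : R) (N n m : nat).

(** The substitution [r -> c / r] turns this into Euler's integral. *)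
Lemma integral_inverse_gamma p c : 0 < p -> 0 < c ->
  (\int[mu]_(r in `]0%R, +oo[) (r `^ (- p - 1) * expR (- (c / r)))%:E =
   (c `^ (- p) * euler_gamma p)%:E)%E.
Proof.
move=> p0 c0.
pose f r : R := r `^ (- p - 1) * expR (- r^-1).
have f0 r : 0 <= f r by rewrite mulr_ge0 ?powR_ge0 ?expR_ge0.
have cf : {in `]0, +oo[, continuous f}.
  move=> r; rewrite in_itv/= andbT => r0; apply: cvgM.
    apply: (@derivable1_continuous _ (fun x => x `^ (- p - 1))).
    by apply: derivable_powR; rewrite in_itv/= andbT.
  apply: continuous_cvg; first exact: continuous_expR.
  by apply: cvgN; apply: inv_continuous; rewrite gt_eqF.
have mfT : measurable_fun [set: R] f.
  apply: measurable_funM; first exact: measurable_powR.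
  by do 2 apply: measurableT_comp => //; exact: measurable_invr.
have mf : measurable_fun (`]0, +oo[%classic : set R) (fun x => (f x)%:E).
  by apply/measurable_EFinP; exact: measurable_funTS.
have fg : (\int[mu]_(r in `]0%R, +oo[) (f r)%:E = (euler_gamma p)%:E)%E.
  rewrite -ge0_integral_inv0y// -euler_gammaE//; apply: eq_integral => r.
  rewrite inE/= in_itv/= andbT => r0; congr EFin; rewrite /f invrK mulrAC; congr (_ * _).
  rewrite -powR_inv1 ?(ltW r0)// -powRrM -powR_invn ?(ltW r0)// -powRD.
    by congr powR; ring.
  by rewrite (gt_eqF r0) implybT.
have cV0 : 0 < c^-1 by rewrite invr_gt0.
have f0' x : 0 < x -> (0 <= (f x)%:E)%E by rewrite lee_fin.
have h := ge0_integral_scale0y cV0 mf f0'.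
rewrite fg invrK -EFinM in h.
have -> : c `^ (- p) * euler_gamma p = c `^ (- p - 1) * (c * euler_gamma p).
  rewrite mulrA powRB ?(gt_eqF c0) ?implybT// powRr1 ?(ltW c0)//.
  by congr (_ * _); field; rewrite gt_eqF.
rewrite EFinM -h -ge0_integralZl_EFin ?powR_ge0//; last 2 first.
- by move=> x _; rewrite lee_fin.
- apply/measurable_EFinP; apply: measurable_funTS; apply: (measurableT_comp mfT).
  exact: measurable_funM.
apply: eq_integral => r; rewrite inE/= in_itv/= andbT => r0.
rewrite -EFinM /f; congr EFin; rewrite mulrA invfM invrK; congr (_ * _).
rewrite -powR_inv1 ?(ltW c0)// -powRM ?powR_ge0 ?(ltW r0)//; last by rewrite mulr_ge0 ?powR_ge0 ?(ltW r0).
  by rewrite mulrA powR_inv1 ?(ltW c0)// divff ?mul1r// gt_eqF.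
exact: ltW.
Qed.

Lemma enorm_gt0 n (y : 'rV[R]_n) : y != 0 -> 0 < enorm y.
Proof.
move=> y0; rewrite lt_neqAle enorm_ge0 andbT eq_sym; apply: contra_neq y0 => e0.
have := sqr_enorm y; rewrite e0 expr0n/= => /esym/eqP.
rewrite psumr_eq0 => [/allP h|i _]; last exact: sqr_ge0.
apply/rowP => i; rewrite mxE; apply/eqP.
by rewrite -sqrf_eq0; apply: h; rewrite mem_index_enum.
Qed.

Lemma enorm0 n : enorm (0 : 'rV[R]_n) = 0.
Proof. by rewrite /enorm big1 ?sqrtr0// => i _; rewrite mxE expr0n. Qed.

(** The value of the integral in [has_integral_riesz] at unit [xi]. *)
Definition riesz_const N m s : R :=
  pi `^ (N%:R / 2) * heat_moment m s / (4 `^ s * euler_gamma (N%:R / 2 + s)).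

Lemma sqrtr_powR a n : 0 <= a -> Num.sqrt a ^+ n = a `^ (n%:R / 2).
Proof.
by move=> a0; rewrite -powR12_sqrt// -powR_mulrn ?powR_ge0// -powRrM mulrC.
Qed.

Lemma measurable_symbol n m (xi : 'rV[R]_n) :
  measurable_fun setT (fun y : 'rV[R]_n => (2 - 2 * cos (dotr xi y)) ^+ m).
Proof.
apply: measurable_funX; apply: measurable_funB => //; apply: measurable_funM => //.
apply: (measurableT_comp (continuous_measurable_fun (@continuous_cos R))).
by apply: measurable_fun_dotr => //; exact: measurable_cst.
Qed.

(** The power is a superposition of Gaussians, whose integrals against the symbol are heat sums of
    [r |xi|^2]; everything being nonnegative, Tonelli applies. *)
Lemma has_integral_riesz N m s (xi : 'rV[R]_N) : (0 < m)%N -> 0 < s -> s < m%:R ->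
  has_integral (L N) setT
    (fun y => (2 - 2 * cos (dotr xi y)) ^+ m / enorm y `^ (N%:R + 2 * s))
    (riesz_const N m s * enorm xi `^ (2 * s)).
Proof.
move=> m0 s0 sm.
have W0 (y : 'rV[R]_N) : 0 <= (2 - 2 * cos (dotr xi y)) ^+ m by exact: symbol_ge0.
have mW := @measurable_symbol N m xi.
have mE : measurable_fun setT (fun y : 'rV[R]_N => (enorm y `^ (N%:R + 2 * s))^-1).
  rewrite (_ : (fun _ => _) = fun y => enorm y `^ (- (N%:R + 2 * s))); last first.
    by apply/funext => y; rewrite powRN.
  by apply: (measurableT_comp (measurable_powR _)); exact: measurable_enorm.
apply: has_integral_ge0 => //.
- exact: measurable_funM.
- by move=> y _; rewrite mulr_ge0// invr_ge0 powR_ge0.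
pose p := N%:R / 2 + s.
have p0 : 0 < p by rewrite ltr_wpDl// divr_ge0.
have [xi0|xin0] := eqVneq xi 0.
  rewrite xi0 enorm0 powR0 ?mulr0; last by rewrite gt_eqF// mulr_gt0.
  apply: integral0_eq => y _; rewrite dotrC (_ : dotr y 0 = 0) ?cos0.
    by rewrite mulr1 subrr expr0n gtn_eqF// mul0r.
  by rewrite /dotr big1// => i _; rewrite mxE mulr0.
have e0 := enorm_gt0 xin0.
have G0 := euler_gamma_gt0 p0.
pose I : set R := `]0, +oo[%classic.
have I1 r : \1_I r = (0 < r)%R%:R :> R by rewrite indicE /I mem_setE in_itv/= andbT.
have mI0 : measurable (I : set (measurableTypeR R)) by exact: measurable_itv.
have mI : measurable_fun [set: R] (\1_I : R -> R) by apply: measurable_indic; exact: measurable_itv.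
pose h (z : measurableTypeR R * 'rV[R]_N) : \bar R :=
  ((z.1 : R) `^ (- p - 1) * \1_I (z.1 : R) * (gaussian z.1 z.2 * (2 - 2 * cos (dotr xi z.2)) ^+ m))%:E.
have h0 z : (0 <= h z)%E.
  by rewrite /h I1 lee_fin !mulr_ge0 ?powR_ge0 ?gaussian_ge0.
have mh : measurable_fun setT h.
  apply/measurable_EFinP; apply: measurable_funM.
    apply: measurable_funM; first exact: (measurableT_comp (measurable_powR _) measurable_fst).
    exact: (measurableT_comp mI measurable_fst).
  apply: measurable_funM; last exact: (measurableT_comp mW measurable_snd).
  apply: measurableT_comp => //; apply: measurable_funM.
    apply: measurableT_comp => //; apply: measurable_funX.
    exact: (measurableT_comp (@measurable_enorm R N) measurable_snd).
  have m4 : measurable_fun [set: R] (fun a : R => (4 * a)^-1).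
    by apply: (measurableT_comp (@measurable_invr R)); exact: measurable_funM.
  exact: (measurableT_comp m4 measurable_fst).
have := fubini_tonelli (m1 := mu) (m2 := L N) h mh h0.
have -> : (\int[mu]_r \int[L N]_y h (r, y) =
  ((4 * pi) `^ (N%:R / 2) * ((enorm xi ^+ 2) `^ s * heat_moment m s))%:E)%E.
  transitivity (\int[mu]_(r in I) ((4 * pi) `^ (N%:R / 2) *
     (r `^ (- s - 1) * heat_sum m (enorm xi ^+ 2 * r)))%:E)%E.
    rewrite [RHS]integral_mkcond; apply: eq_integral => r _; rewrite patchE mem_setE.
    rewrite in_itv/= andbT; case: ltP => r0; last first.
      by apply: integral0_eq => y _; rewrite /h/= I1 ltNge r0/= mulr0 mul0r.
    have [_ hg] := has_integralZl measurableT (r `^ (- p - 1)) (heat_sum_gaussian m xi r0).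
    under eq_integral do rewrite /h/= I1 r0 mulr1.
    rewrite hg; congr EFin; rewrite sqrtr_powR ?mulr_ge0 ?pi_ge0 ?(ltW r0)//.
    rewrite powRM ?mulr_ge0 ?pi_ge0 ?(ltW r0)// (mulrC r).
    rewrite mulrA mulrCA -!mulrA; congr (_ * _); rewrite mulrA -powRD ?(gt_eqF r0) ?implybT//.
    by congr (_ `^ _ * _); rewrite /p; ring.
  under eq_integral do rewrite EFinM.
  have [[_ hJ] _] := heat_momentP N s0 sm.
  have mhs := measurable_heat_sum (R := R) m.
  have hs := integral_scale_powR (exprn_gt0 2 e0) mhs (@heat_sum_ge0 R m) hJ.
  rewrite ge0_integralZl_EFin ?powR_ge0//; last 2 first.
  - move=> r; rewrite /I/= in_itv/= andbT => r0.
    by rewrite lee_fin mulr_ge0 ?powR_ge0 ?heat_sum_ge0 ?mulr_gt0 ?exprn_gt0.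
  - apply/measurable_EFinP/measurable_funTS; apply: measurable_funM; first exact: measurable_powR.
    by apply: (measurableT_comp mhs); exact: measurable_funM.
  by rewrite [X in (_ * X)%E]hs -EFinM.
have -> : (\int[L N]_y \int[mu]_r h (r, y) =
  \int[L N]_y ((4 `^ p * euler_gamma p)%:E *
    ((2 - 2 * cos (dotr xi y)) ^+ m / enorm y `^ (N%:R + 2 * s))%:E))%E.
  apply: eq_integral => y _.
  have [->|y0] := eqVneq y 0.
    have -> : cos (dotr xi 0) = 1 by rewrite /dotr big1 ?cos0// => i _; rewrite mxE mulr0.
    rewrite mulr1 subrr expr0n gtn_eqF// mul0r mule0.
    apply: integral0_eq => r _; rewrite /h/=.
    have -> : cos (dotr xi 0) = 1 by rewrite /dotr big1 ?cos0// => i _; rewrite mxE mulr0.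
    by rewrite mulr1 subrr expr0n gtn_eqF// !mulr0.
  have ey := enorm_gt0 y0.
  set W := (_ - _) ^+ m.
  transitivity (\int[mu]_(r in I) (W%:E * (r `^ (- p - 1) * expR (- (enorm y ^+ 2 / 4 / r)))%:E))%E.
    rewrite [RHS]integral_mkcond; apply: eq_integral => r _; rewrite patchE mem_setE /h/= I1 in_itv/= andbT.
    case: ltP => r0; last by rewrite mulr0 mul0r.
    rewrite -EFinM /gaussian -/W mulr1 mulrA mulrC; congr (_ * (_ * expR _))%:E.
    by rewrite invfM mulNr mulrA.
  rewrite ge0_integralZl_EFin ?W0//; last 2 first.
  - by move=> r _; rewrite lee_fin mulr_ge0 ?powR_ge0 ?expR_ge0.
  - apply/measurable_EFinP; apply: measurable_funM.
      by apply: measurable_funTS; exact: measurable_powR.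
    apply: measurableT_comp => //; apply: measurableT_comp => //; apply: measurable_funM => //.
    by apply: measurable_funTS; exact: measurable_invr.
  rewrite integral_inverse_gamma ?divr_gt0 ?exprn_gt0// -!EFinM; congr EFin.
  have -> : (enorm y ^+ 2 / 4) `^ (- p) = 4 `^ p / enorm y `^ (N%:R + 2 * s).
    rewrite powRN powRM ?sqr_ge0 ?invr_ge0// -(powR_inv1 (ler0n _ 4)) -powRrM mulN1r powRN.
    rewrite invfM invrK mulrC -powR_mulrn ?enorm_ge0// -powRrM; congr (_ / _ `^ _).
    by rewrite /p mulrDr mulrCA divff ?mulr1// pnatr_eq0.
  by rewrite -!mulrA; ring.
rewrite ge0_integralZl_EFin//; last 3 first.
- by move=> y _; rewrite lee_fin mulr_ge0// invr_ge0 powR_ge0.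
- by apply/measurable_EFinP; exact: measurable_funM.
- by rewrite mulr_ge0 ?powR_ge0 ?(ltW G0).
set K := (\int[L N]_y _)%E => E.
have c0 : 0 < 4 `^ p * euler_gamma p by rewrite mulr_gt0 ?powR_gt0.
have : ((4 `^ p * euler_gamma p)^-1%:E * ((4 `^ p * euler_gamma p)%:E * K) = K)%E.
  by rewrite muleA -EFinM mulVf ?gt_eqF// mul1e.
move=> <-; rewrite -E -EFinM; congr EFin.
have E4 : 4 `^ p = 4 `^ (N%:R / 2) * 4 `^ s :> R by rewrite powRD// pnatr_eq0 implybT.
rewrite /riesz_const -/p powRM ?pi_ge0// E4.
have -> : (enorm xi ^+ 2) `^ s = enorm xi `^ (2 * s).
  by rewrite -powR_mulrn ?enorm_ge0// -powRrM.
move: (euler_gamma p) (enorm xi `^ _) (heat_moment m s) G0 => G a J G0'.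
have : 4 `^ (N%:R / 2) != 0 :> R by rewrite gt_eqF// powR_gt0.
have : 4 `^ s != 0 :> R by rewrite gt_eqF// powR_gt0.
move: (4 `^ (N%:R / 2)) (4 `^ s) (pi `^ _) => A B C B0 A0.
by field; rewrite B0 A0 gt_eqF.
Qed.

Lemma cNms_riesz_const N m s : (0 < m)%N -> 0 < s -> s < m%:R ->
  0 < riesz_const N m s /\ cNms N m s * riesz_const N m s = 2.
Proof.
move=> m0 s0 sm.
have J0 := heat_moment_gt0 s0 sm (@heat_sum_ge0 R m).
have [_ /(_ (lt0r_neq0 J0)) E] := heat_momentP N s0 sm.
have p0 : 0 < N%:R / 2 + s by rewrite ltr_wpDl// divr_ge0.
have G0 := euler_gamma_gt0 p0.
split.
  by rewrite /riesz_const divr_gt0// mulr_gt0 ?powR_gt0// pi_gt0.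
rewrite /riesz_const mulrA E /Gamma p0 addr0 big_ord0 divr1; field.
by rewrite (gt_eqF G0) gt_eqF// powR_gt0.
Qed.

End subordination.

(** * Test functions and the decay of their Fourier integrals *)

Section box.
Context {R : realType}.
Notation mu := (@lebesgue_measure R).
Notation L := (@lebesgue_rV R).
Variable n : nat.
Implicit Types (B : R) (x : 'rV[R]_n).

(** The indicator of a ball for the sup norm, written as a product so that it can be integrated
    one coordinate at a time; it dominates bounded functions of bounded support. *)
Definition box B x : R := \prod_(i < n) \1_(`[- B, B]%classic : set R) (x ord0 i).

Lemma boxE B x : 0 <= B -> box B x = if `|x| <= B then 1 else 0.
Proof.
move=> B0; have I1 (a : R) : \1_(`[- B, B]%classic : set R) a = (`|a| <= B)%R%:R :> R.
  by rewrite indicE mem_setE in_itv/= -ler_norml.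
rewrite /box; under eq_bigr do rewrite I1.
case: ifPn => [/(mx_norm_leP x B0) h|xB].
  by rewrite big1// => i _; rewrite h.
have [i hi] : exists i, ~~ (`|x ord0 i| <= B).
  apply/existsP; apply: contraNT xB; rewrite negb_exists => /forallP h.
  by apply/(mx_norm_leP x B0) => i; have := h i; rewrite negbK.
by rewrite (bigD1 i)//= (negbTE hi) mul0r.
Qed.

Lemma box_dominates B M (f : 'rV[R]_n -> R) : 0 <= B ->
  (forall x, `|f x| <= M) -> (forall x, B < `|x| -> f x = 0) ->
  forall x, `|f x| <= M * box B x.
Proof.
move=> B0 fM f0 x; rewrite boxE//; case: ifPn => [_|]; first by rewrite mulr1.
by rewrite -ltNge => xB; rewrite f0// normr0 mulr0.
Qed.

Lemma has_integral_box B : 0 <= B -> has_integral (L n) setT (box B) ((2 * B) ^+ n).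
Proof.
move=> B0; rewrite -[n in X in _ ^+ X]card_ord -prodr_const.
apply: (has_integral_rV_prod (f := fun _ => \1_(`[- B, B]%classic : set R))) => i.
apply: has_integral_ge0 => //.
rewrite integral_indic//= setIT lebesgue_measure_itv/= lte_fin.
case: ltP => BB; first by rewrite -EFinB opprK; congr EFin; lra.
by congr EFin; lra.
Qed.

End box.

Section test_functions.
Context {R : realType}.
Notation mu := (@lebesgue_measure R).
Notation L := (@lebesgue_rV R).
Variable n : nat.
Implicit Types (B M : R) (x y xi : 'rV[R]_n) (w : 'rV[R]_n -> R) (i : 'I_n).

(** An explicit radius, in the sup norm, is convenient because partial derivatives keep it. *)
Definition test_fun B w := is_smooth w /\ forall x, B < `|x| -> w x = 0.

Lemma test_fun_continuous B w : test_fun B w -> continuous w.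
Proof. by move=> [/(_ 0%N)[]]. Qed.

Lemma test_fun_measurable B w : test_fun B w -> measurable_fun setT w.
Proof. by move/test_fun_continuous; exact: continuous_rV_measurable. Qed.

Lemma test_fun_bounded B w : 0 <= B -> test_fun B w -> exists2 M : R, 0 <= M & forall x, `|w x| <= M.
Proof.
move=> B0 tw; pose K := [set x : 'rV[R]_n | forall i, `[- B, B]%classic (x ord0 i)].
have cK : compact K by apply: (@rV_compact R n (fun _ => `[- B, B]%classic)) => i; exact: segment_compact.
have : compact (w @` K).
  by apply: continuous_compact cK; apply: continuous_subspaceT; exact: test_fun_continuous tw.
move/compact_bounded => [M [_ hM]].
exists (`|M| + 1) => [|x]; first by rewrite addr_ge0.
have [xB|Bx] := leP `|x| B; last by rewrite tw.2// normr0 addr_ge0.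
apply: hM; first by rewrite (le_lt_trans (ler_norm _))// ltrDl.
exists x => // i /=; rewrite in_itv/= -ler_norml.
exact: le_trans (coord_le_mx_norm x i) xB.
Qed.

Let e i : 'rV[R]_n := delta_mx ord0 i.

Lemma test_fun_derivable B w i x : test_fun B w -> derivable w x (e i).
Proof. by move=> [/(_ 1%N)[_ /(_ i)[+ _]] _]; apply. Qed.

Lemma test_fun_derive B w i : test_fun B w -> test_fun B (fun x => 'D_(e i) w x).
Proof.
move=> tw; split; first by move=> k; have [/(_ k.+1)[_ /(_ i)[]]] := tw.
move=> x Bx; rewrite -(@derive_cst R 'rV[R]_n R 0 x (e i)).
apply: near_eq_derive; near=> z.
rewrite tw.2//; near: z.
have h : `|z| @[z --> x] --> `|x| by exact: norm_continuous.
by move/cvgr_gt : h; exact.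
Unshelve. all: by end_near. Qed.

Lemma is_derive_shift w i x : derivable w x (e i) ->
  is_derive (0 : R) 1 (fun t => w (t *: e i + x)) ('D_(e i) w x).
Proof.
move=> dw.
have E : (fun h : R => h^-1 *:
     (((fun t : R => w (t *: e i + x)) \o shift 0) (h *: (1 : R)) - w (0 *: e i + x))) =
   (fun h : R => h^-1 *: ((w \o shift x) (h *: e i) - w x)).
  by apply/funext => h /=; rewrite addr0 scale0r add0r /GRing.scale/= mulr1.
by split; [rewrite /derivable E|rewrite /derive E].
Qed.

(** Difference quotients have zero integral by translation invariance, and converge boundedly. *)
Lemma has_integral_partial B M (F G : 'rV[R]_n -> R) i : 0 <= B -> 0 <= M ->
  measurable_fun setT F -> (exists M', forall x, `|F x| <= M') ->
  (forall x, is_derive (0 : R) 1 (fun t => F (t *: e i + x)) (G x)) ->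
  (forall x, B < `|x| -> F x = 0) -> (forall x, `|G x| <= M) ->
  has_integral (L n) setT G 0.
Proof.
move=> B0 M0 mF [M' FM'] dF F0 GM.
have M'0 : 0 <= M' by apply: le_trans (FM' 0).
have hF : has_integral (L n) setT F (\int[L n]_x F x).
  apply: integrable_has_integral => //.
  apply: (integrable_dominated mF (has_integralZl measurableT M' (has_integral_box n B0))).
  exact: box_dominates.
pose h k : R := k.+1%:R^-1.
have h0 k : 0 < h k by rewrite invr_gt0.
have h1 k : h k <= 1 by rewrite invf_le1// ler1n.
pose q k x := k.+1%:R * (F (h k *: e i + x) - F x).
have hq k : has_integral (L n) setT (q k) 0.
  have := has_integralB (has_integral_rV_affine (h k *: e i) ltr01 hF) hF.
  rewrite expr1n invr1 mul1r subrr => /(has_integralZl measurableT k.+1%:R).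
  rewrite mulr0; apply: (eq_has_integral measurableT) => x _.
  by rewrite /q scale1r [x + _]addrC.
have dFt x (t : R) : is_derive t 1 (fun t => F (t *: e i + x)) (G (t *: e i + x)).
  have [d1 d2] := dF (t *: e i + x).
  have E : (fun h : R => h^-1 *:
       (((fun t : R => F (t *: e i + x)) \o shift t) (h *: (1 : R)) - F (t *: e i + x))) =
     (fun h : R => h^-1 *: (((fun u : R => F (u *: e i + (t *: e i + x))) \o shift 0) (h *: (1 : R))
       - F (0 *: e i + (t *: e i + x)))).
    by apply/funext => u /=; rewrite addr0 scale0r add0r scalerDl addrA.
  by split; [rewrite /derivable E|rewrite /derive E].
have cq x : q k x @[k --> \oo] --> G x.
  have [d1 d2] := dF x.
  have /cvg_ex[/= l hl] := d1.
  have lE : l = G x by rewrite -d2; apply/esym/cvg_lim.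
  move: hl => /cvgr_dnbhsP/(_ h); rewrite lE => hl.
  have h0' : (forall k, h k != 0) /\ h k @[k --> \oo] --> (0 : R).
    split=> [k|]; first by rewrite gt_eqF.
    exact: cvg_harmonic.
  move: (hl h0'); rewrite (_ : (fun _ => _) = q^~ x)//; apply/funext => k.
  by rewrite /= addr0 scale0r add0r /GRing.scale/= mulr1 /q /h invrK.
(* The quotients vanish outside the ball of radius B + 1, since the increment h k is at most 1. *)
have bq k x : `|q k x| <= M * box (B + 1) x.
  have B1 : 0 <= B + 1 by rewrite addr_ge0.
  rewrite boxE//; case: ifPn => [_|]; last rewrite -ltNge => Bx.
    rewrite mulr1 /q.
    have [c _] : exists2 c, c \in `[0, h k] &
        F (h k *: e i + x) - F (0 *: e i + x) = G (c *: e i + x) * (h k - 0).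
      apply: (@MVT_segment _ (fun t => F (t *: e i + x)) (fun t => G (t *: e i + x))); first exact: ltW.
      by apply: continuous_subspaceT => t; apply: derivable1_continuous; have [] := dFt x t.
    rewrite scale0r add0r subr0 => ->.
    by rewrite mulrCA /h divff ?mulr1 ?GM// pnatr_eq0.
  have xB : B < `|x| by rewrite (le_lt_trans _ Bx)// lerDl.
  rewrite mulr0 /q !F0 ?subrr ?mulr0 ?normr0//.
  have e1 : `|h k *: e i| <= 1.
    rewrite normrZ ger0_norm ?(ltW (h0 k))// (le_trans (ler_piMr (ltW (h0 k)) _) (h1 k))//.
    by apply/mx_norm_leP => // j; rewrite mxE; case: (_ && _); rewrite ?normr1 ?normr0.
  have : `|x| <= `|h k *: e i + x| + `|h k *: e i|.
    by rewrite -[in leLHS](addKr (h k *: e i) x) addrC ler_normB.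
  by lra.
have [v hv] := has_integral_dominated hq cq
  (has_integralZl measurableT M (has_integral_box n (addr_ge0 B0 ler01))) bq.
by move=> v0; have <- : v = 0 by exact: cvg_unique v0 (cvg_cst _).
Qed.

(** The real part of [exp (i a)] times the Fourier integral of [w]; the imaginary part is
    recovered by shifting the phase [a] by a quarter period. *)
Definition wave w xi (a : R) : R := \int[L n]_y (w y * cos (a - dotr xi y)).

Lemma measurable_wave_integrand w xi (a : R) : measurable_fun setT w ->
  measurable_fun setT (fun y => w y * cos (a - dotr xi y)).
Proof.
move=> mw; apply: measurable_funM => //.
apply: (measurableT_comp (continuous_measurable_fun (@continuous_cos R))).
by apply: measurable_funB => //; apply: measurable_fun_dotr => //; exact: measurable_cst.
Qed.

Lemma has_integral_wave B w xi a : 0 <= B -> test_fun B w ->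
  has_integral (L n) setT (fun y => w y * cos (a - dotr xi y)) (wave w xi a).
Proof.
move=> B0 tw; have [M M0 wM] := test_fun_bounded B0 tw.
apply: integrable_has_integral => //.
apply: (integrable_dominated _ (has_integralZl measurableT M (has_integral_box n B0))).
  exact: measurable_wave_integrand (test_fun_measurable tw).
apply: box_dominates => // y; last by move=> By; rewrite tw.2// mul0r.
by rewrite normrM (le_trans (ler_piMr _ _) (wM y))// ler_norml cos_geN1 cos_le1.
Qed.

Lemma dotr_delta xi i : dotr xi (e i) = xi ord0 i.
Proof.
rewrite /dotr (bigD1 i)//= mxE !eqxx mulr1 big1 ?addr0// => j ji.
by rewrite mxE (negbTE ji) andbF mulr0.
Qed.

(** The derivative of [w x * cos (a + pi / 2 - xi.x)] in the direction [e i] has integral zero. *)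
Lemma wave_derive B w xi a i : 0 <= B -> test_fun B w ->
  wave (fun x => 'D_(e i) w x) xi (a + pi / 2) = - (xi ord0 i * wave w xi a).
Proof.
move=> B0 tw; have tdw := test_fun_derive i tw.
have [M M0 wM] := test_fun_bounded B0 tw.
have [M1 M10 dwM] := test_fun_bounded B0 tdw.
have h1 := has_integral_wave xi (a + pi / 2) B0 tdw.
have h2 := has_integral_wave xi a B0 tw.
pose F x := w x * cos (a + pi / 2 - dotr xi x).
pose G x := 'D_(e i) w x * cos (a + pi / 2 - dotr xi x) + xi ord0 i * (w x * cos (a - dotr xi x)).
have hG : has_integral (L n) setT G (wave (fun x => 'D_(e i) w x) xi (a + pi / 2) + xi ord0 i * wave w xi a).
  exact: has_integralD h1 (has_integralZl measurableT _ h2).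
have hG0 : has_integral (L n) setT G 0.
  apply: (@has_integral_partial B (M1 + `|xi ord0 i| * M) F G i B0).
  - by rewrite addr_ge0// mulr_ge0.
  - exact: measurable_wave_integrand (test_fun_measurable tw).
  - exists M => x; rewrite normrM (le_trans (ler_piMr _ _) (wM x))//.
    by rewrite ler_norml cos_geN1 cos_le1.
  - move=> x.
    have d1 := is_derive_shift (@test_fun_derivable B w i x tw).
    have d2 : is_derive (0:R) 1 (fun t => cos (a + pi / 2 - dotr xi (t *: e i + x)))
        (sin (a + pi / 2 - dotr xi x) * xi ord0 i).
      have d3 : is_derive (0:R) 1 (fun t => a + pi / 2 - dotr xi (t *: e i + x)) (- xi ord0 i).
        have d4 := is_derive1N (is_derive1D (is_derive1_linear (xi ord0 i) (0:R))
          (is_derive_cst (dotr xi x) (0:R) (1:R))).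
        have d5 := is_derive1D (is_derive_cst (a + pi / 2) (0:R) (1:R)) d4.
        rewrite addr0 add0r in d5.
        apply: (is_derive1_ext d5) => t.
        by rewrite /= dotrDr dotrZr dotr_delta (mulrC t).
      have := @is_derive1_comp _ cos _ (0:R) _ _ (is_derive_cos _) d3.
      by rewrite scale0r add0r mulrNN.
    have := is_derive1M d1 d2; rewrite scale0r add0r.
    move=> D; apply: (is_derive_eq D); rewrite /G.
    have -> : sin (a + pi / 2 - dotr xi x) = cos (a - dotr xi x).
      by rewrite addrAC -sinDpihalf.
    ring.
  - by move=> x Bx; rewrite /F tw.2// mul0r.
  - move=> x; rewrite /G (le_trans (ler_normD _ _))// lerD//.
      rewrite normrM (le_trans (ler_piMr _ _) (dwM x))//.
      by rewrite ler_norml cos_geN1 cos_le1.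
    rewrite normrM ler_wpM2l// normrM (le_trans (ler_piMr _ _) (wM x))//.
    by rewrite ler_norml cos_geN1 cos_le1.
by have /eqP := has_integral_uniq hG hG0; rewrite addr_eq0 => /eqP.
Qed.

Lemma wave_bounded B w : 0 <= B -> test_fun B w ->
  exists2 C : R, 0 <= C & forall xi a, `|wave w xi a| <= C.
Proof.
move=> B0 tw; have [M M0 wM] := test_fun_bounded B0 tw.
exists (M * (2 * B) ^+ n) => [|xi a]; first by rewrite mulr_ge0// exprn_ge0// mulr_ge0.
apply: (has_integral_norm_le (has_integral_wave xi a B0 tw)
  (has_integralZl measurableT M (has_integral_box n B0))).
apply: box_dominates => // y; last by move=> By; rewrite tw.2// mul0r.
by rewrite normrM (le_trans (ler_piMr _ _) (wM y))// ler_norml cos_geN1 cos_le1.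
Qed.

Lemma wave_decay_coord B w i k : 0 <= B -> test_fun B w ->
  exists2 C : R, 0 <= C & forall xi a, `|xi ord0 i| ^+ k * `|wave w xi a| <= C.
Proof.
move=> B0; elim: k w => [|k IH] w tw.
  have [C C0 h] := wave_bounded B0 tw; exists C => // xi a.
  by rewrite expr0 mul1r.
have [C C0 h] := IH _ (test_fun_derive i tw); exists C => // xi a.
by rewrite exprSr -mulrA -normrM -[X in _ * X]normrN -(wave_derive xi a i B0 tw); exact: h.
Qed.

(** This majorant takes the place of a negative power of [1 + |xi|^2] because it can be integrated one
    coordinate at a time. *)
Definition cauchy_prod xi : R := \prod_(i < n) (1 + xi ord0 i ^+ 2)^-1.

Lemma has_integral_cauchy_prod : has_integral (L n) setT cauchy_prod (pi ^+ n).
Proof.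
rewrite -[n in X in _ ^+ X]card_ord -prodr_const.
apply: (has_integral_rV_prod (f := fun _ (a : R) => (1 + a ^+ 2)^-1)) => i.
exact: has_integral_cauchy_density.
Qed.

Lemma cauchy_prod_ge xi (t : R) : `|xi| ^+ 2 <= t -> (1 + t) ^- n <= cauchy_prod xi.
Proof.
move=> xt; rewrite -exprVn -[n in X in _ ^+ X <= _]card_ord -prodr_const; apply: ler_prod => i _.
have x0 : 0 < 1 + xi ord0 i ^+ 2 by rewrite ltr_pwDl// sqr_ge0.
have t0 : 0 < 1 + t by rewrite ltr_pwDl// (le_trans _ xt)// sqr_ge0.
rewrite invr_ge0 (ltW t0)/= lef_pV2// lerD2l (le_trans _ xt)//.
by rewrite -real_normK ?num_real// lerXn2r ?nnegrE// coord_le_mx_norm.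
Qed.

Lemma sqr_enorm_le xi : enorm xi ^+ 2 <= n%:R * `|xi| ^+ 2.
Proof.
rewrite sqr_enorm mulr_natl -[n in X in _ *+ X]card_ord -sumr_const; apply: ler_sum => i _.
by rewrite -real_normK ?num_real// lerXn2r ?nnegrE// coord_le_mx_norm.
Qed.

(** Integration by parts bounds the product of the wave with any power of any [|xi_i|], uniformly in
    the phase, and the largest coordinate controls the norm of [xi]. *)
Lemma wave_decay B w m : 0 <= B -> test_fun B w ->
  exists2 C : R, 0 <= C & forall xi a, (1 + enorm xi ^+ 2) ^+ m * `|wave w xi a| <= C * cauchy_prod xi.
Proof.
move=> B0 tw; pose K := (2 * (m + n))%N.
have [C0 C00 h0] := wave_bounded B0 tw.
have /choice[c hc] : forall i, exists c, 0 <= c /\ forall xi a, `|xi ord0 i| ^+ K * `|wave w xi a| <= c.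
  by move=> i; have [c c0 h] := wave_decay_coord i K B0 tw; exists c.
pose C := C0 + \sum_i c i.
have sc0 : 0 <= \sum_i c i by apply: sumr_ge0 => i _; have [] := hc i.
have CC : 0 <= C by rewrite addr_ge0.
have hC xi a : Num.max 1 (`|xi| ^+ 2) ^+ (m + n) * `|wave w xi a| <= C.
  case: (leP 1 (`|xi| ^+ 2)) => x1; last first.
    by rewrite expr1n mul1r (le_trans (h0 _ _))// lerDl.
  have /mx_norm_neq0[[j i]] : mx_norm xi != 0.
    by apply: contraTneq x1; rewrite -/(mx_norm xi) /Num.norm/= => ->; rewrite expr0n/= -ltNge.
  rewrite /= ord1 => xE; rewrite -exprM -/K [`|xi|]xE.
  have [ci h] := hc i; rewrite (le_trans (h _ _))// /C (bigD1 i)//= addrCA lerDl.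
  by rewrite addr_ge0// sumr_ge0// => k _; have [] := hc k.
exists ((n%:R + 1) ^+ m * 2 ^+ (m + n) * C) => [|xi a].
  by rewrite !mulr_ge0 ?exprn_ge0// addr_ge0.
pose t := `|xi| ^+ 2; have t0 : 0 <= t by exact: sqr_ge0.
have t1 : 0 < 1 + t by rewrite ltr_pwDl.
(* Of the m + n available powers of 1 + t, the last n are traded for the majorant. *)
apply: (@le_trans _ _ ((n%:R + 1) ^+ m * 2 ^+ (m + n) * C * (1 + t) ^- n)); last first.
  by rewrite ler_wpM2l ?cauchy_prod_ge// !mulr_ge0 ?exprn_ge0// addr_ge0.
rewrite ler_pdivlMr ?exprn_gt0//.
have e1 : (1 + enorm xi ^+ 2) ^+ m <= (n%:R + 1) ^+ m * (1 + t) ^+ m.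
  rewrite -exprMn lerXn2r ?nnegrE ?addr_ge0 ?sqr_ge0 ?mulr_ge0 ?addr_ge0//.
  have := sqr_enorm_le xi; rewrite -/t => h.
  have : 0 <= n%:R :> R by []; nra.
have e2 : (1 + t) ^+ (m + n) <= 2 ^+ (m + n) * Num.max 1 t ^+ (m + n).
  rewrite -exprMn lerXn2r ?nnegrE ?mulr_ge0 ?addr_ge0// ?le_max ?ler01//.
  have h1 : 1 <= Num.max 1 t by rewrite le_max lexx.
  have h2 : t <= Num.max 1 t by rewrite le_max lexx orbT.
  by lra.
apply: (@le_trans _ _ ((n%:R + 1) ^+ m * (1 + t) ^+ m * `|wave w xi a| * (1 + t) ^+ n)).
  by rewrite ler_wpM2r ?exprn_ge0 ?(ltW t1)// ler_wpM2r.
rewrite mulrAC -!mulrA ler_wpM2l ?exprn_ge0 ?addr_ge0//.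
rewrite mulrA -exprD mulrC.
apply: (@le_trans _ _ (2 ^+ (m + n) * Num.max 1 t ^+ (m + n) * `|wave w xi a|)).
  by rewrite mulrC ler_wpM2r.
by rewrite -mulrA ler_wpM2l ?exprn_ge0//; exact: hC.
Qed.

End test_functions.

(** * Iterated integrals and Fourier inversion *)

Section iterated_integrals.
Context d1 d2 (T1 : measurableType d1) (T2 : measurableType d2) (R : realType).
Variable m1 : {sigma_finite_measure set T1 -> \bar R}.
Variable m2 : {sigma_finite_measure set T2 -> \bar R}.

Lemma measurable_Rintegral (f : T1 * T2 -> R) : measurable_fun setT f ->
  measurable_fun setT (fun x => \int[m2]_y f (x, y)).
Proof.
move=> mf; rewrite /Rintegral; apply: measurableT_comp => //.
have mF : measurable_fun setT (EFin \o f) by exact/measurable_EFinP.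
rewrite (_ : (fun x => _) = fubini_F m2 ((EFin \o f)^\+)%E \- fubini_F m2 ((EFin \o f)^\-)%E)%E.
  apply: emeasurable_funB.
    by apply: measurable_fun_fubini_tonelli_F => //; exact: measurable_funepos.
  by apply: measurable_fun_fubini_tonelli_F => //; exact: measurable_funeneg.
apply/funext => x; rewrite [LHS]integralE.
by congr (_ - _)%E; apply: eq_integral => y _; rewrite ?funeposE ?funenegE.
Qed.

(** Tonelli applied to the majorant [g] gives integrability on the product space. *)
Lemma has_integral_fubini (f g : T1 * T2 -> R) F G H c : measurable_fun setT f ->
  (forall z, `|f z| <= g z) ->
  (forall x, has_integral m2 setT (fun y => f (x, y)) (F x)) ->
  (forall y, has_integral m1 setT (fun x => f (x, y)) (G y)) ->
  (forall x, has_integral m2 setT (fun y => g (x, y)) (H x)) ->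
  has_integral m1 setT H c ->
  exists2 v, has_integral m1 setT F v & has_integral m2 setT G v.
Proof.
move=> mf fg hF hG hH hc.
have mf' : measurable_fun setT (EFin \o f) by exact/measurable_EFinP.
have fi : (m1 \x m2)%E.-integrable setT (EFin \o f).
  apply/(integrable12ltyP _ _ mf').
  apply: (@le_lt_trans _ _ (\int[m1]_x (H x)%:E)%E); last by rewrite hc.2 ltry.
  apply: ge0_le_integral => //.
  - by move=> x _; apply: integral_ge0 => y _; exact: abse_ge0.
  - apply: (measurable_fun_fubini_tonelli_F (abse \o (EFin \o f))) => //.
    exact: measurableT_comp.
  - by move=> z; exact: abse_ge0.
  - by move: (hc.1) => /integrableP[].
  - move=> x _; rewrite -(hH x).2; apply: ge0_le_integral => //.
    + by apply: measurableT_comp => //; exact: measurableT_comp.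
    + by move: (hH x).1 => /integrableP[].
    + by move=> y _; rewrite /= lee_fin.
have FE : fubini_F m2 (EFin \o f) = EFin \o F.
  by apply/funext => x; rewrite /fubini_F/= (hF x).2.
have GE : fubini_G m1 (EFin \o f) = EFin \o G.
  by apply/funext => y; rewrite /fubini_G/= (hG y).2.
have Fi := integrable_fubini_F fi; rewrite FE in Fi.
have Gm := measurable_fubini_G fi; rewrite GE in Gm.
have hFi := integrable_has_integral measurableT Fi.
exists (\int[m1]_x F x) => //.
have E : (\int[m2]_y (G y)%:E = (\int[m1]_x F x)%:E)%E.
  rewrite -hFi.2; have := integral21_prod_meas1 fi; rewrite -(integral12_prod_meas1 fi) FE GE; exact.
split => //.
have gi : (\int[m2]_y \int[m1]_x `|(EFin \o f) (x, y)| < +oo)%E.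
  by apply/(integrable21ltyP _ _ mf').
apply/integrableP; split=> //; apply: le_lt_trans gi.
apply: ge0_le_integral => //.
- exact: measurableT_comp.
- apply: (measurable_fun_fubini_tonelli_G (abse \o (EFin \o f))) => //.
  exact: measurableT_comp.
- by move=> z; exact: abse_ge0.
- move=> y _; rewrite [X in (`|X| <= _)%E](esym (hG y).2); apply: le_abse_integral => //.
  by move: (hG y).1 => /integrableP[].
Qed.

End iterated_integrals.

Section inversion.
Context {R : realType}.
Notation L := (@lebesgue_rV R).
Variable n : nat.
Implicit Types (B M : R) (x y xi : 'rV[R]_n) (w : 'rV[R]_n -> R).

Lemma measurable_wave_joint d (T : measurableType d) w (f g : T -> 'rV[R]_n) (a : T -> R) :
  measurable_fun setT w -> measurable_fun setT f -> measurable_fun setT g -> measurable_fun setT a ->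
  measurable_fun setT (fun t => w (g t) * cos (a t - dotr (f t) (g t))).
Proof.
move=> mw mf mg ma; apply: measurable_funM; first exact: measurableT_comp.
apply: (measurableT_comp (continuous_measurable_fun (@continuous_cos R))).
by apply: measurable_funB => //; exact: measurable_fun_dotr.
Qed.

Lemma measurable_wave w (a : 'rV[R]_n -> R) : measurable_fun setT w -> measurable_fun setT a ->
  measurable_fun setT (fun xi => wave w xi (a xi)).
Proof.
move=> mw ma.
have := @measurable_Rintegral _ _ _ _ R (L n) (fun z => w z.2 * cos (a z.1 - dotr z.1 z.2)).
apply; apply: measurable_wave_joint => //.
exact: measurableT_comp.
Qed.

Lemma has_integral_gaussian0 r : 0 < r ->
  has_integral (L n) setT (gaussian r) (Num.sqrt (4 * pi * r) ^+ n).
Proof.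
move=> r0; have := (has_integral_gaussian (0 : 'rV[R]_n) r0).1.
rewrite enorm0 expr0n/= mulr0 oppr0 expR0 mulr1.
apply: (eq_has_integral measurableT) => y _.
by rewrite (_ : dotr 0 y = 0) ?cos0 ?mulr1// /dotr big1// => i _; rewrite mxE mul0r.
Qed.

(** Damping the frequency integral by a wide Gaussian convolves [w] with a narrow one. *)
Lemma gauss_weierstrass B w x r : 0 <= B -> test_fun B w -> 0 < r ->
  exists2 v, has_integral (L n) setT (fun xi => gaussian r xi * wave w xi (dotr xi x)) v &
    has_integral (L n) setT
      (fun y => w y * (Num.sqrt (4 * pi * r) ^+ n * expR (- (r * enorm (x - y) ^+ 2)))) v.
Proof.
move=> B0 tw r0; have [M M0 wM] := test_fun_bounded B0 tw.
have mw := test_fun_measurable tw.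
have hb := has_integralZl measurableT M (has_integral_box n B0).
apply: (@has_integral_fubini _ _ _ _ R (L n) (L n)
  (fun z => gaussian r z.1 * (w z.2 * cos (dotr z.1 x - dotr z.1 z.2)))
  (fun z => gaussian r z.1 * (M * box B z.2)) _ _
  (fun xi => gaussian r xi * (M * (2 * B) ^+ n)) (M * (2 * B) ^+ n * Num.sqrt (4 * pi * r) ^+ n)).
- apply: measurable_funM; first by apply: measurableT_comp => //; exact: measurable_gaussian.
  apply: measurable_wave_joint => //.
  by apply: measurable_fun_dotr => //; exact: measurable_cst.
- move=> [xi y]/=; rewrite normrM ger0_norm ?gaussian_ge0// ler_wpM2l ?gaussian_ge0//.
  apply: (box_dominates (f := fun y => w y * cos (dotr xi x - dotr xi y))) => // z; last first.
    by move=> Bz; rewrite tw.2// mul0r.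
  by rewrite normrM (le_trans (ler_piMr _ _) (wM z))// ler_norml cos_geN1 cos_le1.
- by move=> xi /=; exact: (has_integralZl measurableT _ (has_integral_wave xi _ B0 tw)).
- move=> y; have := has_integralZl measurableT (w y) (has_integral_gaussian (x - y) r0).1.
  apply: (eq_has_integral measurableT) => xi _ /=.
  by rewrite -dotrBr dotrC; ring.
- by move=> xi /=; exact: (has_integralZl measurableT _ hb).
- have := has_integralZl measurableT (M * (2 * B) ^+ n) (has_integral_gaussian0 r0).
  by apply: (eq_has_integral measurableT) => xi _; rewrite mulrC.
Qed.

(** Along [r = (k + 1)^2] the damping disappears in the limit, while the substitution
    [y = x + z / (k + 1)] turns the narrow kernel into a fixed Gaussian in [z] and [w y] into
    values of [w] that tend to [w x].  Both limits are by dominated convergence. *)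
Lemma fourier_inversion B w x : 0 <= B -> test_fun B w ->
  has_integral (L n) setT (fun xi => wave w xi (dotr xi x)) ((2 * pi) ^+ n * w x).
Proof.
move=> B0 tw; have [M M0 wM] := test_fun_bounded B0 tw.
have mw := test_fun_measurable tw.
have [C C0 hC] := wave_decay 0 B0 tw.
pose c (k : nat) : R := k.+1%:R; have c0 k : 0 < c k by [].
pose r k := c k ^+ 2; have r0 k : 0 < r k by rewrite exprn_gt0.
have /choice[v hv] : forall k, exists v,
  has_integral (L n) setT (fun xi => gaussian (r k) xi * wave w xi (dotr xi x)) v /\
  has_integral (L n) setT
    (fun y => w y * (Num.sqrt (4 * pi * r k) ^+ n * expR (- (r k * enorm (x - y) ^+ 2)))) v.
  by move=> k; have [v] := gauss_weierstrass x B0 tw (r0 k); exists v.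
have ic : (c k)^-1 @[k --> \oo] --> (0 : R) by exact: cvg_harmonic.
have gk xi : gaussian (r k) xi @[k --> \oo] --> (1 : R).
  rewrite -expR0; apply: continuous_cvg; first exact: continuous_expR.
  rewrite (_ : (fun k => _) = fun k => - enorm xi ^+ 2 / 4 * ((c k)^-1 * (c k)^-1)).
    rewrite (_ : 0 = - enorm xi ^+ 2 / 4 * (0 * 0)); last by rewrite !mulr0.
    by apply: cvgMr; exact: cvgM.
  by apply/funext => k; rewrite /r expr2; have := lt0r_neq0 (c0 k); move=> ?; field.
have gk1 k xi : `|gaussian (r k) xi| <= 1.
  rewrite ger0_norm ?gaussian_ge0// /gaussian -expR0 ler_expR mulNr oppr_le0.
  by rewrite divr_ge0 ?sqr_ge0// mulr_ge0// ltW.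
have [V hV cV] : exists2 V, has_integral (L n) setT (fun xi => wave w xi (dotr xi x)) V &
    v k @[k --> \oo] --> V.
  apply: (has_integral_dominated (fun k => (hv k).1) (f := fun xi => wave w xi (dotr xi x))
    (g := fun xi => C * cauchy_prod xi)).
  - by move=> xi; rewrite -[X in _ --> X]mul1r; apply: cvgMl; exact: gk.
  - exact: (has_integralZl measurableT C (@has_integral_cauchy_prod R n)).
  move=> k xi; rewrite normrM (le_trans (ler_piMl _ (gk1 k xi)))//.
  by have := hC xi (dotr xi x); rewrite expr0 mul1r.
suff cW : v k @[k --> \oo] --> (2 * pi) ^+ n * w x.
  by rewrite -(cvg_unique _ cV cW).
pose A : R := Num.sqrt (4 * pi) ^+ n.
have A0 : 0 <= A by rewrite exprn_ge0.
pose e z : R := expR (- enorm (z : 'rV[R]_n) ^+ 2).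
have he : has_integral (L n) setT e (Num.sqrt pi ^+ n).
  have q0 : (0 : R) < 4^-1 by [].
  have := has_integral_gaussian0 q0; rewrite (_ : 4 * pi * 4^-1 = pi :> R); last by field.
  by apply: (eq_has_integral measurableT) => z _; rewrite /gaussian /e; congr expR; field.
have hk k : has_integral (L n) setT (fun z => w ((c k)^-1 *: z + x) * (A * e z)) (v k).
  have := has_integral_rV_affine x (_ : 0 < (c k)^-1) (hv k).2.
  rewrite invr_gt0 => /(_ (c0 k)) /(has_integralZl measurableT ((c k) ^- n)).
  have -> : c k ^- n * ((c k)^-1 ^- n * v k) = v k.
    by rewrite exprVn invrK mulKf// expf_neq0// gt_eqF.
  apply: (eq_has_integral measurableT) => z _.
  have -> : Num.sqrt (4 * pi * r k) = Num.sqrt (4 * pi) * c k.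
    by rewrite sqrtrM ?mulr_ge0 ?pi_ge0// /r sqrtr_sqr ger0_norm// ltW.
  have -> : enorm (x - ((c k)^-1 *: z + x)) ^+ 2 = (c k)^-1 ^+ 2 * enorm z ^+ 2.
    rewrite !sqr_enorm big_distrr/=; apply: eq_bigr => i _; rewrite !mxE; ring.
  have -> : r k * ((c k)^-1 ^+ 2 * enorm z ^+ 2) = enorm z ^+ 2.
    by rewrite /r mulrA -exprMn mulfV ?gt_eqF// expr1n mul1r.
  rewrite exprMn /e /A.
  have := lt0r_neq0 (exprn_gt0 n (c0 k)); move: (c k ^+ n) => t t0.
  by field.
have [V' hV' cV'] : exists2 V, has_integral (L n) setT (fun z => w x * (A * e z)) V & v k @[k --> \oo] --> V.
  apply: (has_integral_dominated hk _ (has_integralZl measurableT (M * A) he)).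
    move=> z; have cx : ((c k)^-1 *: z + x) @[k --> \oo] --> x.
      rewrite -[X in _ --> X]add0r -(scale0r z).
      by apply: cvgD; [exact: cvgZr_tmp ic|exact: cvg_cst].
    have cw : {for x, continuous w} by exact: (test_fun_continuous tw).
    by apply: cvgMl; exact: (cvg_comp _ _ cx cw).
  move=> k z; rewrite normrM -mulrA ler_pM//.
  by rewrite ger0_norm// mulr_ge0// expR_ge0.
have := has_integralZl measurableT (w x * A) he.
rewrite (_ : w x * A * _ = (2 * pi) ^+ n * w x); last first.
  rewrite -mulrA [A * _](_ : _ = (2 * pi) ^+ n); first by rewrite mulrC.
  rewrite /A -exprMn -sqrtrM ?mulr_ge0 ?pi_ge0//; congr (_ ^+ _).
  rewrite (_ : 4 * pi * pi = (2 * pi) ^+ 2); last by ring.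
  by rewrite sqrtr_sqr ger0_norm// mulr_ge0 ?pi_ge0.
move=> h; suff <- : V' = (2 * pi) ^+ n * w x by [].
apply: (has_integral_uniq hV'); apply: (eq_has_integral measurableT _ h) => z _.
by rewrite mulrA.
Qed.

End inversion.

(** * The operator on real test functions *)

Section difference_operator.
Context {R : realType}.
Notation L := (@lebesgue_rV R).
Variables (n m : nat) (s : R).
Hypotheses (m0 : (0 < m)%N) (s0 : 0 < s) (sm : s < m%:R).
Implicit Types (B M : R) (x y xi : 'rV[R]_n) (w : 'rV[R]_n -> R).

Definition ddiff w x y : R := \sum_(j < (2 * m).+1) dcoef m j * w (x + dnode m j *: y).

Definition riesz_op w x : R := \int[L n]_y (ddiff w x y / enorm y `^ (n%:R + 2 * s)).

Lemma wave_ddiff B w xi (a t : R) : 0 <= B -> test_fun B w ->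
  \sum_(j < (2 * m).+1) dcoef m j * wave w xi (a + dnode m j * t) =
  wave w xi a * (2 - 2 * cos t) ^+ m.
Proof.
move=> B0 tw.
have h1 := has_integral_sum measurableT (index_enum 'I_(2 * m).+1) (fun j =>
  has_integralZl measurableT (dcoef m j) (has_integral_wave xi (a + dnode m j * t) B0 tw)).
have h2 := has_integralZl measurableT ((2 - 2 * cos t) ^+ m) (has_integral_wave xi a B0 tw).
rewrite mulrC; apply: (has_integral_uniq h1); apply: (eq_has_integral measurableT _ h2) => y _.
rewrite mulrCA (mulrC (_ ^+ _)) -(sum_dcoef_cos m (a - dotr xi y) t) big_distrr/=.
by apply: eq_bigr => j _; rewrite mulrCA addrAC.
Qed.

(** The inversion formula at each of the points [x + k y]; the sum over [k] acts on the phase. *)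
Lemma has_integral_ddiff B w x y : 0 <= B -> test_fun B w ->
  has_integral (L n) setT (fun xi => wave w xi (dotr xi x) * (2 - 2 * cos (dotr xi y)) ^+ m)
    ((2 * pi) ^+ n * ddiff w x y).
Proof.
move=> B0 tw.
have := has_integral_sum measurableT (index_enum 'I_(2 * m).+1) (fun j =>
  has_integralZl measurableT (dcoef m j) (fourier_inversion (x + dnode m j *: y) B0 tw)).
rewrite (_ : \sum_(i <- _) _ = (2 * pi) ^+ n * ddiff w x y); last first.
  by rewrite /ddiff big_distrr/=; apply: eq_bigr => j _; rewrite mulrCA.
apply: (eq_has_integral measurableT) => xi _.
rewrite -(wave_ddiff xi _ _ B0 tw); apply: eq_bigr => j _.
by rewrite dotrDr dotrZr.
Qed.

Lemma powR_enorm_le xi : enorm xi `^ (2 * s) <= (1 + enorm xi ^+ 2) ^+ m.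
Proof.
have e0 : 0 <= enorm xi ^+ 2 by exact: sqr_ge0.
have e1 : 1 <= 1 + enorm xi ^+ 2 by rewrite lerDl.
rewrite powRrM powR_mulrn ?enorm_ge0//.
apply: (@le_trans _ _ ((1 + enorm xi ^+ 2) `^ s)).
  by apply: ge0_ler_powR; rewrite ?nnegrE ?(ltW s0)// ?lerDr// (le_trans ler01).
by rewrite -[leRHS]powR_mulrn ?(le_trans ler01)//; apply: ler_powR => //; exact: ltW.
Qed.

Lemma symbol_wave_bound B w : 0 <= B -> test_fun B w ->
  exists2 C : R, 0 <= C & forall xi a, `|enorm xi `^ (2 * s) * wave w xi a| <= C * cauchy_prod xi.
Proof.
move=> B0 tw; have [C C0 hC] := wave_decay m B0 tw.
exists C => // xi a; rewrite (le_trans _ (hC xi a))// normrM ler_wpM2r//.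
by rewrite ger0_norm ?powR_ge0// powR_enorm_le.
Qed.

Lemma integrable_symbol_wave B w (a : 'rV[R]_n -> R) : 0 <= B -> test_fun B w ->
  measurable_fun setT a ->
  exists v, has_integral (L n) setT (fun xi => enorm xi `^ (2 * s) * wave w xi (a xi)) v.
Proof.
move=> B0 tw ma; have [C C0 hC] := symbol_wave_bound B0 tw.
eexists; apply: (integrable_has_integral measurableT).
apply: (integrable_dominated _ (has_integralZl measurableT C (@has_integral_cauchy_prod R n))).
  apply: measurable_funM; first exact: measurableT_comp (measurable_powR _) (@measurable_enorm R n).
  by apply: measurable_wave => //; exact: (test_fun_measurable tw).
by move=> xi; exact: hC.
Qed.

Lemma measurable_ddiff_joint w : measurable_fun setT w ->
  measurable_fun setT (fun z : 'rV[R]_n * 'rV[R]_n => ddiff w z.1 z.2 / enorm z.2 `^ (n%:R + 2 * s)).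
Proof.
move=> mw; apply: measurable_funM.
  apply: measurable_sum => j; apply: measurable_funM => //; apply: measurableT_comp => //.
  apply: measurable_fun_rV => i; under eq_fun do rewrite !mxE.
  apply: measurable_funD.
    exact: (measurableT_comp (measurable_coord i) measurable_fst).
  apply: measurable_funM => //.
  exact: (measurableT_comp (measurable_coord i) measurable_snd).
apply: (measurableT_comp (f := @GRing.inv R)
  (g := fun z : 'rV[R]_n * 'rV[R]_n => enorm z.2 `^ (n%:R + 2 * s))).
  exact: measurable_invr.
apply: (measurableT_comp (measurable_powR _)).
exact: (measurableT_comp (@measurable_enorm R n) measurable_snd).
Qed.

(** The inversion formula expresses the difference through waves, each of which the singular
    integral multiplies by the symbol; Fubini exchanges the two integrals. *)
Lemma has_integral_riesz_op B w x : 0 <= B -> test_fun B w ->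
  exists2 v, has_integral (L n) setT (fun xi => enorm xi `^ (2 * s) * wave w xi (dotr xi x)) v &
    has_integral (L n) setT (fun y => ddiff w x y / enorm y `^ (n%:R + 2 * s))
      ((2 * pi) ^- n * (riesz_const n m s * v)).
Proof.
move=> B0 tw; have mw := test_fun_measurable tw.
pose p := n%:R + 2 * s; pose c := riesz_const n m s.
have [C C0 hC] := symbol_wave_bound B0 tw.
have c0 : 0 < c := (cNms_riesz_const n m0 s0 sm).1.
pose K (z : 'rV[R]_n * 'rV[R]_n) := (2 - 2 * cos (dotr z.1 z.2)) ^+ m / enorm z.2 `^ p.
have K0 z : 0 <= K z by rewrite mulr_ge0 ?symbol_ge0// invr_ge0 powR_ge0.
have [v hv1 hv2] : exists2 v,
    has_integral (L n) setT (fun xi => wave w xi (dotr xi x) * (c * enorm xi `^ (2 * s))) v &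
    has_integral (L n) setT (fun y => (2 * pi) ^+ n * (ddiff w x y / enorm y `^ p)) v.
  have hab : has_integral (L n) setT (fun xi => `|wave w xi (dotr xi x)| * (c * enorm xi `^ (2 * s)))
      (\int[L n]_xi (`|wave w xi (dotr xi x)| * (c * enorm xi `^ (2 * s)))).
    apply: (integrable_has_integral measurableT).
    apply: (integrable_dominated _ (has_integralZl measurableT (c * C) (@has_integral_cauchy_prod R n))).
      apply: measurable_funM.
        apply: measurableT_comp => //; apply: measurable_wave => //.
        by apply: measurable_fun_dotr => //; exact: measurable_cst.
      apply: measurable_funM => //.
      exact: measurableT_comp (measurable_powR _) (@measurable_enorm R n).
    move=> xi; rewrite normrM normr_id normrM (gtr0_norm c0) mulrCA -(mulrA c) ler_pM2l//.
    by rewrite -normrM mulrC; exact: hC.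
  apply: (@has_integral_fubini _ _ _ _ R (L n) (L n)
    (fun z => wave w z.1 (dotr z.1 x) * K z)
    (fun z => `|wave w z.1 (dotr z.1 x)| * K z) _ _ _ _ _ _ _ _ _ hab).
  - apply: measurable_funM.
      apply: (measurableT_comp (f := fun xi => wave w xi (dotr xi x))) => //.
      apply: measurable_wave => //.
      by apply: measurable_fun_dotr => //; exact: measurable_cst.
    apply: measurable_funM.
      apply: measurable_funX; apply: measurable_funB => //; apply: measurable_funM => //.
      apply: (measurableT_comp (continuous_measurable_fun (@continuous_cos R))).
      exact: measurable_fun_dotr.
    apply: (measurableT_comp (f := @GRing.inv R) (g := fun z : 'rV[R]_n * 'rV[R]_n => enorm z.2 `^ p)).
      exact: measurable_invr.
    apply: (measurableT_comp (measurable_powR _)).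
    exact: (measurableT_comp (@measurable_enorm R n) measurable_snd).
  - by move=> z; rewrite normrM (ger0_norm (K0 z)).
  - move=> xi; have := has_integralZl measurableT (wave w xi (dotr xi x)) (has_integral_riesz xi m0 s0 sm).
    exact.
  - move=> y /=; have := has_integralZl measurableT (enorm y `^ p)^-1 (has_integral_ddiff x y B0 tw).
    rewrite mulrCA [_ * ddiff _ _ _]mulrC; apply: (eq_has_integral measurableT) => xi _.
    by rewrite mulrC /K/= mulrA.
  - move=> xi; have := has_integralZl measurableT `|wave w xi (dotr xi x)| (has_integral_riesz xi m0 s0 sm).
    exact.
exists (c^-1 * v).
  have := has_integralZl measurableT c^-1 hv1; apply: (eq_has_integral measurableT) => xi _.
  by field; rewrite gt_eqF.
have pn : (2 * pi) ^+ n != 0 :> R by rewrite expf_neq0// mulf_neq0// gt_eqF// pi_gt0.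
have := has_integralZl measurableT ((2 * pi) ^- n) hv2.
rewrite -/c (mulVKf (lt0r_neq0 c0)).
apply: (eq_has_integral measurableT) => y _.
by rewrite mulKf.
Qed.

(** The integrand changes sign under [xi -> - xi]. *)
Lemma has_integral_symbol_wave_odd B w x : 0 <= B -> test_fun B w ->
  has_integral (L n) setT (fun xi => enorm xi `^ (2 * s) * wave w xi (dotr xi x - pi / 2)) 0.
Proof.
move=> B0 tw.
have [v hv] : exists v,
    has_integral (L n) setT (fun xi => enorm xi `^ (2 * s) * wave w xi (dotr xi x - pi / 2)) v.
  apply: (integrable_symbol_wave B0 tw); apply: measurable_funB => //.
  by apply: measurable_fun_dotr => //; exact: measurable_cst.
suff v0 : v = - v by have -> : 0 = v by lra.
have h := has_integral_rVN hv; apply: (has_integral_uniq h).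
apply: (eq_has_integral measurableT _ (has_integralN hv)) => xi _.
have -> : enorm (- xi) = enorm xi.
  by rewrite /enorm; congr Num.sqrt; apply: eq_bigr => i _; rewrite mxE sqrrN.
rewrite -(mulrN (enorm _ `^ _)); congr (_ * _).
have h1 := has_integralN (has_integral_wave xi (dotr xi x - pi / 2) B0 tw).
have h2 := has_integral_wave (- xi) (dotr (- xi) x - pi / 2) B0 tw.
apply: (has_integral_uniq h1); apply: (eq_has_integral measurableT _ h2) => y _.
rewrite -(mulrN (w y)) !dotrNl; congr (_ * _).
rewrite -cosN (_ : - _ = dotr xi x - dotr xi y + pi / 2); last by lra.
by rewrite (_ : _ - pi / 2 - _ = dotr xi x - dotr xi y - pi / 2) ?cosDpihalf ?cosBpihalf//; lra.
Qed.

Lemma riesz_op_bounded B w : 0 <= B -> test_fun B w ->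
  exists2 C : R, 0 <= C & forall x, `|riesz_op w x| <= C.
Proof.
move=> B0 tw; have [C C0 hC] := symbol_wave_bound B0 tw.
exists ((2 * pi) ^- n * (riesz_const n m s * (C * pi ^+ n))) => [|x].
  apply: mulr_ge0; first by rewrite invr_ge0 exprn_ge0// mulr_ge0// pi_ge0.
  apply: mulr_ge0; first by apply: ltW; exact: (cNms_riesz_const n m0 s0 sm).1.
  by rewrite mulr_ge0// exprn_ge0// pi_ge0.
have [v hv hT] := has_integral_riesz_op x B0 tw.
rewrite /riesz_op (has_integral_Rintegral hT) normrM [`|_ * v|]normrM.
have c0 : 0 < riesz_const n m s := (cNms_riesz_const n m0 s0 sm).1.
rewrite (gtr0_norm c0) ger0_norm ?invr_ge0 ?exprn_ge0 ?mulr_ge0 ?pi_ge0//.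
rewrite ler_wpM2l ?invr_ge0 ?exprn_ge0 ?mulr_ge0 ?pi_ge0// ler_wpM2l ?(ltW c0)//.
exact: (has_integral_norm_le hv (has_integralZl measurableT C (@has_integral_cauchy_prod R n))).
Qed.

Lemma has_integral_box_affine B x (k : R) : 0 <= B -> 1 <= `|k| ->
  exists2 v, has_integral (L n) setT (fun y => box B (x + k *: y)) v & v <= (2 * B) ^+ n.
Proof.
move=> B0 k1.
have V (c : R) : 1 <= c -> c ^- n * (2 * B) ^+ n <= (2 * B) ^+ n.
  move=> c1; rewrite ler_piMl ?exprn_ge0 ?mulr_ge0//.
  by rewrite invf_le1 ?exprn_gt0 ?exprn_ege1// (lt_le_trans ltr01).
have hb := has_integral_box n B0.
case: (ger0P k) k1 => k0 k1.
  exists (k ^- n * (2 * B) ^+ n); last exact: V.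
  have := has_integral_rV_affine x (lt_le_trans ltr01 k1) hb.
  by apply: (eq_has_integral measurableT) => y _; rewrite addrC.
exists ((- k) ^- n * (2 * B) ^+ n); last exact: V.
have := has_integral_rV_affine (- x) (lt_le_trans ltr01 k1) hb.
apply: (eq_has_integral measurableT) => y _.
by rewrite !boxE// scaleNr -opprD normrN addrC.
Qed.

Lemma mx_norm_le_enorm x : `|x| <= enorm x.
Proof.
apply/mx_norm_leP; first exact: enorm_ge0.
move=> i; rewrite -sqrtr_sqr; apply: ler_wsqrtr.
by rewrite (bigD1 i)//= lerDl sumr_ge0// => j _; exact: sqr_ge0.
Qed.

(** Outside the support only the nodes [k != 0] contribute, and [x + k y] can reach the support
    only if [y] is at least as large as [|x| / (2 m)], which bounds the kernel. *)
Lemma riesz_op_decay B w : 0 <= B -> test_fun B w ->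
  exists2 C : R, 0 <= C & forall x, 2 * B < `|x| ->
    `|riesz_op w x| <= C / (`|x| / (2 * m%:R)) `^ (n%:R + 2 * s).
Proof.
move=> B0 tw; have [M M0 wM] := test_fun_bounded B0 tw.
have p0 : 0 < n%:R + 2 * s by rewrite ltr_wpDl// mulr_gt0.
have mR : 0 < m%:R :> R by rewrite ltr0n.
exists (\sum_(j < (2 * m).+1) `|dcoef m j : R| * (M * (2 * B) ^+ n)) => [|x Bx].
  by apply: sumr_ge0 => j _; rewrite !mulr_ge0 ?exprn_ge0 ?mulr_ge0.
have x0 : 0 < `|x| by rewrite (le_lt_trans _ Bx)// mulr_ge0.
pose A := `|x| / (2 * m%:R); have A0 : 0 < A by rewrite divr_gt0// mulr_gt0.
pose D := (A `^ (n%:R + 2 * s))^-1.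
have D0 : 0 <= D by rewrite invr_ge0 powR_ge0.
have [v hv hT] := has_integral_riesz_op x B0 tw.
have /choice[b hb] : forall j : 'I_(2 * m).+1, exists b, 
    [/\ has_integral (L n) setT (fun y => (dnode m j != 0 :> R)%:R * box B (x + dnode m j *: y)) b &
      b <= (2 * B) ^+ n].
  move=> j; have [->|jm] := eqVneq (dnode m j : R) 0.
    exists 0; split; last by rewrite exprn_ge0// mulr_ge0.
    have := has_integralZl measurableT 0 (has_integral_box n B0); rewrite mul0r.
    by apply: (eq_has_integral measurableT) => y _; rewrite !mul0r.
  have k1 : 1 <= `|dnode m j : R|.
    have zE : dnode m j = (j%:Z - m%:Z)%:~R :> R by rewrite /dnode rmorphB.
    rewrite zE -intr_norm ler1z; move: jm; rewrite zE intr_eq0; move: (j%:Z - m%:Z) => z z0.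
    by rewrite -gtz0_ge1 normr_gt0.
  have [u hu ub] := has_integral_box_affine x B0 k1; exists u; split => //.
  by apply: (eq_has_integral measurableT _ hu) => y _; rewrite mul1r.
rewrite /riesz_op (has_integral_Rintegral hT).
have h := has_integral_sum measurableT (index_enum 'I_(2 * m).+1)
  (fun j => has_integralZl measurableT (`|dcoef m j| * (M * D)) (hb j).1).
apply: (le_trans (has_integral_norm_le hT h _)); last first.
  rewrite big_distrl/=; apply: ler_sum => j _; rewrite -/D -!mulrA ler_wpM2l// ler_wpM2l//.
  by rewrite mulrC ler_wpM2r// (hb j).2.
move=> y; rewrite normrM.
apply: (@le_trans _ _ (\sum_(j < (2 * m).+1) `|dcoef m j : R| *
  (`|w (x + dnode m j *: y)| * `|(enorm y `^ (n%:R + 2 * s))^-1|))).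
  rewrite /ddiff; under [leRHS]eq_bigr do rewrite mulrA -normrM.
  by rewrite -big_distrl/= ler_wpM2r// ler_norm_sum.
apply: ler_sum => j _; rewrite -mulrA ler_wpM2l//.
have [jm|jm] := eqVneq (dnode m j : R) 0.
  by rewrite jm scale0r addr0 mul0r mulr0 tw.2 ?normr0 ?mul0r//; lra.
rewrite mul1r boxE//; case: ifPn => [xB|]; last first.
  by rewrite -ltNge => xB; rewrite tw.2// normr0 !mulr0 mul0r.
rewrite mulr1 ler_pM// ger0_norm ?invr_ge0 ?powR_ge0//.
have Ay : A <= enorm y.
  apply: le_trans (mx_norm_le_enorm y).
  rewrite /A ler_pdivrMr ?mulr_gt0//.
  have km : `|dnode m j : R| <= m%:R.
    rewrite /dnode ler_norml; apply/andP; split; first by rewrite lerBrDl addrN.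
    rewrite lerBlDr -natrD ler_nat addnn -mul2n -ltnS; exact: ltn_ord.
  have h1 : `|x| <= `|x + dnode m j *: y| + `|dnode m j *: y|.
    by rewrite -[in leLHS](addrK (dnode m j *: y) x) ler_normB.
  rewrite normrZ in h1.
  have h2 : `|dnode m j : R| * `|y| <= m%:R * `|y| by rewrite ler_wpM2r.
  lra.
rewrite lef_pV2 ?posrE ?powR_gt0//; last exact: lt_le_trans Ay.
by apply: ge0_ler_powR; rewrite ?nnegrE ?(ltW p0) ?(ltW A0) ?enorm_ge0.
Qed.

(** Boundedness is used on a fixed ball and the decay outside it; there the exponent [n + 2s] may
    be lowered to [n], the argument of the power being at least [1]. *)
Lemma riesz_op_sqr_le B w : 0 <= B -> test_fun B w ->
  exists C : R, forall x, riesz_op w x ^+ 2 <= C * cauchy_prod x.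
Proof.
move=> B0 tw; have [C1 C10 h1] := riesz_op_bounded B0 tw.
have [C2 C20 h2] := riesz_op_decay B0 tw.
have mR : 0 < m%:R :> R by rewrite ltr0n.
have m1 : 1 <= m%:R :> R by rewrite ler1n.
(* Beyond r0 the decay estimate applies and |x| / (2 m) is at least 1. *)
pose r0 : R := 2 * B + 2 * m%:R.
pose K1 := C1 ^+ 2 * (1 + r0 ^+ 2) ^+ n.
pose K2 := C2 ^+ 2 * (2 * (2 * m%:R) ^+ 2) ^+ n.
have K10 : 0 <= K1 by rewrite mulr_ge0 ?sqr_ge0// exprn_ge0// addr_ge0// sqr_ge0.
have K20 : 0 <= K2 by rewrite mulr_ge0 ?sqr_ge0// exprn_ge0// mulr_ge0// sqr_ge0.
exists (K1 + K2) => x.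
have cp0 : 0 <= cauchy_prod x.
  by apply: prodr_ge0 => i _; rewrite invr_ge0 addr_ge0// sqr_ge0.
have sq (c : R) : `|riesz_op w x| <= c -> riesz_op w x ^+ 2 <= c ^+ 2.
  by move=> h; rewrite -real_normK ?num_real// lerXn2r ?nnegrE// (le_trans _ h).
rewrite mulrDl; have [xr|rx] := leP `|x| r0.
  apply: (@le_trans _ _ (K1 * cauchy_prod x)); last by rewrite lerDl mulr_ge0.
  rewrite (le_trans (sq _ (h1 x)))// /K1 -mulrA ler_peMr ?sqr_ge0//.
  have t0 : 0 < 1 + r0 ^+ 2 by rewrite ltr_pwDl// sqr_ge0.
  rewrite -ler_pdivrMl ?exprn_gt0// mulr1; apply: cauchy_prod_ge.
  by rewrite lerXn2r ?nnegrE// (le_trans _ xr).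
apply: (@le_trans _ _ (K2 * cauchy_prod x)); last by rewrite lerDr mulr_ge0.
have rx2 : 2 * B < `|x| by rewrite (le_lt_trans _ rx)// lerDl mulr_ge0// ltW.
have xm : 2 * m%:R <= `|x| by rewrite (le_trans _ (ltW rx))// lerDr mulr_ge0.
have x0 : 0 < `|x| by rewrite (lt_le_trans _ xm)// mulr_gt0.
pose A := `|x| / (2 * m%:R).
have A1 : 1 <= A by rewrite ler_pdivlMr ?mulr_gt0// mul1r.
have A0 : 0 < A by exact: lt_le_trans A1.
have hA : `|riesz_op w x| <= C2 / A ^+ n.
  rewrite (le_trans (h2 x rx2))// ler_wpM2l// lef_pV2 ?posrE ?powR_gt0 ?exprn_gt0//.
  rewrite -powR_mulrn ?(ltW A0)//; apply: ler_powR => //.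
  by rewrite lerDl mulr_ge0// ltW.
rewrite (le_trans (sq _ hA))// exprMn /K2 -mulrA ler_wpM2l ?sqr_ge0//.
apply: (@le_trans _ _ ((2 * (2 * m%:R) ^+ 2) ^+ n * (1 + `|x| ^+ 2) ^- n)); last first.
  by rewrite ler_wpM2l ?cauchy_prod_ge// exprn_ge0// mulr_ge0// sqr_ge0.
rewrite exprVn -exprM mulnC exprM -!exprVn -exprMn lerXn2r ?nnegrE.
- by [].
- exact: sqr_ge0.
- by rewrite mulr_ge0 ?mulr_ge0 ?sqr_ge0// invr_ge0 addr_ge0 ?sqr_ge0.
have x1 : 1 <= `|x| ^+ 2 by rewrite exprn_ege1// (le_trans _ xm)//; lra.
have -> : A^-1 ^+ 2 = (2 * m%:R) ^+ 2 / `|x| ^+ 2 by rewrite /A invf_div expr_div_n.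
rewrite [2 * _ ^+ 2]mulrC -[leRHS]mulrA ler_wpM2l ?sqr_ge0//.
rewrite ler_pdivlMr ?ltr_pwDl ?sqr_ge0// mulrC ler_pdivrMr ?exprn_gt0//.
lra.
Qed.

Lemma measurable_riesz_op w : measurable_fun setT w -> measurable_fun setT (riesz_op w).
Proof. by move=> mw; exact: (measurable_Rintegral (L n) (measurable_ddiff_joint mw)). Qed.

End difference_operator.

Section square_integrable.
Context d (T : measurableType d) (R : realType) (mu : {measure set T -> \bar R}).

Lemma Lfun2_dominated (f g : T -> R) v : measurable_fun setT f -> has_integral mu setT g v ->
  (forall x, f x ^+ 2 <= g x) -> f \in Lfun mu 2%:E.
Proof.
move=> mf gv fg; rewrite inE/=; apply/andP; split; rewrite inE//=.
rewrite /finite_norm unlock poweR_lty//.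
apply: (@le_lt_trans _ _ (\int[mu]_x (g x)%:E)%E); last by rewrite gv.2 ltry.
apply: ge0_le_integral => //.
- by move=> x _; exact: poweR_ge0.
- apply/measurable_EFinP; apply: (measurableT_comp (measurable_powR _)).
  exact: measurableT_comp.
- by apply/measurable_EFinP; exact: has_integral_measurable gv.
- move=> x _; rewrite /= lee_fin powR_mulrn// real_normK ?num_real//; exact: fg.
Qed.

End square_integrable.

(** * Complex test functions and the theorem *)

Section complex_parts.
Context {R : realType}.
Local Open Scope complex_scope.
Implicit Types (a : R) (z : R[i]).

Lemma Re_realM a z : complex.Re (a%:C * z) = a * complex.Re z.
Proof. by case: z => b c /=; rewrite mul0r subr0. Qed.

Lemma Im_realM a z : complex.Im (a%:C * z) = a * complex.Im z.
Proof. by case: z => b c /=; rewrite mul0r addr0. Qed.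

Lemma Re_sum I (r : seq I) (F : I -> R[i]) :
  complex.Re (\sum_(i <- r) F i) = \sum_(i <- r) complex.Re (F i).
Proof. by apply: big_morph => // -[a b] [c d]. Qed.

Lemma Im_sum I (r : seq I) (F : I -> R[i]) :
  complex.Im (\sum_(i <- r) F i) = \sum_(i <- r) complex.Im (F i).
Proof. by apply: big_morph => // -[a b] [c d]. Qed.

End complex_parts.

Section assembly.
Context {R : realType}.
Notation L := (@lebesgue_rV R).
Local Open Scope complex_scope.
Variables (n m : nat) (s : R).
Hypotheses (m0 : (0 < m)%N) (s0 : 0 < s) (sm : s < m%:R).
Implicit Types (x y xi : 'rV[R]_n) (w : 'rV[R]_n -> R) (u : 'rV[R]_n -> R[i]).

Let re u x := complex.Re (u x).
Let im u x := complex.Im (u x).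

Lemma test_function_support u : is_test_function u ->
  exists2 B : R, 0 <= B & test_fun B (re u) /\ test_fun B (im u).
Proof.
move=> [su1 su2 /compact_bounded[M [_ hM]]].
have hB x : `|M| + 1 < `|x| -> u x = 0.
  move=> Bx; apply/eqP; apply: contraTT Bx => ux; rewrite -leNgt.
  apply: hM; first by rewrite (le_lt_trans (ler_norm M))// ltrDl.
  exact: subset_closure.
exists (`|M| + 1); first by rewrite addr_ge0.
by split; split=> // x /hB ux; rewrite /re /im ux.
Qed.

Lemma delta_dcoef u x y :
  delta m u x y = \sum_(j < (2 * m).+1) (dcoef m j)%:C * u (x + dnode m j *: y).
Proof.
apply: eq_bigr => j _ /=; congr (_ * u (_ + _ *: y)); last by rewrite /dnode rmorphB.
have jm : (j <= 2 * m)%N by rewrite -ltnS.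
have -> : absz (m%:Z - (j%:Z - m%:Z))%R = (2 * m - j)%N.
  by rewrite (_ : m%:Z - _ = (2 * m - j)%N%:Z)//; rewrite -subzn// PoszM; ring.
rewrite bin_sub// /dcoef rmorphM rmorphXn rmorphN1 rmorph_nat; congr (_ * _).
have u1 : (-1 : R[i]) \is a GRing.unit by rewrite unitrN unitr1.
by rewrite exprzDr// -exprz_inv invrN1 exprD.
Qed.

Lemma Re_delta u x y : complex.Re (delta m u x y) = ddiff m (re u) x y.
Proof. by rewrite delta_dcoef Re_sum; apply: eq_bigr => j _; rewrite Re_realM. Qed.

Lemma Im_delta u x y : complex.Im (delta m u x y) = ddiff m (im u) x y.
Proof. by rewrite delta_dcoef Im_sum; apply: eq_bigr => j _; rewrite Im_realM. Qed.

Lemma Re_Lms_integrand u x y : complex.Re (Lms_integrand m s u x y) =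
  ddiff m (re u) x y / enorm y `^ (n%:R + 2 * s).
Proof. by rewrite /Lms_integrand -fmorphV mulrC Re_realM Re_delta mulrC. Qed.

Lemma Im_Lms_integrand u x y : complex.Im (Lms_integrand m s u x y) =
  ddiff m (im u) x y / enorm y `^ (n%:R + 2 * s).
Proof. by rewrite /Lms_integrand -fmorphV mulrC Im_realM Im_delta mulrC. Qed.

Lemma Lms_riesz_op u x :
  Lms m s u x = (cNms n m s / 2)%:C * (riesz_op m s (re u) x +i* riesz_op m s (im u) x).
Proof.
rewrite /Lms /cintegral; congr (_ * (_ +i* _)); apply: eq_Rintegral => y _.
  exact: Re_Lms_integrand.
exact: Im_Lms_integrand.
Qed.

(** The addition formula for the cosine, under the integral sign. *)
Lemma wave_shift B w xi a : 0 <= B -> test_fun B w ->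
  wave w xi a = cos a * wave w xi 0 - sin a * wave w xi (- (pi / 2)).
Proof.
move=> B0 tw; apply: (has_integral_uniq (has_integral_wave xi a B0 tw)).
have h1 := has_integralZl measurableT (cos a) (has_integral_wave xi 0 B0 tw).
have h2 := has_integralZl measurableT (sin a) (has_integral_wave xi (- (pi / 2)) B0 tw).
apply: (eq_has_integral measurableT _ (has_integralB h1 h2)) => y _.
have -> : - (pi / 2) - dotr xi y = - (dotr xi y + pi / 2) by rewrite opprD addrC.
by rewrite sub0r !cosN cosDpihalf cosB; ring.
Qed.

(** The sine in the imaginary part of the exponential is a cosine with phase shifted by a quarter
    period. *)
Lemma fourier_wave B u xi : 0 <= B -> test_fun B (re u) -> test_fun B (im u) ->
  fourier u xi = ((2 * pi) `^ (- (n%:R / 2)))%:C *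
    ((wave (re u) xi 0 - wave (im u) xi (- (pi / 2))) +i*
     (wave (re u) xi (- (pi / 2)) + wave (im u) xi 0)).
Proof.
move=> B0 t1 t2; rewrite /fourier /cintegral; congr (_ * (_ +i* _)).
  apply: has_integral_Rintegral.
  have h1 := has_integral_wave xi 0 B0 t1.
  have h2 := has_integral_wave xi (- (pi / 2)) B0 t2.
  apply: (eq_has_integral measurableT _ (has_integralB h1 h2)) => y _.
  have -> : - (pi / 2) - dotr xi y = - (dotr xi y + pi / 2) by rewrite opprD addrC.
  rewrite sub0r !cosN cosDpihalf /re /im /expi cosN sinN; case: (u y) => a b /=; ring.
apply: has_integral_Rintegral.
have h1 := has_integral_wave xi (- (pi / 2)) B0 t1.
have h2 := has_integral_wave xi 0 B0 t2.
apply: (eq_has_integral measurableT _ (has_integralD h1 h2)) => y _.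
have -> : - (pi / 2) - dotr xi y = - (dotr xi y + pi / 2) by rewrite opprD addrC.
rewrite sub0r !cosN cosDpihalf /re /im /expi cosN sinN; case: (u y) => a b /=; ring.
Qed.

Lemma cintegrable_Lms_integrand u x : is_test_function u -> cintegrable (Lms_integrand m s u x).
Proof.
move=> /test_function_support[B B0 [t1 t2]].
have [v1 _ h1] := has_integral_riesz_op m0 s0 sm x B0 t1.
have [v2 _ h2] := has_integral_riesz_op m0 s0 sm x B0 t2.
split.
  by under eq_fun do rewrite Re_Lms_integrand; exact: h1.1.
by under eq_fun do rewrite Im_Lms_integrand; exact: h2.1.
Qed.

Lemma riesz_op_L2 B w c : 0 <= B -> test_fun B w ->
  (fun x => c * riesz_op m s w x) \in Lfun (L n) 2%:E.
Proof.
move=> B0 tw; have [C hC] := riesz_op_sqr_le m0 s0 sm B0 tw.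
apply: (Lfun2_dominated _ (has_integralZl measurableT (c ^+ 2 * C) (@has_integral_cauchy_prod R n))).
  apply: measurable_funM => //; apply: measurable_riesz_op => //.
  exact: (test_fun_measurable tw).
by move=> x; rewrite exprMn -mulrA ler_wpM2l ?sqr_ge0.
Qed.

Lemma in_L2_Lms u : is_test_function u -> in_L2 (Lms m s u).
Proof.
move=> /test_function_support[B B0 [t1 t2]]; split.
  under eq_fun do rewrite Lms_riesz_op Re_realM.
  exact: riesz_op_L2 B0 t1.
under eq_fun do rewrite Lms_riesz_op Im_realM.
exact: riesz_op_L2 B0 t2.
Qed.

Lemma cintegrable_symbol_fourier u : is_test_function u -> cintegrable (symbol_fourier s u).
Proof.
move=> /test_function_support[B B0 [t1 t2]].
pose c : R := (2 * pi) `^ (- (n%:R / 2)).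
have h w (a : R) : test_fun B w ->
    exists v, has_integral (L n) setT (fun xi => enorm xi `^ (2 * s) * wave w xi a) v.
  by move=> tw; exact: (integrable_symbol_wave s0 sm B0 tw (measurable_cst a)).
have [v1 h1] := h _ 0 t1; have [v2 h2] := h _ (- (pi / 2)) t2.
have [v3 h3] := h _ (- (pi / 2)) t1; have [v4 h4] := h _ 0 t2.
split.
  have [+ _] := has_integralZl measurableT c (has_integralB h1 h2).
  apply: eq_integrable => // xi _; rewrite /symbol_fourier (fourier_wave xi B0 t1 t2) !Re_realM/=.
  by congr EFin; rewrite -/c; ring.
have [+ _] := has_integralZl measurableT c (has_integralD h3 h4).
apply: eq_integrable => // xi _; rewrite /symbol_fourier (fourier_wave xi B0 t1 t2) !Im_realM/=.
by congr EFin; rewrite -/c; ring.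
Qed.

(** The two normalising powers of [2 pi] multiply to the one of the inversion formula, and the
    constant cancels by [cNms_riesz_const]. *)
Lemma Lms_inv_fourier u x : is_test_function u -> Lms m s u x = inv_fourier (symbol_fourier s u) x.
Proof.
move=> /test_function_support[B B0 [t1 t2]].
have [v1 e1 h1] := has_integral_riesz_op m0 s0 sm x B0 t1.
have [v2 e2 h2] := has_integral_riesz_op m0 s0 sm x B0 t2.
have o1 := has_integral_symbol_wave_odd s0 sm x B0 t1.
have o2 := has_integral_symbol_wave_odd s0 sm x B0 t2.
pose c : R := (2 * pi) `^ (- (n%:R / 2)).
have pi20 : 0 < 2 * pi :> R by rewrite mulr_gt0 ?pi_gt0.
have c2 : c * c = (2 * pi) ^- n.
  rewrite /c -powRD; last by apply/implyP => _; rewrite gt_eqF.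
  by rewrite -opprD -splitr powRN powR_mulrn// ltW.
have k2 : cNms n m s / 2 * riesz_const n m s = 1.
  by rewrite mulrAC (cNms_riesz_const n m0 s0 sm).2 divff.
have E xi : symbol_fourier s u xi * expi (dotr xi x) =
    (c * (enorm xi `^ (2 * s) * wave (re u) xi (dotr xi x) -
          enorm xi `^ (2 * s) * wave (im u) xi (dotr xi x - pi / 2))) +i*
    (c * (enorm xi `^ (2 * s) * wave (re u) xi (dotr xi x - pi / 2) +
          enorm xi `^ (2 * s) * wave (im u) xi (dotr xi x))).
  rewrite /symbol_fourier (fourier_wave xi B0 t1 t2) -/c /expi.
  rewrite !(wave_shift xi (dotr _ _) B0 t1) !(wave_shift xi (dotr _ _) B0 t2).
  rewrite !(wave_shift xi (_ - _) B0 t1) !(wave_shift xi (_ - _) B0 t2).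
  rewrite cosBpihalf sinBpihalf.
  by apply/eqP; rewrite eq_complex/= !mul0r; apply/andP; split; apply/eqP; ring.
rewrite Lms_riesz_op /riesz_op (has_integral_Rintegral h1) (has_integral_Rintegral h2).
rewrite /inv_fourier -/c /cintegral.
have -> : \int[L n]_xi complex.Re (symbol_fourier s u xi * expi (dotr xi x)) = c * (v1 - 0).
  apply: has_integral_Rintegral.
  apply: (eq_has_integral measurableT _ (has_integralZl measurableT c (has_integralB e1 o2))) => xi _.
  by rewrite E.
have -> : \int[L n]_xi complex.Im (symbol_fourier s u xi * expi (dotr xi x)) = c * (0 + v2).
  apply: has_integral_Rintegral.
  apply: (eq_has_integral measurableT _ (has_integralZl measurableT c (has_integralD o1 e2))) => xi _.
  by rewrite E.
have K v : cNms n m s / 2 * ((2 * pi) ^- n * (riesz_const n m s * v)) = c * (c * v).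
  by rewrite (mulrA c) c2 mulrCA; congr (_ * _); rewrite mulrA k2 mul1r.
by apply/eqP; rewrite eq_complex !Re_realM !Im_realM/= subr0 add0r !K !eqxx.
Qed.

End assembly.
Unset Implicit Arguments.

Theorem theorem1p9 (R : realType) (N m : nat) (s : R)
  (hN : (0 < N)%N) (hm : (0 < m)%N) (hs0 : 0 < s) (hsm : s < m%:R)
  (u : 'rV[R]_N -> complex R) (hu : is_test_function u) :
  [/\ forall x : 'rV[R]_N, cintegrable (Lms_integrand m s u x),
      in_L2 (Lms m s u),
      cintegrable (symbol_fourier s u) &
      forall x : 'rV[R]_N, Lms m s u x = inv_fourier (symbol_fourier s u) x].
Proof.
split.
- by move=> x; exact: cintegrable_Lms_integrand.
- exact: in_L2_Lms.
- exact: (cintegrable_symbol_fourier hs0 hsm).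
- by move=> x; exact: Lms_inv_fourier.
Qed.
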